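(* Let all parameters except $D>0$ be fixed, and let $\Lambda_D(\alpha)$, $c^*(D)$, $\Lambda_f(\alpha)$, $c_f^*$ be as in the context. Assume that $\sup_{D>0}\Lambda_D(0)<0$ and that $\Lambda_f(0)<0$. (i) The spreading speed $c^*(D)$ converges to some $c_0$ as $D\to0$. If, moreover, $$\max_{y\in\partial\omega}\partial_u g(y,0)<-2\Lambda_f(0),$$ then $c_0\in(0,c_f^* )$. (ii) We have $c^*(D)\to+\infty$ as $D\to+\infty$; more precisely, there exist $A,B>0$ such that $$A\sqrt{D}\le c^*(D)\le B\sqrt{D}\qquad\text{for all } D \text{ large enough.}$$
   Context: Setting. $N\ge 1$; $\omega\subset\mathbb{R}^N$ is open, bounded, connected, with smooth boundary (each connected component of $\partial\omega$ is a smooth hypersurface). $d,D,\mu,\nu>0$ are constants, $0<r<1$, and $\kappa\in C^{1,r}(\partial\omega)$ is nonnegative and not identically $0$. The functions $f\in C^{1,r}(\omega\times[0,+\infty))$ and $g\in C^{1,r}(\partial\omega\times[0,+\infty))$ satisfy: $f(\cdot,0)\equiv 0\equiv g(\cdot,0)$; $v\mapsto f(\cdot,v)/v$ is decreasing and $u\mapsto g(\cdot,u)/u$ is nonincreasing; there is $M>0$ such that for all $u,v\ge M$, $f(y,v)\le 0$ for all $y\in\omega$ and $g(y,u)\le0$ for all $y\in\partial\omega$. For $\alpha\in\mathbb{R}$ and $D>0$ the principal eigenvalue is $$\Lambda_D(\alpha)=\min\Big\{\mathcal{F}_D(\alpha)[U,V]:\ (U,V)\in H^1(\partial\omega)\times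 H^1(\omega),\ \int_{\partial\omega}U^2+\int_\omega V^2=1\Big\},$$ $$\mathcal{F}_D(\alpha)[U,V]=D\int_{\partial\omega}|\nabla U|^2-\int_{\partial\omega}(D\alpha^2+\partial_u g(y,0))U^2+d\int_\omega|\nabla V|^2-\int_\omega(d\alpha^2+\partial_v f(y,0))V^2+\int_{\partial\omega}\kappa(y)(\sqrt{\mu}U-\sqrt{\nu}V)^2$$ (traces of $V$ on $\partial\omega$; tangential gradient of $U$, absent when $N=1$). When $\Lambda_D(0)<0$, the spreading speed of the bulk-surface system ($\partial_t v=d\Delta v+f(y,v)$ in $\mathbb{R}\times\omega$, $d\,\partial_nv=\kappa(\mu u-\nu v)$ on $\mathbb{R}\times\partial\omega$, $\partial_tu=D\Delta u+g(y,u)+\kappa(\nu v-\mu u)$ on $\mathbb{R}\times\partial\omega$) is $$c^*(D)=\min_{\alpha>0}\frac{-\Lambda_D(\alpha)}{\alpha}.$$ For the bulk equation alone with Neumann boundary conditions, $$\Lambda_f(\alpha)=\min_{V\in H^1(\omega),\,V\not\equiv0}\frac{d\int_\omega|\nabla V|^2-\int_\omega(d\alpha^2+\partial_vf(y,0))V^2}{\int_\omega V^2}=\Lambda_f(0)-d\alpha^2,\qquad c_f^*=\min_{\alpha>0}\frac{-\Lambda_f(\alpha)}{\alpha},$$ the latter being well defined when $\Lambda_f(0)<0$. *)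

(* Defs.v *)
From HB Require Import structures.
From mathcomp Require Import all_boot all_order all_algebra.
From mathcomp Require Import all_classical all_reals all_analysis.

Set Implicit Arguments.
Unset Strict Implicit.
Unset Printing Implicit Defensive.

Import Order.TTheory GRing.Theory Num.Theory.
Import numFieldNormedType.Exports.

Local Open Scope classical_set_scope.
Local Open Scope ring_scope.

(* The library norm on 'rV[R]_n is the sup norm, not the Euclidean one. *)
Definition dot (R : realType) (n : nat) (u v : 'rV[R]_n) : R :=
  \sum_(i < n) u 0 i * v 0 i.

Definition enorm (R : realType) (n : nat) (u : 'rV[R]_n) : R :=
  Num.sqrt (dot u u).

(* mu_ext takes infima over countable covers by measurable sets; on the alias
   all_sets T every set is measurable, so that it becomes Caratheodory's
   construction from an arbitrary weight on the subsets of T. *)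
Definition all_sets (T : Type) : Type := T.

Section all_sets.
Variable T : pointedType.
HB.instance Definition _ := Pointed.on (all_sets T).
HB.instance Definition _ := @isMeasurable.Build default_measure_display
  (all_sets T) discrete_measurable discrete_measurable0
  discrete_measurableC discrete_measurableU.
End all_sets.

Section lebesgue_outer.
Local Open Scope ereal_scope.
Variables (R : realType) (n : nat).

Definition box_weight (A : set 'rV[R]_n) : \bar R :=
  if `[< A = set0 >] then 0 else
  ereal_inf [set x | exists a b : 'rV[R]_n,
    [/\ (forall i, (a 0 i <= b 0 i)%R),
        A `<=` [set y | forall i, (a 0 i <= y 0 i <= b 0 i)%R]
      & x = (\prod_(i < n) (b 0 i - a 0 i))%R%:E]].

Definition lebesgue_outer (A : set 'rV[R]_n) : \bar R :=
  mu_ext (box_weight : set (all_sets 'rV[R]_n) -> \bar R) A.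

Lemma box_weight0 : box_weight set0 = 0.
Proof. by rewrite /box_weight asboolT. Qed.

Lemma box_weight_ge0 A : 0 <= box_weight A.
Proof.
rewrite /box_weight; case: ifPn => // _.
apply: le_ereal_inf_tmp => _ [a [b [ab _ ->]]].
by rewrite lee_fin prodr_ge0// => i _; rewrite subr_ge0.
Qed.

HB.instance Definition _ := isOuterMeasure.Build R 'rV[R]_n lebesgue_outer
  (@mu_ext0 _ (all_sets 'rV[R]_n) R _ box_weight0 box_weight_ge0)
  (@mu_ext_ge0 _ (all_sets 'rV[R]_n) R _ box_weight_ge0)
  (@le_mu_ext _ (all_sets 'rV[R]_n) R box_weight)
  (@mu_ext_sigma_subadditive _ (all_sets 'rV[R]_n) R _ box_weight_ge0).

End lebesgue_outer.

(* Volume of the unit ball of R^s, by omega_(s+2) = 2 pi / (s+2) omega_s. *)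
Fixpoint unit_ball_volume (R : realType) (s : nat) : R :=
  match s with
  | 0 => 1
  | 1 => 2
  | s'.+2 => 2 * pi / (s'.+2)%:R * unit_ball_volume R s'
  end.

Section hausdorff_outer.
Local Open Scope ereal_scope.
Variables (R : realType) (n s : nat).

Definition ediam (A : set 'rV[R]_n) : \bar R :=
  ereal_sup [set x | exists y z, [/\ A y, A z & x = (enorm (y - z))%:E]].

(* For s = 0 every nonempty set has weight 1: counting measure. *)
Definition hausdorff_weight (delta : R) (A : set 'rV[R]_n) : \bar R :=
  if `[< A = set0 >] then 0 else
  if ediam A <= delta%:E then
    (unit_ball_volume R s / 2 ^+ s)%R%:E * ediam A ^+ s
  else +oo.

Definition hausdorff_content (delta : R) (A : set 'rV[R]_n) : \bar R :=
  mu_ext (hausdorff_weight delta : set (all_sets 'rV[R]_n) -> \bar R) A.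

(* The s-dimensional Hausdorff outer measure, normalized so as to agree with
   the surface measure on s-dimensional submanifolds of R^n. *)
Definition hausdorff_outer (A : set 'rV[R]_n) : \bar R :=
  ereal_sup [set hausdorff_content delta A
            | delta in [set delta : R | (0 < delta)%R]].

Lemma unit_ball_volume_ge0 k : (0 <= unit_ball_volume R k)%R.
Proof.
have [m] := ubnP k; elim: m k => // m IH [|[|k]] km //=.
rewrite !mulr_ge0 ?pi_ge0 ?invr_ge0 ?IH//.
by move: km; rewrite !ltnS => /ltnW.
Qed.

Lemma hausdorff_weight0 delta : hausdorff_weight delta set0 = 0.
Proof. by rewrite /hausdorff_weight asboolT. Qed.

Lemma hausdorff_weight_ge0 delta A : 0 <= hausdorff_weight delta A.
Proof.
rewrite /hausdorff_weight; case: ifPn => // /asboolPn/eqP/set0P[x Ax].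
case: ifPn => // _.
rewrite mule_ge0 ?lee_fin ?divr_ge0 ?exprn_ge0 ?unit_ball_volume_ge0//.
apply: expe_ge0; apply: (@le_trans _ _ (enorm (x - x))%:E).
  by rewrite lee_fin sqrtr_ge0.
by apply: ereal_sup_ubound; exists x, x.
Qed.

Lemma hausdorff_content_le delta A :
  (0 < delta)%R -> hausdorff_content delta A <= hausdorff_outer A.
Proof. by move=> d0; apply: ereal_sup_ubound; exists delta. Qed.

Lemma hausdorff_outer_ge0 A : 0 <= hausdorff_outer A.
Proof.
apply: le_trans (hausdorff_content_le A (@ltr01 R)).
exact/mu_ext_ge0/hausdorff_weight_ge0.
Qed.

Lemma hausdorff_outer0 : hausdorff_outer set0 = 0.
Proof.
apply/eqP; rewrite eq_le hausdorff_outer_ge0 andbT.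
apply: ge_ereal_sup => _ [delta _ <-].
rewrite /hausdorff_content mu_ext0//; first exact: hausdorff_weight0.
exact: hausdorff_weight_ge0.
Qed.

Lemma le_hausdorff_outer :
  {homo hausdorff_outer : A B / A `<=` B >-> A <= B}.
Proof.
move=> A B AB; apply: ge_ereal_sup => _ [delta d0 <-].
by apply: le_trans (hausdorff_content_le B d0); exact: le_mu_ext.
Qed.

Lemma hausdorff_outer_sigma_subadditive : sigma_subadditive hausdorff_outer.
Proof.
move=> F; apply: ge_ereal_sup => _ [delta d0 <-].
apply: le_trans (mu_ext_sigma_subadditive _ _) _.
  exact: hausdorff_weight_ge0.
apply: lee_nneseries => [k _ _|k _].
  exact/mu_ext_ge0/hausdorff_weight_ge0.
exact: hausdorff_content_le.
Qed.

HB.instance Definition _ := isOuterMeasure.Build R 'rV[R]_n hausdorff_outer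
  hausdorff_outer0 hausdorff_outer_ge0 le_hausdorff_outer
  hausdorff_outer_sigma_subadditive.

End hausdorff_outer.

Section integration.
Variables (R : realType) (T : pointedType).
Variable m : {outer_measure set T -> \bar R}.

Definition cara_measure : {measure set (caratheodory_type m) -> \bar R} :=
  (m : set (caratheodory_type m) -> \bar R).

Definition integ (A : set T) (h : T -> R) : R :=
  (\int[cara_measure]_(x in A) h x)%R.

Definition sqint (A : set T) (h : T -> R) : \bar R :=
  (\int[cara_measure]_(x in A) ((h x) ^+ 2)%:E)%E.

Definition L2 (A : set T) (h : T -> R) : Prop :=
  measurable_fun (A : set (caratheodory_type m)) h /\ (sqint A h < +oo)%E.

Definition L2_cvg (A : set T) (h_ : nat -> T -> R) (h : T -> R) : Prop :=
  sqint A (h_ k \- h) @[k --> \oo] --> 0%E.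

End integration.

Section calculus.
Variables (R : realType) (N : nat).
Implicit Types (phi rho : 'rV[R]_N -> R) (omega : set 'rV[R]_N).

Definition partial phi (i : 'I_N) (x : 'rV[R]_N) : R :=
  'D_(delta_mx 0 i) phi x.

Definition grad phi (x : 'rV[R]_N) : 'rV[R]_N := \row_i partial phi i x.

Fixpoint Ck (k : nat) phi : Prop :=
  match k with
  | 0 => continuous phi
  | k'.+1 => continuous phi /\ forall i : 'I_N,
      (forall x, derivable phi x (delta_mx 0 i)) /\ Ck k' (partial phi i)
  end.

Definition smooth phi : Prop := forall k, Ck k phi.

Definition bdry omega : set 'rV[R]_N := closure omega `\` interior omega.

Definition local_defining_function omega (p : 'rV[R]_N) rho : Prop :=
  [/\ smooth rho, grad rho p != 0
    & \forall x \near p, omega x <-> rho x < 0].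

Definition smooth_boundary omega : Prop :=
  forall p, bdry omega p -> exists rho, local_defining_function omega p rho.

(* At a boundary point of a smooth domain the set below is a singleton. *)
Definition outer_normal omega (p : 'rV[R]_N) : 'rV[R]_N :=
  get [set nu | exists2 rho, local_defining_function omega p rho
                & nu = (enorm (grad rho p))^-1 *: grad rho p].

Definition tangential_grad omega phi (p : 'rV[R]_N) : 'rV[R]_N :=
  grad phi p - dot (grad phi p) (outer_normal omega p) *: outer_normal omega p.

(* C^{1,r} regularity of h on A x [0, +oo), for A open: first derivatives
   (one-sided in v at v = 0) that are r-Hoelder on A x [0, K] for all K. *)
Definition C1r (r : R) (A : set 'rV[R]_N) (h : 'rV[R]_N -> R -> R) : Prop :=
  exists (hy : 'rV[R]_N -> R -> 'rV[R]_N) (hv : 'rV[R]_N -> R -> R),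
  [/\ forall y v (i : 'I_N), A y -> 0 <= v ->
        is_derive y (delta_mx 0 i) (h^~ v) (hy y v 0 i),
      forall y v, A y -> 0 <= v ->
        t^-1 * (h y (v + t) - h y v)
          @[t --> within [set t | 0 <= v + t] (0 : R)^'] --> hv y v
    & forall K, exists C, forall y z v w, A y -> A z ->
        0 <= v <= K -> 0 <= w <= K ->
        `|hy y v - hy z w| <= C * (`|y - z| + `|v - w|) `^ r /\
        `|hv y v - hv z w| <= C * (`|y - z| + `|v - w|) `^ r].

(* C^{1,r} regularity on (bdry omega) x [0, +oo): being the restriction of a
   C^{1,r} function defined on a neighbourhood of the hypersurface. *)
Definition C1r_bdry (r : R) omega (h : 'rV[R]_N -> R -> R) : Prop :=
  exists (O : set 'rV[R]_N) (H : 'rV[R]_N -> R -> R),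
  [/\ open O, bdry omega `<=` O, C1r r O H
    & forall y v, bdry omega y -> 0 <= v -> H y v = h y v].

Definition dv0 (h : 'rV[R]_N -> R -> R) (y : 'rV[R]_N) : R :=
  lim (t^-1 * (h y t - h y 0) @[t --> 0^'+]).

End calculus.

Section sobolev.
Variables (R : realType) (N : nat) (omega : set 'rV[R]_N).

Let leb : {outer_measure set 'rV[R]_N -> \bar R} := @lebesgue_outer R N.
Let surf : {outer_measure set 'rV[R]_N -> \bar R} := @hausdorff_outer R N N.-1.

Definition int_bulk (h : 'rV[R]_N -> R) : R := integ leb omega h.
Definition int_bdry (h : 'rV[R]_N -> R) : R := integ surf (bdry omega) h.

Definition test_function (phi : 'rV[R]_N -> R) : Prop :=
  smooth phi /\ exists K : set 'rV[R]_N,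
    [/\ compact K, K `<=` omega & forall x, ~ K x -> phi x = 0].

(* V is in H^1(omega), with weak gradient GV *)
Definition H1_bulk (V : 'rV[R]_N -> R) (GV : 'rV[R]_N -> 'rV[R]_N) : Prop :=
  [/\ L2 leb omega V,
      forall i : 'I_N, L2 leb omega (fun x => GV x 0 i)
    & forall phi (i : 'I_N), test_function phi ->
        int_bulk (fun x => V x * partial phi i x) =
        - int_bulk (fun x => GV x 0 i * phi x)].

(* U is in H^1(bdry omega), with tangential gradient GU: the completion of the
   smooth functions on the hypersurface for the H^1 norm. Smooth functions on
   bdry omega are the restrictions of smooth functions on R^N. *)
Definition H1_bdry (U : 'rV[R]_N -> R) (GU : 'rV[R]_N -> 'rV[R]_N) : Prop :=
  [/\ L2 surf (bdry omega) U,
      forall i : 'I_N, L2 surf (bdry omega) (fun x => GU x 0 i)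
    & exists phi_ : nat -> 'rV[R]_N -> R,
      [/\ forall k, smooth (phi_ k),
          L2_cvg surf (bdry omega) phi_ U
        & forall i : 'I_N, L2_cvg surf (bdry omega)
            (fun k x => tangential_grad omega (phi_ k) x 0 i)
            (fun x => GU x 0 i)]].

(* T is the trace on bdry omega of V, where V is in H^1(omega) with weak
   gradient GV: the continuous extension to H^1(omega) of the restriction of
   functions that are smooth up to the boundary. *)
Definition trace_of (V : 'rV[R]_N -> R) (GV : 'rV[R]_N -> 'rV[R]_N)
    (T : 'rV[R]_N -> R) : Prop :=
  L2 surf (bdry omega) T /\
  exists phi_ : nat -> 'rV[R]_N -> R,
    [/\ forall k, smooth (phi_ k),
        L2_cvg leb omega phi_ V,
        forall i : 'I_N, L2_cvg leb omega
          (fun k => partial (phi_ k) i) (fun x => GV x 0 i)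
      & L2_cvg surf (bdry omega) phi_ T].

End sobolev.

Section speeds.
Variables (R : realType) (N : nat) (omega : set 'rV[R]_N).
Variables (d mu nu : R) (kappa : 'rV[R]_N -> R) (f g : 'rV[R]_N -> R -> R).
Implicit Types (D alpha : R) (U V T : 'rV[R]_N -> R).
Implicit Types (GU GV : 'rV[R]_N -> 'rV[R]_N).

Definition energy_bulk alpha V GV : R :=
  d * int_bulk omega (fun y => dot (GV y) (GV y))
  - int_bulk omega (fun y => (d * alpha ^+ 2 + dv0 f y) * V y ^+ 2).

Definition energy D alpha U GU V GV T : R :=
  D * int_bdry omega (fun y => dot (GU y) (GU y))
  - int_bdry omega (fun y => (D * alpha ^+ 2 + dv0 g y) * U y ^+ 2)
  + energy_bulk alpha V GV
  + int_bdry omega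
      (fun y => kappa y * (Num.sqrt mu * U y - Num.sqrt nu * T y) ^+ 2).

Definition Lambda D alpha : R :=
  inf [set E | exists U GU V GV T,
    [/\ H1_bdry omega U GU, H1_bulk omega V GV, trace_of omega V GV T,
        int_bdry omega (fun y => U y ^+ 2)
          + int_bulk omega (fun y => V y ^+ 2) = 1
      & E = energy D alpha U GU V GV T]].

Definition cstar D : R :=
  inf [set - Lambda D alpha / alpha | alpha in [set alpha : R | 0 < alpha]].

Definition Lambda_f alpha : R :=
  inf [set E | exists V GV,
    [/\ H1_bulk omega V GV, int_bulk omega (fun y => V y ^+ 2) != 0
      & E = energy_bulk alpha V GV / int_bulk omega (fun y => V y ^+ 2)]].

Definition cstar_f : R :=
  inf [set - Lambda_f alpha / alpha | alpha in [set alpha : R | 0 < alpha]].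

End speeds.

(* Main.v *)
(* With a = alpha^2, Lambda_D(alpha) is an infimum over states with surface mass u and
   bulk mass v = 1 - u of D (G - a u) + E - d a v, where G is the surface Dirichlet
   integral and E does not depend on D and alpha. Constant states give
   -Lambda_D(alpha) >= max(D a, d a) - C, the assumption on the supremum gives
   -Lambda_D(alpha) >= delta > 0, and -Lambda_D(alpha) <= (D + d) a + C. These bounds
   yield c^*(D) ~ sqrt D for large D and confine the minimizing alpha for D <= 1,
   where monotonicity of -Lambda_D(alpha) - D a in D gives the limit c_0 > 0.

   For c_0 < c_f^*, put lambda = -Lambda_f(0) and take alpha with d a = lambda, the
   minimizer for c_f^*. One needs E >= -(max d_u g + theta) u - (lambda - e) v for some
   e > 0, i.e. a quantitative form of the fact that a Neumann ground state of the bulk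
   cannot have zero trace on a part of the boundary where kappa is positive: for some
   q > 0, q int V^2 <= Q(V) + int_{bdry near p} V^2, Q being the bulk form minus its
   bottom. No compactness or regularity theory is used: for smooth V with small
   right-hand side, testing Q >= 0 with sqrt(V^2 + e^2) + e^2 / sqrt(V^2 + e^2) bounds
   the Dirichlet integral of ln sqrt(1 + V^2 / e^2), a Harnack-type estimate that
   spreads the smallness of V from the boundary through the connected domain. *)

Require Import Defs.
From HB Require Import structures.
From mathcomp Require Import all_boot all_order all_algebra.
From mathcomp Require Import all_classical all_reals all_analysis.
From mathcomp Require Import measurable_realfun ring lra.
Import Order.TTheory GRing.Theory Num.Theory.
Import numFieldNormedType.Exports.
Local Open Scope classical_set_scope.
Local Open Scope ring_scope.
Set Implicit Arguments.
Unset Strict Implicit.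
Unset Printing Implicit Defensive.

(** * Half-spaces are Caratheodory measurable *)

(** The factor 2 in the hypothesis on the surface reaction comes from d alpha^2 = lambda. At this
    alpha, -Lambda_D(alpha) receives at most lambda + d alpha^2 = 2 lambda per unit of bulk mass,
    and per unit of surface mass about max d_u g + D alpha^2, which stays below 2 lambda for small
    D. A strict gain in the bulk is therefore all that has to be produced. The logarithm produces it
    because the bound on the Dirichlet integral of ln sqrt(1 + V^2 / e^2) does not depend on e: the
    level L below which this logarithm stays, off a small set, is fixed beforehand, and e is chosen
    afterwards so that e exp(L) is small. Smallness on the boundary is carried into the domain along
    segments: the points whose segment in a fixed direction meets a boundary set of small Hausdorff
    measure form a set of small Lebesgue measure. Both measures are built from coverings, so the
    measurability of continuous functions rests on that of half-spaces, proved for each measure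
    separately. *)

Section weighted_outer_measures.
Local Open Scope ereal_scope.
Variables (R : realType) (T : pointedType) (w : set T -> \bar R).
Hypothesis w_ge0 : forall A, 0 <= w A.

(** Cutting every member of a cover of A [|] B by A and by B yields covers of A and of B; on
    [all_sets T] the cut pieces are again admissible. *)
Lemma mu_ext_superadditive (A B : set T) :
  (forall F, w (F `&` A) + w (F `&` B) <= w F) ->
  mu_ext (w : set (all_sets T) -> \bar R) A + mu_ext (w : set (all_sets T) -> \bar R) B <=
  mu_ext (w : set (all_sets T) -> \bar R) (A `|` B).
Proof.
move=> wAB; apply: le_ereal_inf_tmp => _ [F [mF ABF] <-].
apply: (@le_trans _ _ (\sum_(k <oo) w (F k `&` A) + \sum_(k <oo) w (F k `&` B))).
  apply: leeD; apply: ereal_inf_lbound => /=.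
    exists (fun k => F k `&` A) => //; split=> // x Ax.
    by have [k _ Fkx] := ABF x (or_introl Ax); exists k.
  exists (fun k => F k `&` B) => //; split=> // x Bx.
  by have [k _ Fkx] := ABF x (or_intror Bx); exists k.
rewrite -nneseriesD//; apply: lee_nneseries => // k _ _.
by rewrite adde_ge0.
Qed.

End weighted_outer_measures.

Section half_spaces.
Context {R : realType} {n : nat}.
Implicit Types (i : 'I_n) (c : R).

Definition halfspace i c : set 'rV[R]_n := [set x | x 0 i <= c].

Lemma box_weight_le (A : set 'rV[R]_n) (a b : 'rV[R]_n) :
  (forall i, a 0 i <= b 0 i) ->
  A `<=` [set y | forall i, a 0 i <= y 0 i <= b 0 i] ->
  (box_weight A <= (\prod_(i < n) (b 0 i - a 0 i))%R%:E)%E.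
Proof.
move=> ab Aab; rewrite /box_weight; case: ifPn => _.
  by rewrite lee_fin prodr_ge0// => i _; rewrite subr_ge0.
by apply: ereal_inf_lbound; exists a, b.
Qed.

Lemma box_weightS (A B : set 'rV[R]_n) : A `<=` B -> (box_weight A <= box_weight B)%E.
Proof.
move=> AB; rewrite {2}/box_weight; case: ifPn => [/asboolP B0|_].
  by rewrite (_ : A = set0) ?box_weight0// -subset0 -B0.
apply: le_ereal_inf_tmp => _ [a [b [ab Bab ->]]].
exact: box_weight_le ab (subset_trans AB Bab).
Qed.

(** A hyperplane that crosses a box splits it into two boxes whose i-th sides add up, the other
    sides being unchanged; when it misses the box, one of the two pieces of F is empty. *)
Lemma box_weight_halfspace i c (F : set 'rV[R]_n) :
  (box_weight (F `&` halfspace i c) + box_weight (F `&` ~` halfspace i c)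
   <= box_weight F)%E.
Proof.
rewrite {3}/box_weight; case: ifPn => [/asboolP ->|_].
  by rewrite !set0I box_weight0 adde0.
apply: le_ereal_inf_tmp => _ [a [b [ab Fab ->]]].
have [ca|ac] := ltP c (a 0 i).
  rewrite (_ : F `&` halfspace i c = set0) ?box_weight0 ?add0e; last first.
    rewrite -subset0 => x [/Fab/(_ i)/andP[ax _]]; rewrite /halfspace /= => xc.
    by have := lt_le_trans ca (le_trans ax xc); rewrite ltxx.
  by apply: box_weight_le ab _ => x [/Fab].
have [bc|cb] := leP (b 0 i) c.
  rewrite (_ : F `&` ~` halfspace i c = set0) ?box_weight0 ?adde0; last first.
    rewrite -subset0 => x [/Fab/(_ i)/andP[_ xb]]; rewrite /halfspace /=.
    by apply; exact: le_trans xb bc.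
  by apply: box_weight_le ab _ => x [/Fab].
pose b' := \row_j (if j == i then c else b 0 j).
pose a' := \row_j (if j == i then c else a 0 j).
have H1 : (box_weight (F `&` halfspace i c) <= (\prod_(j < n) (b' 0 j - a 0 j))%R%:E)%E.
  apply: box_weight_le => [j|x [/Fab Fx]]; first by rewrite mxE; case: eqP => [->|].
  rewrite /halfspace /= => xc j; rewrite mxE; case: eqP => [->|_ //].
  by rewrite xc andbT; case/andP: (Fx i).
have H2 : (box_weight (F `&` ~` halfspace i c) <= (\prod_(j < n) (b 0 j - a' 0 j))%R%:E)%E.
  apply: box_weight_le => [j|x [/Fab Fx]].
    by rewrite mxE; case: eqP => [->|//]; exact: ltW.
  rewrite /halfspace /= => /negP; rewrite -ltNge => xc j; rewrite mxE; case: eqP => [->|_ //].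
  by rewrite (ltW xc) /=; case/andP: (Fx i).
apply: le_trans (leeD H1 H2) _; rewrite -EFinD lee_fin.
rewrite [X in X + _](bigD1 i)// [X in _ + X](bigD1 i)// [in leRHS](bigD1 i)//=.
rewrite !mxE eqxx.
under eq_bigr => j /negPf ji do rewrite mxE ji.
under [X in _ + _ * X]eq_bigr => j /negPf ji do rewrite mxE ji.
by rewrite -mulrDl addrC addrA subrK.
Qed.

Lemma measurable_halfspace_lebesgue i c :
  measurable (halfspace i c : set (caratheodory_type (@lebesgue_outer R n))).
Proof.
apply: le_caratheodory_measurable => X.
rewrite -{3}(setIT X) -(setUCr (halfspace i c)) setIUr.
apply: mu_ext_superadditive => F; first exact: box_weight_ge0.
rewrite /= !setIA; apply: le_trans (box_weight_halfspace i c F).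
by apply: leeD; apply: box_weightS => x [[]].
Qed.

End half_spaces.

(** * Hausdorff measure as a metric outer measure *)

Section metric_outer_measure.
Context {R : realType} {n s : nat}.
Implicit Types (A B F G : set 'rV[R]_n) (delta : R).

Lemma normr_coord_le_enorm (x : 'rV[R]_n) i : `|x 0 i| <= enorm x.
Proof.
rewrite -sqrtr_sqr /enorm ler_sqrt; last first.
  by apply: sumr_ge0 => j _; rewrite -expr2 sqr_ge0.
rewrite /dot (bigD1 i)//= -expr2 lerDl.
by apply: sumr_ge0 => j _; rewrite -expr2 sqr_ge0.
Qed.

Lemma lee_expe (x y : \bar R) m : (0 <= x -> x <= y -> x ^+ m <= y ^+ m)%E.
Proof.
move=> x0 xy; elim: m => [|m IH]; first by rewrite !expe0.
by rewrite !expeS lee_pmul// expe_ge0.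
Qed.

Lemma ediamS A B : A `<=` B -> (ediam A <= ediam B)%E.
Proof.
move=> AB; apply: le_ereal_sup => _ [y [z [Ay Az ->]]].
by exists y, z; split=> //; exact: AB.
Qed.

Lemma ediam_ge0 A : A !=set0 -> (0 <= ediam A)%E.
Proof.
move=> [x Ax]; apply: (@le_trans _ _ (enorm (x - x))%:E).
  by rewrite lee_fin sqrtr_ge0.
by apply: ereal_sup_ubound; exists x, x.
Qed.

Lemma hausdorff_weightS delta A B :
  A `<=` B -> (hausdorff_weight s delta A <= hausdorff_weight s delta B)%E.
Proof.
move=> AB; rewrite {2}/hausdorff_weight; case: ifPn => [/asboolP B0|B0].
  rewrite (_ : A = set0) ?hausdorff_weight0//.
  by rewrite -subset0 -B0.
case: ifPn => [Bd|_]; last by rewrite leey.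
rewrite /hausdorff_weight; case: ifPn => [_|/asboolPn/eqP/set0P A0].
  have /asboolPn/eqP/set0P/ediam_ge0 B1 := B0.
  rewrite mule_ge0 ?expe_ge0// lee_fin divr_ge0 ?exprn_ge0//.
  exact: unit_ball_volume_ge0.
rewrite (le_trans (ediamS AB) Bd).
apply: lee_wpmul2l.
  by rewrite lee_fin divr_ge0 ?exprn_ge0// unit_ball_volume_ge0.
by apply: lee_expe; [exact: ediam_ge0 | exact: ediamS].
Qed.

(** A smaller scale only turns some weights into +oo. *)
Lemma hausdorff_contentS delta delta' A : delta <= delta' ->
  (hausdorff_content s delta' A <= hausdorff_content s delta A)%E.
Proof.
move=> dd'; apply: le_ereal_inf_tmp => _ [F cF <-].
apply: (@le_trans _ _ (\sum_(k <oo) hausdorff_weight s delta' (F k))%E).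
  by apply: ereal_inf_lbound; exists F.
apply: lee_nneseries => k _ => [_|]; first exact: hausdorff_weight_ge0.
rewrite /hausdorff_weight; case: ifPn => // _.
have [Fd|Fd] := leP (ediam (F k)) delta%:E; last by rewrite leey.
by rewrite (le_trans Fd) ?lee_fin.
Qed.

(** A piece of diameter at most delta < e cannot meet both A and B, and a larger piece has weight
    +oo. *)
Lemma hausdorff_content_superadditive delta e A B : delta < e ->
  (forall x y, A x -> B y -> e <= enorm (x - y)) ->
  (hausdorff_content s delta A + hausdorff_content s delta B <=
   hausdorff_content s delta (A `|` B))%E.
Proof.
move=> de sep; apply: mu_ext_superadditive => F.
  exact: hausdorff_weight_ge0.
have [Fd|dF] := leP (ediam F) delta%:E; last first.
  rewrite {3}/hausdorff_weight; case: ifPn => [/asboolP ->|_].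
    by rewrite !set0I hausdorff_weight0 adde0.
  by rewrite ifN ?leey// -ltNge.
have [FA|/set0P [x [Fx Ax]]] := eqVneq (F `&` A) set0.
  by rewrite FA hausdorff_weight0 add0e; apply: hausdorff_weightS => z [].
rewrite (_ : F `&` B = set0) ?hausdorff_weight0 ?adde0.
  by apply: hausdorff_weightS => z [].
rewrite -subset0 => y [Fy By].
have : (e%:E <= delta%:E)%E.
  apply: le_trans Fd; apply: le_trans (_ : (enorm (x - y))%:E <= _)%E.
    by rewrite lee_fin sep.
  by apply: ereal_sup_ubound; exists x, y.
by rewrite lee_fin leNgt de.
Qed.

Lemma hausdorff_outer_superadditive e A B : 0 < e ->
  (forall x y, A x -> B y -> e <= enorm (x - y)) ->
  (hausdorff_outer s A + hausdorff_outer s B <= hausdorff_outer s (A `|` B))%E.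
Proof.
move=> e0 sep; have e2 : e / 2 < e by lra.
set X := hausdorff_outer s (A `|` B).
have X0 : (0 <= X)%E by exact: outer_measure_ge0.
have [->|Xoo] := eqVneq X +oo%E; first by rewrite leey.
have Xfin : X \is a fin_num by rewrite ge0_fin_numE// ltey.
have fin C : C `<=` A `|` B -> hausdorff_outer s C \is a fin_num.
  move=> CAB; rewrite ge0_fin_numE ?outer_measure_ge0//.
  by apply: le_lt_trans (le_hausdorff_outer s CAB) _; rewrite ltey.
(* The two scales are independent so that the suprema defining the measures of A and of B can be
   taken one after the other; both are refined to a common scale below e. *)
have key d1 d2 : 0 < d1 -> 0 < d2 ->
    (hausdorff_content s d1 A + hausdorff_content s d2 B <= X)%E.
  move=> d10 d20; pose d := Num.min (Num.min d1 d2) (e / 2).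
  have d0 : 0 < d by rewrite !lt_min d10 d20 divr_gt0.
  have de : d < e.
    by rewrite gt_min e2 orbT.
  apply: le_trans (hausdorff_content_le s (A `|` B) d0).
  apply: le_trans (hausdorff_content_superadditive de sep).
  by apply: leeD; apply: hausdorff_contentS; rewrite /d !ge_min lexx ?orbT.
have Bfin : hausdorff_outer s B \is a fin_num by apply: fin; exact: subsetUr.
rewrite -leeBrDr//; apply: ge_ereal_sup => _ [d1 d10 <-].
have cfin : hausdorff_content s d1 A \is a fin_num.
  rewrite ge0_fin_numE ?mu_ext_ge0//; last exact: hausdorff_weight_ge0.
  apply: le_lt_trans (hausdorff_content_le s A d10) _.
  by rewrite -ge0_fin_numE ?outer_measure_ge0//; apply: fin; exact: subsetUl.
rewrite leeBrDr// addeC -leeBrDr//; apply: ge_ereal_sup => _ [d2 d20 <-].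
by rewrite leeBrDr// addeC key.
Qed.

(* Caratheodory's criterion for metric outer measures, in the special case of a
   half-space: the slices [c + 1/(k+2) < x_i <= c + 1/(k+1)] of a set of finite
   measure have summable measures, since slices with indices of the same parity
   are separated. *)
Lemma measurable_halfspace_hausdorff i c :
  measurable (halfspace i c : set (caratheodory_type (@hausdorff_outer R n s))).
Proof.
apply: le_caratheodory_measurable => X.
pose mu : set 'rV[R]_n -> \bar R := hausdorff_outer s; set H := halfspace i c.
change (mu (X `&` H) + mu (X `&` ~` H) <= mu X)%E.
have [->|Xoo] := eqVneq (mu X) +oo%E; first by rewrite leey.
have le_mu C D : C `<=` D -> (mu C <= mu D)%E by exact: le_hausdorff_outer.
have mu_ge0 C : (0 <= mu C)%E by exact: outer_measure_ge0.
have Xfin : mu X \is a fin_num by rewrite ge0_fin_numE ?mu_ge0// ltey.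
pose t k : R := c + k.+1%:R^-1.
have tlt k l : (k < l)%N -> t l < t k.
  by move=> kl; rewrite ltrD2l ltf_pV2 ?posrE ?ltr0n// ltr_nat ltnS.
pose Y k := X `&` [set x : 'rV[R]_n | t k < x 0 i].
pose S k := X `&` [set x : 'rV[R]_n | t k.+1 < x 0 i <= t k].
have sepS (E : set 'rV[R]_n) (u v : R) : u < v ->
    (forall x, E x -> x 0 i <= u) -> forall D : set 'rV[R]_n,
    (forall x, D x -> v < x 0 i) -> (mu E + mu D <= mu (E `|` D))%E.
  move=> uv Eu D Dv; apply: (@hausdorff_outer_superadditive (v - u)).
    by rewrite subr_gt0.
  move=> x y /Eu xu /Dv vy; apply: le_trans (normr_coord_le_enorm (x - y) i).
  rewrite !mxE distrC ger0_norm; first by rewrite lerB// ltW.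
  by rewrite subr_ge0 (le_trans xu)// ltW// (lt_trans uv).
have parity b : forall m, (\sum_(k < m) mu (S (k.*2 + b)%N) <= mu X)%E.
  move=> m; pose U m := \big[setU/set0]_(k < m) S (k.*2 + b)%N.
  apply: (@le_trans _ _ (mu (U m))); last first.
    apply: le_mu; rewrite /U; elim/big_ind: _ => [|? ? ? ?|k _]; first exact: sub0set.
      by rewrite subUset.
    by move=> x [].
  elim: m => [|[|m] IH]; first by rewrite big_ord0.
    by rewrite /U !big_ord_recl !big_ord0 setU0 adde0.
  have -> : U m.+2 = U m.+1 `|` S (m.+1.*2 + b)%N by rewrite /U big_ord_recr.
  rewrite big_ord_recr /=.
  apply: le_trans (leeD2r _ IH) _; rewrite addeC setUC.
  apply: (@sepS _ (t (m.+1.*2 + b)) (t (m.*2 + b).+1)).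
  - by apply: tlt; rewrite doubleS; exact: (ltnSn (m.*2 + b).+1).
  - by move=> x [_ /andP[]].
  - suff : U m.+1 `<=` [set x : 'rV[R]_n | t (m.*2 + b).+1 < x 0 i].
      by [].
    rewrite /U; elim/big_ind: _ => [|C D HC HD|k _]; first exact: sub0set.
      by rewrite subUset.
    move=> x [_ /= /andP[+ _]]; apply: le_lt_trans.
    have : ((k.*2 + b).+1 <= (m.*2 + b).+1)%N.
      by rewrite ltnS leq_add2r leq_double -ltnS.
    by rewrite leq_eqVlt => /predU1P[-> //|/tlt/ltW].
have sumS m : (\sum_(k < m.*2) mu (S k) <= mu X + mu X)%E.
  apply: le_trans (leeD (parity 0%N m) (parity 1%N m)).
  elim: m => [|m IH]; first by rewrite !big_ord0 adde0.
  rewrite doubleS !big_ord_recr /= addn0 addn1 [leRHS]addeACA -[leLHS]addeA.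
  exact: leeD2r.
have Slty : (\sum_(0 <= k <oo) mu (S k) < +oo)%E.
  apply: (@le_lt_trans _ _ (mu X + mu X)%E); last first.
    by rewrite -ge0_fin_numE ?adde_ge0// fin_numD Xfin.
  apply: lime_le; first exact: is_cvg_nneseries.
  near=> m; apply: le_trans (sumS m); rewrite big_mkord.
  rewrite -addnn big_split_ord /= leeDl//.
  by apply: sume_ge0.
have cov N : X `&` ~` H `<=` Y N `|` \bigcup_(k in ~` `I_N) S k.
  move=> x [Xx]; rewrite /H /halfspace /= => /negP; rewrite -ltNge => cx.
  have [tx|xt] := ltP (t N) (x 0 i); first by left.
  right; have [k0 tk0] : exists k, t k < x 0 i.
    by have [k ck] := ltr_add_invr cx; exists k.
  have ex : exists k, t k < x 0 i by exists k0.
  case: (ex_minnP ex) => k tk mink.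
  have Nk : (N < k)%N.
    rewrite ltnNge; apply/negP; rewrite leq_eqVlt => /predU1P[kN|/tlt].
      by move: xt; rewrite -kN leNgt tk.
    by move=> /lt_trans /(_ tk) /lt_le_trans /(_ xt); rewrite ltxx.
  (* As k is the least index with [t k] < x_i, also x_i <= [t k.-1]: the point lies in the slice of
     index k - 1, which is at least N because N < k. *)
  exists k.-1 => /=; first by apply/negP; rewrite -leqNgt; case: (k) Nk.
  split=> //=; rewrite prednK ?tk ?(leq_ltn_trans _ Nk)//= leNgt; apply/negP.
  by move=> /mink; rewrite leqNgt; case: (k) Nk => //= k' _; rewrite ltnSn.
(* [Y N] is at distance 1/(N+1) from H, so the two measures add; what is left of X outside H lies in
   the slices of index at least N, a tail of a convergent series. *)
have bound N : (mu (X `&` H) + mu (X `&` ~` H) <=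
    mu X + \sum_(N <= k <oo) mu (S k))%E.
  have HY : (mu (X `&` H) + mu (Y N) <= mu X)%E.
    apply: (@le_trans _ _ (mu ((X `&` H) `|` Y N))); last first.
      by apply: le_mu; rewrite subUset; split=> x [].
    apply: (@sepS _ c (t N)) => [|x []//|x []//].
    by rewrite ltrDl invr_gt0.
  apply: le_trans (leeD2r _ HY); rewrite -addeA; apply: leeD => //.
  apply: le_trans (le_mu _ _ (cov N)) _.
  apply: le_trans (outer_measureU2 _ _ _) _; apply: leeD => //.
  exact: outer_measure_sigma_subadditive_tail.
have tail := nneseries_tail_cvg Slty (fun k _ => mu_ge0 (S k)).
have : (mu X + \sum_(N <= k <oo) mu (S k))%E @[N --> \oo] --> (mu X + 0)%E.
  by apply: cvgeD => //; [rewrite fin_num_adde_defr | exact: cvg_cst].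
rewrite adde0 => XS; rewrite -(cvg_lim _ XS)//.
by apply: lime_ge; [apply/cvg_ex; exists (mu X) | near=> N; exact: bound].
Unshelve. all: by end_near. Qed.
End metric_outer_measure.

(** * Measurability of continuous functions *)

Section measurable_coordinates.
Context {R : realType} {n : nat} {d : measure_display} {T : measurableType d}.
Variable X : T -> 'rV[R]_n.
Hypothesis mX : forall i c, measurable (X @^-1` halfspace i c).

Lemma measurable_preimage_open (O : set 'rV[R]_n) :
  open O -> measurable (X @^-1` O).
Proof.
move=> oO; pose rr (q : rat) : R := ratr q.
pose iv (k : nat) : R := k.+1%:R^-1.
have rr_dense (x y : R) : x < y -> exists q, x < rr q < y.
  by move=> /rat_in_itvoo[q]; rewrite in_itv /=; exists q.
pose box (qk : 'rV[rat]_n * nat) : set 'rV[R]_n :=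
  [set y | forall i, rr (qk.1 0 i) - iv qk.2 < y 0 i <=
                     rr (qk.1 0 i) + iv qk.2].
have mbox qk : measurable (X @^-1` box qk).
  rewrite (_ : X @^-1` box qk = \bigcap_(i in [set: 'I_n])
    (X @^-1` halfspace i (rr (qk.1 0 i) + iv qk.2) `\`
     X @^-1` halfspace i (rr (qk.1 0 i) - iv qk.2))).
    by apply: fin_bigcap_measurable => // i _; exact: measurableD.
  apply/seteqP; split => [t Xt i _|t Xt i].
    by have /andP[lt le] := Xt i; split=> //=; apply/negP; rewrite -ltNge.
  by have [/= le /negP] := Xt i I; rewrite -ltNge le => ->.
pose F m := if @unpickle ('rV[rat]_n * nat)%type m is Some qk then
  (if `[< box qk `<=` O >] then box qk else set0) else set0.
have -> : O = \bigcup_m F m.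
  apply/seteqP; split => [x Ox|x [m _]]; last first.
    rewrite /F; case: unpickle => // qk; case: ifPn => // /asboolP; exact.
  have /nbhs_ballP[e /= e0 exO] : nbhs x O by exact: open_nbhs_nbhs.
  have e20 : 0 < e / 2 by rewrite divr_gt0.
  have [k] : exists k, 0 + k.+1%:R^-1 < e / 2 by exact: ltr_add_invr.
  rewrite add0r.
  rewrite -/(iv k) => ke; have k0 : 0 < iv k by rewrite invr_gt0.
  have /choice[q qP] : forall i, exists q : rat,
      x 0 i - iv k < rr q < x 0 i + iv k.
    by move=> i; apply: rr_dense; lra.
  exists (pickle ((\row_i q i : 'rV[rat]_n), k)) => //; rewrite /F pickleK.
  have subO : box (\row_i q i, k) `<=` O.
    move=> y By; apply: exO; rewrite mx_norm_ball /ball_ /=.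
    rewrite /Num.Def.normr /= mx_normrE.
    apply/bigmax_ltP; split=> // -[i j] _ /=; rewrite (ord1 i) !mxE.
    have := By j; have := qP j; rewrite /= mxE.
    move=> /andP[q1 q2] /andP[y1 y2]; rewrite ltr_norml; apply/andP; split; lra.
  rewrite (asboolT subO) => i /=; rewrite mxE; have /andP[q1 q2] := qP i.
  by apply/andP; split; lra.
rewrite preimage_bigcup; apply: bigcup_measurable => m _; rewrite /F.
case: unpickle => [qk|]; last by rewrite preimage_set0.
by case: ifP => _ //; rewrite preimage_set0.
Qed.

Lemma measurable_fun_continuous_on (A : set 'rV[R]_n) (f : 'rV[R]_n -> R) :
  open A -> (forall x, A x -> {for x, continuous f}) ->
  measurable_fun (X @^-1` A) (f \o X).
Proof.
move=> oA fc; apply: (measurability _ (measurable_realfun.RGenInftyO.measurableE R)).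
move=> _ [_ [c ->] <-].
apply: (@measurable_preimage_open (A `&` f @^-1` `]-oo, c[)).
rewrite openE => x [Ax fxc]; rewrite /interior.
apply: filterI; first exact: open_nbhs_nbhs.
apply: (fc x Ax).
by apply: open_nbhs_nbhs; split=> //; exact: interval_open.
Qed.

End measurable_coordinates.

Section borel.
Context {R : realType} {n : nat} (mu : {outer_measure set 'rV[R]_n -> \bar R}).
Hypothesis mH : forall i c, mu.-cara.-measurable (halfspace i c).

Lemma open_cara_measurable (O : set 'rV[R]_n) :
  open O -> mu.-cara.-measurable O.
Proof. by move=> oO; exact: (@measurable_preimage_open _ _ _ (caratheodory_type mu) id). Qed.

Lemma closed_cara_measurable (A : set 'rV[R]_n) :
  closed A -> mu.-cara.-measurable A.
Proof.
move=> cA; rewrite -(setCK A).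
by apply: (@measurableC _ (caratheodory_type mu)); apply: open_cara_measurable; exact: closed_openC.
Qed.

Lemma bdry_cara_measurable (A : set 'rV[R]_n) : mu.-cara.-measurable (bdry A).
Proof.
apply: (@measurableD _ (caratheodory_type mu)).
  by apply: closed_cara_measurable; exact: closed_closure.
by apply: open_cara_measurable; exact: open_interior.
Qed.

Lemma cara_measurable_fun_continuous_on (A : set 'rV[R]_n) (f : 'rV[R]_n -> R) :
  open A -> (forall x, A x -> {for x, continuous f}) ->
  measurable_fun (A : set (caratheodory_type mu)) f.
Proof. exact: (@measurable_fun_continuous_on _ _ _ (caratheodory_type mu) id). Qed.

Lemma cara_measurable_fun_continuous (A : set (caratheodory_type mu)) (f : 'rV[R]_n -> R) :
  continuous f -> measurable_fun A f.
Proof.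
move=> cf; apply: (@measurable_funTS _ _ (caratheodory_type mu)).
exact: (cara_measurable_fun_continuous_on openT (fun x _ => cf x)).
Qed.

End borel.

(** * Lebesgue measure *)

Section row_norms.
Context {R : realType} {n : nat}.
Implicit Types x y h : 'rV[R]_n.

Lemma rV_normE x : `|x| = \big[Num.max/0]_ij `|x ij.1 ij.2|.
Proof. by rewrite /Num.Def.normr /= mx_normrE. Qed.

Lemma normr_coord_le x i : `|x 0 i| <= `|x|.
Proof. by rewrite rV_normE (le_bigmax _ (fun j => `|x j.1 j.2|) (0, i)). Qed.

Lemma rV_norm_leP x (M : R) : 0 <= M -> (forall i, `|x 0 i| <= M) -> `|x| <= M.
Proof.
move=> M0 xM; rewrite rV_normE; apply/bigmax_leP; split=> // -[i j] _ /=.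
by rewrite (ord1 i).
Qed.

Lemma rV_norm_ltP x (M : R) : 0 < M -> (forall i, `|x 0 i| < M) -> `|x| < M.
Proof.
move=> M0 xM; rewrite rV_normE; apply/bigmax_ltP; split=> // -[i j] _ /=.
by rewrite (ord1 i).
Qed.

Lemma rV_ballE x (e : R) y : ball x e y = (`|x - y| < e) :> Prop.
Proof. by rewrite mx_norm_ball. Qed.

End row_norms.

Section lebesgue.
Context {R : realType} {n : nat}.
Local Notation lo := (@lebesgue_outer R n).
Local Notation lebT := (caratheodory_type lo).
Implicit Types (h : 'rV[R]_n) (A B : set 'rV[R]_n).

(** A named copy of the Caratheodory measure, to which the sigma-finite structure required by
    Tonelli's theorem is attached. *)
Definition leb : set lebT -> \bar R := cara_measure lo.

HB.instance Definition _ := Measure.on leb.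

Definition translate h (x : lebT) : lebT := x + h.

Lemma le_lebesgue_outer_translate h A : (lo (translate h @^-1` A) <= lo A)%E.
Proof.
apply: le_ereal_inf_tmp => _ [F [mF AF] <-].
apply: (@le_trans _ _ (\sum_(k <oo) box_weight (translate h @^-1` F k))%E).
  apply: ereal_inf_lbound; exists (fun k => translate h @^-1` F k) => //; split=> //.
  by move=> x /AF[k _ Fk]; exists k.
apply: lee_nneseries => k _ => [_|]; first exact: box_weight_ge0.
rewrite {2}/box_weight; case: ifPn => [/asboolP ->|_].
  by rewrite preimage_set0 box_weight0.
apply: le_ereal_inf_tmp => _ [a [b [ab Fab ->]]].
rewrite (_ : \prod_(i < n) _ = \prod_(i < n) ((b - h) 0 i - (a - h) 0 i)).
  apply: box_weight_le => [i|x /Fab/= xab i]; first by rewrite !mxE lerD2r.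
  by have := xab i; rewrite !mxE lerBlDr lerBrDr.
by apply: eq_bigr => i _; rewrite !mxE; ring.
Qed.

Lemma translateK h : cancel (translate h) (translate (- h)).
Proof. by move=> x; rewrite /translate addrK. Qed.

Lemma preimage_translateK h A : translate h @^-1` (translate (- h) @^-1` A) = A.
Proof. by apply/seteqP; split=> x; rewrite /preimage /= translateK. Qed.

Lemma lebesgue_outer_translate h A : lo (translate h @^-1` A) = lo A.
Proof.
apply/eqP; rewrite eq_le le_lebesgue_outer_translate /=.
rewrite -{1}(preimage_translateK (- h) A) opprK.
exact: le_lebesgue_outer_translate.
Qed.

Lemma measurable_translate h : measurable_fun [set: lebT] (translate h).
Proof.
move=> _ A mA; rewrite setTI.
suff : lo.-caratheodory (translate h @^-1` A) by [].
have cA : lo.-caratheodory A by [].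
move=> X; rewrite -(preimage_translateK h X); move: (translate (- h) @^-1` X) => Y.
change (lo (translate h @^-1` Y) =
  (lo (translate h @^-1` (Y `&` A)) + lo (translate h @^-1` (Y `&` ~` A)))%E).
rewrite (lebesgue_outer_translate h Y) (lebesgue_outer_translate h (Y `&` A)).
by rewrite (lebesgue_outer_translate h (Y `&` ~` A)); exact: cA.
Qed.

Lemma leb_translate h (A : set lebT) : measurable A -> pushforward leb (translate h) A = leb A.
Proof. by move=> mA; rewrite /pushforward; exact: lebesgue_outer_translate. Qed.

Lemma ge0_integral_translate h (D : set lebT) (f : lebT -> \bar R) :
  measurable D -> measurable_fun D f -> (forall x, D x -> (0 <= f x)%E) ->
  (\int[leb]_(x in translate h @^-1` D) f (translate h x) = \int[leb]_(x in D) f x)%E.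
Proof.
move=> mD mf f0.
rewrite -(ge0_integral_pushforward (measurable_translate h) leb mD mf); last first.
  by move=> x /[!inE]; exact: f0.
apply: eq_measure_integral => [|? A mA _]; first exact: measurable_translate.
exact: (leb_translate h mA).
Qed.

Lemma lebesgue_outer_le_box_weight A : (lo A <= box_weight A)%E.
Proof.
apply: (@le_trans _ _ (\sum_(k <oo) box_weight (bigcup2 A set0 k))%E).
  by apply: ereal_inf_lbound; exists (bigcup2 A set0) => //; split=> // x Ax; exists 0%N.
rewrite nneseries_recl//=; last by move=> *; exact: box_weight_ge0.
rewrite (@eseries0 _ _ 1%N xpredT) ?adde0// => k k0 _.
by case: k k0 => [//|[|k]] _ /=; exact: box_weight0.
Qed.

Lemma lebesgue_outer_ball_lty (M : R) A : (forall x, A x -> `|x| <= M) -> (lo A < +oo)%E.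
Proof.
move=> AM; have [->|/set0P[x0 Ax0]] := eqVneq A set0; first by rewrite outer_measure0.
have M0 : 0 <= M by exact: le_trans (normr_ge0 _) (AM _ Ax0).
apply: le_lt_trans (lebesgue_outer_le_box_weight A) _.
apply: le_lt_trans (box_weight_le (a := const_mx (- M)) (b := const_mx M) _ _) (ltry _).
  by move=> i; rewrite !mxE -subr_ge0 opprK addr_ge0.
by move=> x Ax i; rewrite !mxE -ler_norml (le_trans (normr_coord_le x i)) ?AM.
Qed.

Lemma leb_bounded_lty A : bounded_set A -> (leb A < +oo)%E.
Proof.
by move=> /pinfty_ex_gt0[M M0 AM]; apply: (@lebesgue_outer_ball_lty M); exact: AM.
Qed.

Lemma leb_sigma_finite : sigma_finite [set: lebT] leb.
Proof.
exists (fun k => [set x : 'rV[R]_n | `|x| <= k%:R]).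
  apply/seteqP; split=> // x _; exists (Num.truncn `|x|).+1 => //=.
  exact/ltW/truncnS_gt.
move=> k; split; last by apply: (@lebesgue_outer_ball_lty k%:R).
apply: (closed_cara_measurable measurable_halfspace_lebesgue).
apply: (@closed_comp _ _ _ [set x : R | x <= k%:R]); last exact: closed_le.
by move=> x _; exact: norm_continuous.
Qed.

HB.instance Definition _ := @Measure_isSigmaFinite.Build _ lebT R leb leb_sigma_finite.

(** Countably many rational translates of a nonempty open set cover the whole space, so a null O
    would make every set null; W witnesses that the measure is not zero. *)
Lemma leb_open_gt0 (W O : set 'rV[R]_n) : (0 < lo W)%E -> open O -> O !=set0 -> (0 < leb O)%E.
Proof.
move=> W0 oO [x0 Ox0]; rewrite lt_neqAle outer_measure_ge0 andbT eq_sym.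
apply: contraTneq W0 => O0; rewrite -leNgt.
pose rr (q : rat) : R := ratr q.
pose F m := if @unpickle 'rV[rat]_n m is Some q then
  translate (\row_i rr (q 0 i)) @^-1` O else set0.
apply: (@le_trans _ _ (lo (\bigcup_m F m))).
  apply: le_outer_measure => x _.
  have /nbhs_ballP[e /= e0 eO] : nbhs x0 O by exact: open_nbhs_nbhs.
  have /choice[q qP] : forall i, exists q : rat, x0 0 i - x 0 i - e < rr q < x0 0 i - x 0 i.
    move=> i; have : x0 0 i - x 0 i - e < x0 0 i - x 0 i by rewrite ltrBlDr ltrDl.
    by move=> /rat_in_itvoo[q]; rewrite in_itv /=; exists q.
  exists (pickle (\row_i q i : 'rV[rat]_n)) => //; rewrite /F pickleK /preimage /=.
  apply: eO; rewrite rV_ballE; apply: rV_norm_ltP => // i.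
  rewrite !mxE; have /andP[q1 q2] := qP i; rewrite ltr_norml; apply/andP; split; lra.
apply: le_trans (outer_measure_sigma_subadditive _ _) _.
rewrite eseries0// => m _ _; rewrite /F; case: unpickle => [q|]; last by rewrite outer_measure0.
by transitivity (lo O); [exact: lebesgue_outer_translate | exact: O0].
Qed.

End lebesgue.

(** * C^1 functions *)

Section directional_derivatives.
Context {R : realType} {n : nat}.
Implicit Types (w : 'rV[R]_n -> R) (p x y v h : 'rV[R]_n).

Lemma is_derive_lineP w p v (t d : R) :
  is_derive t 1 (fun s : R => w (p + s *: v)) d <-> is_derive (p + t *: v) v w d.
Proof.
have E : (fun h : R => h^-1 *: (((fun s : R => w (p + s *: v))
            \o pseudometric_normed_Zmodule.shift t) (h *: (1 : R)) - w (p + t *: v))) =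
         (fun h : R => h^-1 *: ((w \o pseudometric_normed_Zmodule.shift (p + t *: v)) (h *: v)
            - w (p + t *: v))).
  apply/funext => h /=; congr (_ *: (w _ - _)).
  by rewrite /GRing.scale /= mulr1 -/(GRing.scale _ _) scalerDl addrCA addrC.
split=> -[D1 D2]; constructor.
- by move: D1; rewrite /derivable E.
- by move: D2; rewrite /derive E.
- by move: D1; rewrite /derivable -E.
- by move: D2; rewrite /derive -E.
Qed.

Lemma is_derive_at_lineP w p v d :
  is_derive (0 : R) (1 : R) (fun s : R => w (p + s *: v)) d <-> is_derive p v w d.
Proof. by rewrite is_derive_lineP scale0r addr0. Qed.

Lemma is_derive_bounded_increment (f f' : R -> R) (M : R) :
  (forall s : R, 0 <= s <= 1 -> is_derive s (1 : R) f (f' s)) ->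
  (forall s : R, 0 <= s <= 1 -> `|f' s| <= M) -> `|f 1 - f 0| <= M.
Proof.
move=> ff' f'M.
have [s||c] := @MVT_segment R f f' 0 1 ler01.
- by move=> /subset_itv_oo_cc; rewrite in_itv; exact: ff'.
- apply: continuous_in_subspaceT => s /[!inE] /= /[!in_itv] /= s01.
  by apply: differentiable_continuous; apply/derivable1_diffP; case: (ff' s s01).
- by rewrite in_itv /= => c01 ->; rewrite subr0 mulr1 f'M.
Qed.

(** One coordinate is moved at a time: [z k] has the first k coordinates of y and the others of x.
    The intermediate points stay in the ball because it is a cube for the sup norm. *)
Lemma coord_increment_le w x0 (r M : R) :
  (forall y, `|x0 - y| < r -> forall i, derivable w y (delta_mx 0 i)) ->
  (forall y, `|x0 - y| < r -> forall i, `|partial w i y| <= M) ->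
  forall x y, `|x0 - x| < r -> `|x0 - y| < r -> `|w y - w x| <= n%:R * M * `|y - x|.
Proof.
move=> dw wM x y xr yr; have r0 : 0 < r by exact: le_lt_trans xr.
pose z k : 'rV[R]_n := \row_j (if (j < k)%N then y 0 j else x 0 j).
have z0 : z 0%N = x by apply/rowP => j; rewrite mxE.
have zn : z n = y by apply/rowP => j; rewrite mxE ltn_ord.
have zS (k : 'I_n) : z k.+1 = z k + (y 0 k - x 0 k) *: delta_mx 0 k.
  apply/rowP => j; rewrite !mxE eqxx /= ltnS leq_eqVlt.
  have [->|jk] := eqVneq j k; first by rewrite eqxx ltnn /= mulr1 addrC subrK.
  by rewrite (inj_eq val_inj) (negPf jk) /= mulr0 addr0.
have -> : w y - w x = \sum_(k < n) (w (z k.+1) - w (z k)).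
  rewrite -[in w y]zn -[in w x]z0.
  by rewrite -(big_mkord xpredT (fun k => w (z k.+1) - w (z k))) telescope_sumr.
apply: le_trans (ler_norm_sum _ _ _) _.
have -> : n%:R * M * `|y - x| = \sum_(k < n) M * `|y - x|.
  by rewrite sumr_const card_ord -mulrA mulr_natl.
apply: ler_sum => k _.
set a := y 0 k - x 0 k.
have M0 : 0 <= M.
  by apply: le_trans (wM x0 _ k) => //; rewrite subrr normr0.
apply: (@le_trans _ _ (M * `|a|)); last first.
  by rewrite ler_wpM2l// /a; have := normr_coord_le (y - x) k; rewrite !mxE.
pose q (s : R) := z k + (s * a) *: delta_mx 0 k.
have qr (s : R) : 0 <= s <= 1 -> `|x0 - q s| < r.
  move=> /andP[s0 s1]; apply: rV_norm_ltP => // j.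
  have := le_lt_trans (normr_coord_le _ j) xr; have := le_lt_trans (normr_coord_le _ j) yr.
  rewrite !mxE eqxx /=.
  have [->|jk] := eqVneq j k; last by rewrite mulr0 addr0; case: ifP.
  rewrite ltnn mulr1 /a => yk xk.
  rewrite (_ : x0 0 k - _ = (1 - s) * (x0 0 k - x 0 k) + s * (x0 0 k - y 0 k)); last by ring.
  apply: le_lt_trans (ler_normD _ _) _; rewrite !normrM (ger0_norm s0) ger0_norm ?subr_ge0//.
  have [->|sn0] := eqVneq s 0; first by rewrite subr0 mul1r mul0r addr0.
  rewrite (_ : r = (1 - s) * r + s * r); last by ring.
  by apply: ler_ltD; [rewrite ler_wpM2l ?subr_ge0// ltW | rewrite ltr_pM2l// lt_def sn0].
rewrite zS -/a -[a in z k + a *: _]mul1r -/(q 1).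
rewrite (_ : z k = q 0); last by rewrite /q mul0r scale0r addr0.
apply: (@is_derive_bounded_increment (w \o q) (fun s => partial w k (q s) * a)) => s s01.
  have := @is_derive1_comp R (fun t : R => w (z k + t *: delta_mx 0 k)) (fun s => s * a)
    s (partial w k (q s)) a.
  apply.
    by apply/is_derive_lineP; constructor=> //; exact: dw (qr s s01) k.
  have := @is_deriveM R R id (cst a) s 1 1 0.
  rewrite scaler0 add0r /GRing.scale /= mulr1; apply.
by rewrite normrM ler_wpM2r// wM// qr.
Qed.

End directional_derivatives.

Section dot_products.
Context {R : realType} {n : nat}.
Implicit Types (a b x y h : 'rV[R]_n).

Lemma dotDr a x y : dot a (x + y) = dot a x + dot a y.
Proof. by rewrite /dot -big_split; apply: eq_bigr => i _; rewrite mxE mulrDr. Qed.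

Lemma dotZr a (s : R) x : dot a (s *: x) = s * dot a x.
Proof. by rewrite /dot mulr_sumr; apply: eq_bigr => i _; rewrite mxE; ring. Qed.

Lemma dot_delta a i : dot a (delta_mx 0 i) = a 0 i.
Proof.
rewrite /dot (bigD1 i)//= mxE !eqxx mulr1 big1 ?addr0// => j ji.
by rewrite mxE (negPf ji) andbF mulr0.
Qed.

Lemma dot_ge0 a : 0 <= dot a a.
Proof. by apply: sumr_ge0 => i _; rewrite -expr2 sqr_ge0. Qed.

(** Cauchy-Schwarz through Lagrange's identity: twice the difference is the sum over i, j of (a_i
    h_j - a_j h_i)^2. *)
Lemma dot_sqr_le a h : dot a h ^+ 2 <= dot a a * dot h h.
Proof.
pose A := \sum_(i < n) \sum_(j < n) (a 0 i * h 0 i * (a 0 j * h 0 j)).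
pose B := \sum_(i < n) \sum_(j < n) (a 0 i * a 0 i * (h 0 j * h 0 j)).
have EA : dot a h ^+ 2 = A.
  by rewrite expr2 /dot mulr_suml; apply: eq_bigr => i _; rewrite mulr_sumr.
have EB : dot a a * dot h h = B.
  by rewrite /dot mulr_suml; apply: eq_bigr => i _; rewrite mulr_sumr.
have EB' : B = \sum_(i < n) \sum_(j < n) (a 0 j * a 0 j * (h 0 i * h 0 i)).
  by rewrite /B exchange_big.
suff : 2 * A <= B + B by rewrite EA EB; move=> AB; lra.
rewrite {2}EB' /A /B mulr_sumr -big_split /=; apply: ler_sum => i _.
rewrite mulr_sumr -big_split /=; apply: ler_sum => j _.
rewrite -subr_ge0 (_ : _ - _ = (a 0 i * h 0 j - a 0 j * h 0 i) ^+ 2); last by ring.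
exact: sqr_ge0.
Qed.

Lemma dot_le_norm h : dot h h <= n%:R * `|h| ^+ 2.
Proof.
have -> : n%:R * `|h| ^+ 2 = \sum_(i < n) `|h| ^+ 2.
  by rewrite sumr_const card_ord mulr_natl.
apply: ler_sum => i _.
by rewrite -expr2 -real_normK ?num_real// lerXn2r ?nnegrE// normr_coord_le.
Qed.

End dot_products.

Section C1_functions.
Context {R : realType} {n : nat}.
Implicit Types (w phi : 'rV[R]_n -> R) (p x y v h : 'rV[R]_n).

Lemma is_derive_affine (b a t : R) : is_derive t (1 : R) (fun s : R => b + s * a) a.
Proof.
have H1 := @is_deriveM R R id (cst a) t 1 1 0.
have H2 := @is_deriveD R R R (cst b) (id * cst a) t 1 0 a.
rewrite add0r in H2; apply: H2.
by rewrite scaler0 add0r /GRing.scale /= mulr1 in H1; apply: H1.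
Qed.

Lemma C1_uniform_partial w p (e : R) : Ck 1 w -> 0 < e ->
  \forall y \near p, forall i, `|partial w i y - partial w i p| <= e.
Proof.
move=> [_ cw] e0.
apply: (@filter_forall _ _ (fun i => [set y | `|partial w i y - partial w i p| <= e])
  (nbhs p) (nbhs_filter p)) => i.
have [_ /(_ p) /cvgrPdist_le /(_ _ e0)] := cw i.
by apply: filterS => y; rewrite distrC.
Qed.

(** Subtracting from w its linear part at p leaves a function with small partial derivatives near p,
    to which [coord_increment_le] applies. *)
Lemma C1_is_derive w : Ck 1 w -> forall p h, is_derive p h w (dot (grad w p) h).
Proof.
move=> C1w p h; have [_ cw] := C1w.
suff L : (fun s : R => s^-1 *: ((w \o pseudometric_normed_Zmodule.shift p) (s *: h) - w p))
    @ 0^' --> dot (grad w p) h.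
  by constructor; [apply/cvg_ex; exists (dot (grad w p) h) | exact: cvg_lim L].
apply/cvgrPdist_le => e e0.
have K0 : 0 < n%:R * `|h| + 1 by rewrite ltr_pwDr// mulr_ge0.
have eK : 0 < e / (n%:R * `|h| + 1) by rewrite divr_gt0.
have /nbhs_ballP[r /= r0 pr] := C1_uniform_partial p C1w eK.
pose u y := w y - dot (grad w p) y.
have du y i : is_derive y (delta_mx 0 i) u (partial w i y - partial w i p).
  apply: is_deriveB; first by constructor=> //; case: (cw i).
  apply/is_derive_at_lineP.
  have := is_derive_affine (dot (grad w p) y) (partial w i p) 0.
  congr is_derive; apply/funext => s.
  by rewrite dotDr dotZr dot_delta mxE.
have incr y : `|p - y| < r ->
    `|u y - u p| <= n%:R * (e / (n%:R * `|h| + 1)) * `|y - p|.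
  move=> py; apply: (@coord_increment_le _ _ u p r) => //.
  - move=> z pz i; rewrite /partial; have [_ ->] := du z i.
    by apply: pr; rewrite /= rV_ballE.
  - by rewrite subrr normr0.
have h10 : 0 < `|h| + 1 by rewrite ltr_wpDl.
exists (r / (`|h| + 1)); first by rewrite /= divr_gt0.
move=> s /=; rewrite sub0r normrN => sr sn0.
have psr : `|p - (s *: h + p)| < r.
  rewrite opprD addrCA subrr addr0 normrN normrZ.
  apply: le_lt_trans (_ : `|s| * `|h| <= `|s| * (`|h| + 1)) _.
    by rewrite ler_wpM2l// lerDl.
  by rewrite -ltr_pdivlMr.
have {incr} := incr _ psr; rewrite /u addrK normrZ => I.
have s0 : 0 < `|s| by rewrite normr_gt0.
have -> : dot (grad w p) h - s^-1 *: (w (s *: h + p) - w p) =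
    - (s^-1 * (w (s *: h + p) - dot (grad w p) (s *: h + p) - (w p - dot (grad w p) p))).
  rewrite dotDr dotZr /GRing.scale /=; field.
  by rewrite -normr_gt0.
rewrite normrN normrM normfV mulrC ler_pdivrMr//; apply: le_trans I _.
set K := n%:R * `|h| + 1 in K0 *.
rewrite (_ : _ * (`|s| * `|h|) = e * `|s| * (n%:R * `|h| / K)); last by ring.
rewrite ler_piMr ?mulr_ge0 ?(ltW e0)// ler_pdivrMr// mul1r.
by rewrite /K lerDl.
Unshelve. all: by end_near. Qed.

Lemma is_derive_comp_scalar (F : R -> R) phi p v (a b : R) :
  is_derive (phi p) (1 : R) F a -> is_derive p v phi b -> is_derive p v (F \o phi) (a * b).
Proof.
move=> dF /is_derive_at_lineP dphi; apply/is_derive_at_lineP.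
apply: (@is_derive1_comp R F (fun s : R => phi (p + s *: v)) 0 a b) => //.
by rewrite scale0r addr0.
Qed.

Lemma partial_comp (F F' : R -> R) phi : (forall s : R, is_derive s (1 : R) F (F' s)) ->
  Ck 1 phi -> forall i x, is_derive x (delta_mx 0 i) (F \o phi) (F' (phi x) * partial phi i x).
Proof.
move=> dF [_ cphi] i x; apply: is_derive_comp_scalar => //.
by constructor=> //; case: (cphi i).
Qed.

Lemma C1_comp (F F' : R -> R) phi : (forall s : R, is_derive s (1 : R) F (F' s)) ->
  continuous F' -> Ck 1 phi -> Ck 1 (F \o phi).
Proof.
move=> dF cF' C1phi; have dFphi := partial_comp dF C1phi; have [cphi dphi] := C1phi.
split=> [x|i].
  apply: continuous_comp; first exact: cphi.
  by apply: differentiable_continuous; apply/derivable1_diffP; case: (dF (phi x)).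
split; first by move=> x; case: (dFphi i x).
have -> : partial (F \o phi) i = fun y => F' (phi y) * partial phi i y.
  by apply/funext => y; rewrite /partial; case: (dFphi i y).
have c2 (x : 'rV[R]_n) : {for x, continuous (fun y => F' (phi y) * partial phi i y)}.
  apply: (@continuousM _ _ (F' \o phi)); last by case: (dphi i) => _; exact.
  by apply: continuous_comp; [exact: cphi | exact: cF'].
exact: c2.
Qed.

Lemma grad_comp (F F' : R -> R) phi : (forall s : R, is_derive s (1 : R) F (F' s)) ->
  Ck 1 phi -> forall x, grad (F \o phi) x = F' (phi x) *: grad phi x.
Proof.
move=> dF C1phi x; apply/rowP => i; rewrite !mxE /partial.
by case: (partial_comp dF C1phi i x).
Qed.

Lemma C1_continuous w : Ck 1 w -> continuous w. Proof. by case. Qed.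

Lemma smoothC1 phi : smooth phi -> Ck 1 phi. Proof. exact. Qed.

Lemma continuous_dot_grad w : Ck 1 w ->
  forall h, continuous (fun x => dot (grad w x) h).
Proof.
move=> [_ dw] h.
rewrite (_ : (fun _ => _) = (fun y : 'rV[R]_n => \sum_(i < n) partial w i y * h 0 i)).
  apply: continuous_big => [|i _ y]; first exact: add_continuous.
  apply: (@continuousM _ _ (partial w i) (cst (h 0 i))).
    by case: (dw i) => _; exact.
  exact: cst_continuous.
by apply/funext => y; apply: eq_bigr => i _; rewrite mxE.
Qed.

End C1_functions.

(** * Increments along lines and the Dirichlet integral *)

Section line_energy.
Context {R : realType} {n : nat}.
Local Notation lebT := (caratheodory_type (@lebesgue_outer R n)).
Variables (w : 'rV[R]_n -> R) (W : set 'rV[R]_n).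
Hypotheses (C1w : Ck 1 w) (oW : open W).

Lemma measurable_preimage_halfspace d (T : measurableType d) (X : T -> 'rV[R]_n) :
  (forall i, measurable_fun setT (fun t => X t 0 i)) ->
  forall i c, measurable (X @^-1` halfspace i c).
Proof.
move=> mX i c; have := mX i measurableT `]-oo, c]%classic (measurable_itv _).
by rewrite setTI; congr measurable; apply/seteqP; split=> t; rewrite /preimage /= in_itv.
Qed.

Lemma measurable_coord i : measurable_fun [set: lebT] (fun x : lebT => (x : 'rV[R]_n) 0 i).
Proof.
apply: (measurability _ (measurable_realfun.RGenInftyO.measurableE R)).
move=> _ [_ [c ->] <-]; rewrite setTI.
apply: (open_cara_measurable measurable_halfspace_lebesgue).
apply: (@open_comp _ _ (fun x : 'rV[R]_n => x 0 i)); last exact: interval_open.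
by move=> x _; exact: coord_continuous.
Qed.

(** The cut-off by W turns integrals over W into integrals over the whole space, where translation
    invariance applies directly. *)
Definition slope2 h y : R := dot (grad w y) h ^+ 2 * \1_W y.

Definition line_energy h x : \bar R :=
  (\int[lebesgue_measure]_(s in `[0%R, 1%R]) (slope2 h (x + s *: h))%:E)%E.

Lemma slope2_ge0 h y : 0 <= slope2 h y.
Proof. by rewrite mulr_ge0 ?sqr_ge0. Qed.

Lemma measurable_slope2 d (T : measurableType d) (X : T -> 'rV[R]_n) h :
  (forall i, measurable_fun setT (fun t => X t 0 i)) ->
  measurable_fun setT (fun t => slope2 h (X t)).
Proof.
move=> /measurable_preimage_halfspace mX; apply: measurable_funM.
  apply: measurable_funX.
  have := measurable_fun_continuous_on mX openT (fun x _ => @continuous_dot_grad _ _ w C1w h x).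
  by rewrite preimage_setT.
by apply: (@measurable_indic _ _ _ _ (X @^-1` W)); exact: measurable_preimage_open.
Qed.

Lemma measurable_line (x h : 'rV[R]_n) i : measurable_fun [set: R] (fun s : R => (x + s *: h : 'rV[R]_n) 0 i).
Proof.
rewrite (_ : (fun _ => _) = (fun s : R => x 0 i + s * h 0 i)); last first.
  by apply/funext => s; rewrite !mxE.
by apply: measurable_funD => //; apply: measurable_funM.
Qed.

Lemma continuous_slope (x h : 'rV[R]_n) : continuous (fun s : R => dot (grad w (x + s *: h)) h).
Proof.
move=> s; apply: (@continuous_comp _ _ _ (fun s : R => x + s *: h)
  (fun y => dot (grad w y) h)); last exact: continuous_dot_grad.
by apply: cvgD; [exact: cvg_cst | exact: scalel_continuous].
Qed.

(** Cauchy-Schwarz in linearized form: if c is the increment and k the slope along the segment, then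
    k^2 >= 2 c k - c^2, whose integral over [0, tau] is c^2 (2 - tau) >= c^2. Only the points before
    tau have to lie in W, so the endpoint may be a boundary point. *)
Lemma sqr_increment_le_line_energy (x h : 'rV[R]_n) (tau : R) : 0 <= tau <= 1 ->
  (forall s, 0 <= s < tau -> W (x + s *: h)) ->
  (((w (x + tau *: h) - w x) ^+ 2)%:E <= line_energy h x)%E.
Proof.
move=> /andP[]; rewrite le_eqVlt => /predU1P[<- _ _|tau0 tau1 inW].
  rewrite scale0r addr0 subrr expr0n /=; apply: integral_ge0 => s _.
  by rewrite lee_fin slope2_ge0.
set c := w (x + tau *: h) - w x.
pose k (s : R) := dot (grad w (x + s *: h)) h.
pose G (s : R) := 2 * c * w (x + s *: h) - c ^+ 2 * s.
have ck : continuous k := @continuous_slope x h.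
have cg : continuous (fun s : R => 2 * c * k s - c ^+ 2).
  by move=> s; apply: cvgB; [apply: cvgM; [exact: cvg_cst | exact: ck] | exact: cvg_cst].
have dG (s : R) : is_derive s (1 : R) G (2 * c * k s - c ^+ 2).
  have H1 : is_derive s (1 : R) (fun s : R => w (x + s *: h)) (k s).
    by apply/is_derive_lineP; exact: C1_is_derive.
  have := @is_derive1_comp R (fun u : R => 0 + u * (2 * c)) (fun s : R => w (x + s *: h))
    s (2 * c) (k s) (is_derive_affine _ _ _) H1.
  move=> H2; have := @is_deriveB R R R _ _ s 1 _ _ H2 (is_derive_affine 0 (c ^+ 2) s).
  congr is_derive; apply/funext => u; rewrite /G /= !fctE /=; ring.
have cG : continuous G.
  by move=> s; apply: differentiable_continuous; apply/derivable1_diffP; case: (dG s).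
have FTC : (\int[lebesgue_measure]_(s in `[0%R, tau]) (2 * c * k s - c ^+ 2)%:E =
    (G tau)%:E - (G 0)%:E)%E.
  apply: continuous_FTC2 => //; first exact: continuous_subspaceT.
    split=> [s _||]; first by case: (dG s).
      exact: (cvg_at_right_filter (cG 0)).
    exact: (cvg_at_left_filter (cG tau)).
  by move=> s _; rewrite derive1E; case: (dG s).
have int_cont (q : R -> R) : continuous q ->
    lebesgue_measure.-integrable `[0, tau] (EFin \o q).
  move=> cq; apply: continuous_compact_integrable; first exact: segment_compact.
  exact: continuous_subspaceT.
have ck2 : continuous (fun s => k s ^+ 2).
  by move=> s; apply: cvgM; exact: ck.
apply: (@le_trans _ _ (\int[lebesgue_measure]_(s in `[0%R, tau]) (k s ^+ 2)%:E)%E).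
  apply: (@le_trans _ _ (\int[lebesgue_measure]_(s in `[0%R, tau])
      (2 * c * k s - c ^+ 2)%:E)%E).
    rewrite FTC -EFinB lee_fin /G scale0r addr0 mulr0 subr0.
    rewrite (_ : _ - _ = 2 * c * (w (x + tau *: h) - w x) - c ^+ 2 * tau); last by ring.
    rewrite -/c -mulrA -expr2 -subr_ge0.
    rewrite (_ : _ - _ = c ^+ 2 * (1 - tau)); last by ring.
    by rewrite mulr_ge0 ?sqr_ge0// subr_ge0.
  apply: le_integral => //; [exact: int_cont | exact: int_cont | move=> s _].
  by rewrite lee_fin -subr_ge0 (_ : _ - _ = (k s - c) ^+ 2) ?sqr_ge0//; ring.
have mk2 : measurable_fun [set: R] (fun s => (k s ^+ 2)%:E).
  by apply/measurable_EFinP; exact: continuous_measurable_fun.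
rewrite -integral_itv_bndo_bndc; last exact: measurable_funTS.
apply: (@le_trans _ _ (\int[lebesgue_measure]_(s in `[0%R, tau[) (slope2 h (x + s *: h))%:E)%E).
  rewrite le_eqVlt; apply/orP; left; apply/eqP; apply: eq_integral => s.
  by rewrite inE /= in_itv /= => /inW Ws; rewrite /slope2 indicE mem_set// mulr1.
apply: ge0_subset_integral => //.
- apply/measurable_EFinP; apply: measurable_funTS; apply: measurable_slope2 => i.
  exact: measurable_line.
- by move=> s _; rewrite lee_fin slope2_ge0.
- move=> s /=; rewrite !in_itv /= => /andP[-> st] /=; exact: ltW (lt_le_trans st tau1).
Qed.

Lemma measurable_add_fun d (T : measurableType d) (X Y : T -> 'rV[R]_n) :
  (forall i, measurable_fun setT (fun t => X t 0 i)) ->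
  (forall i, measurable_fun setT (fun t => Y t 0 i)) ->
  forall i, measurable_fun setT (fun t => (X t + Y t) 0 i).
Proof.
move=> mX mY i; rewrite (_ : (fun _ => _) = (fun t => X t 0 i + Y t 0 i)).
  exact: measurable_funD.
by apply/funext => t; rewrite mxE.
Qed.

Definition dirichlet : \bar R :=
  (\int[@leb R n]_(y in W) (dot (grad w y) (grad w y))%:E)%E.

Lemma measurable_grad_sqr (A : set lebT) :
  measurable_fun A (fun y : lebT => dot (grad w y) (grad w y)).
Proof.
apply: measurable_funTS; rewrite /dot.
apply: (@measurable_sum _ lebT R setT _ _ (fun i y => grad w y 0 i * grad w y 0 i)) => i.
have m : measurable_fun [set: lebT] (fun y : lebT => grad w y 0 i).
  rewrite (_ : (fun _ => _) = partial w i); last by apply/funext => y; rewrite mxE.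
  apply: (cara_measurable_fun_continuous measurable_halfspace_lebesgue).
  by have [_ /(_ i)[]] := C1w.
exact: measurable_funM.
Qed.

Lemma integral_slope2_le h :
  (\int[@leb R n]_y (slope2 h y)%:E <= (dot h h)%:E * dirichlet)%E.
Proof.
have mW : measurable (W : set lebT) := open_cara_measurable measurable_halfspace_lebesgue oW.
have mE (A : set lebT) : measurable_fun A (fun y : lebT => (dot (grad w y) (grad w y))%:E).
  by apply/measurable_EFinP; exact: measurable_grad_sqr.
have hh : (0 <= (dot h h)%:E)%E by rewrite lee_fin dot_ge0.
have E0 (y : lebT) : (0 <= (dot (grad w y) (grad w y))%:E)%E by rewrite lee_fin dot_ge0.
rewrite /dirichlet -(ge0_integralZl (@leb R n) mW (mE W) (fun y _ => E0 y) hh).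
rewrite [leRHS]integral_mkcond.
apply: (@ge0_le_integral _ lebT R (@leb R n) setT measurableT).
- by move=> y _; rewrite lee_fin slope2_ge0.
- by apply/measurable_EFinP; apply: (@measurable_slope2 _ lebT id) => i; exact: measurable_coord.
- apply/(measurable_restrictT _ mW).
  exact: (emeasurable_funM (measurable_cst _) (mE W)).
move=> y _; rewrite /slope2 /patch indicE; case: (y \in W) => /=; last by rewrite mulr0.
by rewrite mulr1 -EFinM lee_fin [dot h h * _]mulrC dot_sqr_le.
Qed.

Let slope_integrand h (z : lebT * measurableTypeR R) : \bar R :=
  (slope2 h ((z.1 : 'rV[R]_n) + z.2 *: h) * \1_(`[0, 1]%classic : set R) z.2)%:E.

Let slope_integrand_ge0 h z : (0 <= slope_integrand h z)%E.
Proof. by rewrite lee_fin mulr_ge0 ?slope2_ge0. Qed.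

Let measurable_slope_integrand h : measurable_fun setT (slope_integrand h).
Proof.
apply/measurable_EFinP; apply: measurable_funM.
  apply: measurable_slope2; apply: measurable_add_fun => i.
    by apply: (@measurableT_comp _ _ _ _ _ _ (fun x : lebT => (x : 'rV[R]_n) 0 i) _ fst);
      [exact: measurable_coord | exact: measurable_fst].
  rewrite (_ : (fun _ => _) = (fun z : lebT * measurableTypeR R => z.2 * h 0 i)); last first.
    by apply/funext => t; rewrite mxE.
  by apply: measurable_funM => //; exact: measurable_snd.
apply: (@measurable_indic _ _ _ setT (snd @^-1` (`[0, 1]%classic : set (measurableTypeR R)))).
by rewrite -[X in measurable X]setTI; apply: measurable_snd => //; exact: measurable_itv.
Qed.

Let line_energyE h x : line_energy h x = (\int[lebesgue_measure]_s slope_integrand h (x, s))%E.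
Proof.
rewrite /line_energy integral_mkcond.
by apply: eq_integral => s _; rewrite epatch_indic EFinM.
Qed.

Lemma line_energy_ge0 h x : (0 <= line_energy h x)%E.
Proof. by apply: integral_ge0 => s _; rewrite lee_fin slope2_ge0. Qed.

Lemma measurable_line_energy h : measurable_fun [set: lebT] (line_energy h).
Proof.
rewrite (_ : line_energy h = (fun x => \int[lebesgue_measure]_s slope_integrand h (x, s))%E).
  apply: measurable_fun_fubini_tonelli_F => //; exact: measurable_slope_integrand.
by apply/funext => x; exact: line_energyE.
Qed.

(** After Tonelli, the inner integral over x at fixed s is independent of s by translation
    invariance, and s runs over an interval of length 1. *)
Lemma integral_line_energy_le h :
  (\int[@leb R n]_x line_energy h x <= (dot h h)%:E * dirichlet)%E.
Proof.
pose P := slope_integrand h; have mP := @measurable_slope_integrand h.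
have P0 z : (0 <= P z)%E by exact: slope_integrand_ge0.
have -> : (\int[@leb R n]_x line_energy h x =
           \int[@leb R n]_x \int[lebesgue_measure]_s P (x, s))%E.
  by apply: eq_integral => x _; rewrite line_energyE.
rewrite (fubini_tonelli P mP P0).
set K := (\int[@leb R n]_y (slope2 h y)%:E)%E.
have K0 : (0 <= K)%E by apply: integral_ge0 => y _; rewrite lee_fin slope2_ge0.
have ms : measurable_fun [set: lebT] (fun y => (slope2 h y)%:E).
  by apply/measurable_EFinP; apply: (@measurable_slope2 _ lebT id) => i; exact: measurable_coord.
have -> : (\int[lebesgue_measure]_s \int[@leb R n]_x P (x, s) =
    \int[lebesgue_measure]_s (K * (\1_(`[0%R, 1%R]%classic : set R) s)%:E))%E.
  apply: eq_integral => s _.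
  have KE : K = (\int[@leb R n]_x (slope2 h (translate (s *: h) x))%:E)%E.
    have := @ge0_integral_translate R n (s *: h) setT (fun y => (slope2 h y)%:E).
    by rewrite preimage_setT => -> // y _; rewrite lee_fin slope2_ge0.
  have mt : measurable_fun [set: lebT] (fun x => (slope2 h (translate (s *: h) x))%:E).
    apply/measurable_EFinP; apply: (@measurable_slope2 _ lebT) => i.
    exact: (@measurable_add_fun _ lebT id (cst (s *: h)) measurable_coord (fun j => measurable_cst _)).
  by rewrite KE -ge0_integralZr// => y _; rewrite lee_fin slope2_ge0.
rewrite ge0_integralZl//; last first.
  by apply/measurable_EFinP; exact: measurable_indic.
rewrite integral_indic// setIT /= lebesgue_measure_itv /= lte_fin ltr01 oppr0 adde0 mule1.
exact: integral_slope2_le.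
Qed.

End line_energy.

(** * Propagation of bounds along segments *)

Section propagation.
Context {R : realType} {n : nat}.
Local Notation lebT := (caratheodory_type (@lebesgue_outer R n)).
Variables (w : 'rV[R]_n -> R) (W : set 'rV[R]_n).
Hypotheses (C1w : Ck 1 w) (oW : open W).
Local Notation E := (dirichlet w W).

Lemma dirichlet_ge0 : (0 <= E)%E.
Proof. by apply: integral_ge0 => y _; rewrite lee_fin dot_ge0. Qed.

Lemma measurable_C1 (A : set lebT) : measurable_fun A (w : lebT -> R).
Proof.
apply: (cara_measurable_fun_continuous measurable_halfspace_lebesgue).
exact: C1_continuous.
Qed.

Lemma measurable_C1_comp d (T : measurableType d) (X : T -> 'rV[R]_n) :
  (forall i, measurable_fun setT (fun t => X t 0 i)) -> measurable_fun setT (fun t => w (X t)).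
Proof.
move=> /measurable_preimage_halfspace mX.
have := measurable_fun_continuous_on mX openT (fun x _ => C1_continuous C1w (x := x)).
by rewrite preimage_setT.
Qed.

Variables (U H S : set lebT) (R2 L m : R).
Hypotheses (mU : measurable U) (mH : measurable H) (mS : measurable S) (m_gt0 : 0 < m).
Hypothesis UHW : forall x h (t : R), U x -> H h -> 0 <= t < 1 -> W (x + t *: h).
Hypothesis HR2 : forall h, H h -> dot h h <= R2.
Hypothesis Hm : forall x, U x -> (m%:E <= @leb R n (H `&` translate x @^-1` S))%E.
Hypothesis SL : forall y, S y -> `|w y| <= L.

Let P (z : lebT * lebT) : \bar R :=
  ((w ((z.1 : 'rV[R]_n) + z.2) - w z.1) ^+ 2 * \1_H z.2)%:E.

Let I x := (\int[@leb R n]_h P (x, h))%E.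

Let P_ge0 z : (0 <= P z)%E.
Proof. by rewrite lee_fin mulr_ge0 ?sqr_ge0. Qed.

Let measurable_coord_fst i :
  measurable_fun [set: lebT * lebT] (fun z => (z.1 : 'rV[R]_n) 0 i).
Proof.
by apply: (@measurableT_comp _ _ _ _ _ _ (fun x : lebT => (x : 'rV[R]_n) 0 i) _ fst);
  [exact: measurable_coord | exact: measurable_fst].
Qed.

Let measurable_coord_snd i :
  measurable_fun [set: lebT * lebT] (fun z => (z.2 : 'rV[R]_n) 0 i).
Proof.
by apply: (@measurableT_comp _ _ _ _ _ _ (fun x : lebT => (x : 'rV[R]_n) 0 i) _ snd);
  [exact: measurable_coord | exact: measurable_snd].
Qed.

Let mP : measurable_fun setT P.
Proof.
apply/measurable_EFinP; apply: measurable_funM.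
  apply: measurable_funX; apply: measurable_funB.
    apply: measurable_C1_comp; apply: measurable_add_fun => i.
      exact: measurable_coord_fst.
    exact: measurable_coord_snd.
  by apply: measurable_C1_comp => i; exact: measurable_coord_fst.
apply: (@measurable_indic _ _ _ setT (snd @^-1` H)).
by rewrite -[X in measurable X]setTI; apply: measurable_snd.
Qed.

Let mI : measurable_fun setT I.
Proof. exact: measurable_fun_fubini_tonelli_F. Qed.

Let I_ge0 x : (0 <= I x)%E. Proof. exact: integral_ge0. Qed.

(** If w(x)^2 exceeds 2 L^2, each displacement from x into S changes w by an amount whose square is
    at least half of the excess, and these displacements have measure at least m. *)
Let pointwise x : U x -> ((w x ^+ 2)%:E <= (2 * L ^+ 2)%:E + (2 / m)%:E * I x)%E.
Proof.
move=> Ux; have [wL|Lw] := leP (w x ^+ 2) (2 * L ^+ 2).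
  apply: (@le_trans _ _ (2 * L ^+ 2)%:E); first by rewrite lee_fin.
  by rewrite leeDl// mule_ge0// lee_fin divr_ge0// ltW.
set a := w x ^+ 2 - 2 * L ^+ 2; have a0 : 0 < a by rewrite subr_gt0.
pose Hx : set lebT := H `&` translate x @^-1` S.
have mHx : measurable Hx.
  apply: measurableI => //; rewrite -[X in measurable X]setTI.
  exact: measurable_translate.
have key : ((a * m)%:E <= 2%:E * I x)%E.
  apply: (@le_trans _ _ (a%:E * @leb R n Hx)%E).
    rewrite EFinM; apply: lee_wpmul2l; first by rewrite lee_fin ltW.
    exact: Hm.
  have mPx : measurable_fun setT (fun h => P (x, h)).
    by apply: measurableT_comp mP _; exact: measurable_pair1.
  have <- := integral_cst (@leb R n) mHx a%:E.
  rewrite (integral_mkcond Hx).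
  have <- : (\int[@leb R n]_h (2%:E * P (x, h)) = 2%:E * I x)%E.
    by apply: ge0_integralZl.
  apply: ge0_le_integral.
  - exact: measurableT.
  - by move=> h _; apply: erestrict_ge0 => z _; rewrite lee_fin ltW.
  - by apply/(measurable_restrictT _ mHx); exact: measurable_cst.
  - by apply: emeasurable_funM; [exact: measurable_cst | exact: mPx].
  move=> h _; rewrite /patch; case: ifPn => [|_]; last by rewrite mule_ge0.
  rewrite inE => -[Hh Sxh]; rewrite /P /= indicE mem_set// mulr1 -EFinM lee_fin.
  have wL : w (x + h) ^+ 2 <= L ^+ 2.
    rewrite -(real_normK (num_real _)) lerXn2r ?nnegrE//; last first.
      by have := SL Sxh; rewrite /translate addrC.
    exact: le_trans (normr_ge0 _) (SL Sxh).
  rewrite /a lerBlDr; set q := w (x + h) in wL *; set p := w x.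
  have : 0 <= (2 * q - p) ^+ 2 by exact: sqr_ge0.
  rewrite (_ : _ ^+ 2 = 2 * (q - p) ^+ 2 + 2 * q ^+ 2 - p ^+ 2); last by ring.
  lra.
have : (((a * m) / m)%:E <= (2 / m)%:E * I x)%E.
  have -> : ((2 / m)%:E * I x = (m^-1)%:E * (2%:E * I x))%E.
    by rewrite muleA -EFinM [m^-1 * 2]mulrC.
  rewrite [a * m / m]mulrC EFinM; apply: lee_wpmul2l; last exact: key.
  by rewrite lee_fin invr_ge0 ltW.
rewrite mulfK ?gt_eqF// => aI.
by rewrite (_ : w x ^+ 2 = 2 * L ^+ 2 + a) ?EFinD ?leeD2l// /a addrC subrK.
Qed.

(** Integrating over x first, at fixed h: the squared increment is then bounded by the line energy
    in the direction h. *)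
Let integral_I : (\int[@leb R n]_(x in U) I x <= (R2%:E * E) * @leb R n H)%E.
Proof.
pose P' (z : lebT * lebT) : \bar R := (P z * (\1_U z.1)%:E)%E.
have mP' : measurable_fun setT P'.
  apply: emeasurable_funM => //; apply/measurable_EFinP.
  apply: (@measurable_indic _ _ _ setT (fst @^-1` U)).
  by rewrite -[X in measurable X]setTI; apply: measurable_fst.
have P'0 z : (0 <= P' z)%E by rewrite mule_ge0.
have mP1 x : measurable_fun setT (fun h => P (x, h)).
  by apply: measurableT_comp mP _; exact: measurable_pair1.
have -> : (\int[@leb R n]_(x in U) I x = \int[@leb R n]_x \int[@leb R n]_h P' (x, h))%E.
  rewrite integral_mkcond; apply: eq_integral => x _.
  have U0 : (0%:E <= (\1_U x : R)%:E)%E by rewrite lee_fin.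
  by rewrite epatch_indic -(ge0_integralZr (@leb R n) measurableT (mP1 x) (fun h _ => P_ge0 _) U0).
rewrite (fubini_tonelli P' mP' P'0).
have <- := integral_cst (@leb R n) mH (R2%:E * E)%E.
rewrite (integral_mkcond H); apply: ge0_le_integral.
- exact: measurableT.
- by move=> h _; apply: integral_ge0.
- exact: (measurable_fun_fubini_tonelli_G P').
- by apply/(measurable_restrictT _ mH); exact: measurable_cst.
move=> h _; rewrite /patch; case: ifPn => [|hH]; last first.
  by rewrite integral0_eq// => x _; rewrite /P' /P /= indicE (negPf hH) mulr0 mul0e.
rewrite inE => Hh; apply: (@le_trans _ _ (\int[@leb R n]_x line_energy w W h x)%E); last first.
  apply: le_trans (integral_line_energy_le C1w oW h) _.
  by apply: lee_wpmul2r; [exact: dirichlet_ge0 | rewrite lee_fin HR2].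
apply: ge0_le_integral.
- exact: measurableT.
- by move=> x _; exact: P'0.
- by apply: measurableT_comp mP' _; exact: measurable_pair2.
- exact: measurable_line_energy.
move=> x _; rewrite /P' /= indicE; case: (boolP (x \in U)) => [/set_mem Ux|_] /=; last first.
  by rewrite mule0 line_energy_ge0.
rewrite mule1 /P /= indicE mem_set// mulr1.
have := @sqr_increment_le_line_energy R n w W C1w oW x h 1.
rewrite scale1r; apply; first by rewrite ler01 lexx.
by move=> s s01; exact: UHW.
Qed.

(* Poincare-type estimate: w is bounded by L on S, and S is seen from every point
   of U through a set of displacements in H of measure at least m. *)
Lemma sqr_integral_propagation :
  (\int[@leb R n]_(x in U) (w x ^+ 2)%:E <=
   (2 * L ^+ 2)%:E * @leb R n U + (2 / m)%:E * ((R2%:E * E) * @leb R n H))%E.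
Proof.
apply: (@le_trans _ _ (\int[@leb R n]_(x in U) ((2 * L ^+ 2)%:E + (2 / m)%:E * I x))%E).
  apply: ge0_le_integral.
  - exact: mU.
  - by move=> x _; rewrite lee_fin sqr_ge0.
  - by apply/measurable_EFinP; apply: measurable_funX; exact: measurable_C1.
  - apply: emeasurable_funD; first exact: measurable_cst.
    by apply: emeasurable_funM; [exact: measurable_cst | exact: measurable_funTS].
  - exact: pointwise.
have c0 : (0 <= (2 / m)%:E)%E by rewrite lee_fin divr_ge0// ltW.
have mIU : measurable_fun U I by exact: measurable_funTS.
have k0 : (0 <= (2 * L ^+ 2)%:E)%E by rewrite lee_fin mulr_ge0 ?sqr_ge0.
have mcI : measurable_fun U (fun x => (2 / m)%:E * I x)%E.
  by apply: emeasurable_funM; [exact: measurable_cst | exact: mIU].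
have -> := ge0_integralD (@leb R n) mU (fun x _ => k0) (measurable_cst _)
  (fun x _ => mule_ge0 c0 (I_ge0 x)) mcI.
have E1 := integral_cst (@leb R n) mU (2 * L ^+ 2)%:E.
have E2 := ge0_integralZl (@leb R n) mU mIU (fun x _ => I_ge0 x) c0.
apply: leeD; first by rewrite -E1.
by rewrite E2; apply: lee_wpmul2l => //; exact: integral_I.
Qed.

End propagation.

(** * Integration by parts *)

Section bounded_continuous.
Context {R : realType} {n : nat}.

Lemma continuous_bounded_ball (f : 'rV[R]_n -> R) (r : R) : continuous f ->
  exists2 M, 0 <= M & forall x, `|x| <= r -> `|f x| <= M.
Proof.
move=> cf; pose A := [set x : 'rV[R]_n | `|x| <= r].
have bA : bounded_set A.
  by exists r; split; [exact: num_real | move=> M rM x /= /le_trans; apply; exact: ltW].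
have cA : closed A.
  apply: (@closed_comp _ _ _ [set x : R | x <= r]); last exact: closed_le.
  by move=> x _; exact: norm_continuous.
have : bounded_set (f @` A).
  apply: compact_bounded; apply: continuous_compact; last exact: bounded_closed_compact.
  exact: continuous_subspaceT.
move=> /pinfty_ex_gt0[M M0 fM]; exists M; first exact: ltW.
by move=> x xr; apply: fM; exists x.
Qed.

Lemma continuous_bounded_on (f : 'rV[R]_n -> R) (A : set 'rV[R]_n) :
  continuous f -> bounded_set A -> exists2 M, 0 <= M & forall x, A x -> `|f x| <= M.
Proof.
move=> cf /pinfty_ex_gt0[r r0 Ar]; have [M M0 fM] := continuous_bounded_ball r cf.
by exists M => // x Ax; apply: fM; exact: Ar.
Qed.

End bounded_continuous.

Section integration_by_parts.
Context {R : realType} {n : nat}.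
Local Notation lebT := (caratheodory_type (@lebesgue_outer R n)).
Local Notation leb := (@leb R n).

Lemma integral_translate (h : 'rV[R]_n) (f : lebT -> \bar R) : measurable_fun setT f ->
  (\int[leb]_x f (translate h x) = \int[leb]_x f x)%E.
Proof.
move=> mf; rewrite (integralE _ _ (f \o translate h)) (integralE _ _ f).
rewrite funepos_comp funeneg_comp; congr (_ - _)%E.
  have := @ge0_integral_translate R n h setT (f^\+)%E.
  by rewrite preimage_setT; apply=> //; exact: measurable_funepos.
have := @ge0_integral_translate R n h setT (f^\-)%E.
by rewrite preimage_setT; apply=> //; exact: measurable_funeneg.
Qed.

Lemma leb_ball_lty (r : R) : (leb [set x : 'rV[R]_n | (`|x| <= r)%R] < +oo)%E.
Proof. exact: (@lebesgue_outer_ball_lty _ _ r). Qed.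

Lemma measurable_ball_leb (r : R) : measurable ([set x : 'rV[R]_n | `|x| <= r] : set lebT).
Proof.
apply: (closed_cara_measurable measurable_halfspace_lebesgue).
apply: (@closed_comp _ _ _ [set x : R | x <= r]); last exact: closed_le.
by move=> x _; exact: norm_continuous.
Qed.

Lemma continuous_integrable (A : set lebT) (f : 'rV[R]_n -> R) : measurable A ->
  bounded_set (A : set 'rV[R]_n) -> continuous f -> leb.-integrable A (EFin \o f).
Proof.
move=> mA bA cf; apply: measurable_bounded_integrable => //.
- exact: leb_bounded_lty.
- exact: (cara_measurable_fun_continuous measurable_halfspace_lebesgue).
- have [M M0 fM] := continuous_bounded_on cf bA.
  by exists M; split; [exact: num_real | move=> x Mx y Ay; exact: le_trans (fM _ Ay) (ltW Mx)].
Qed.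

Lemma bounded_set_ball (r : R) : bounded_set [set x : 'rV[R]_n | `|x| <= r].
Proof.
by exists r; split; [exact: num_real | move=> M rM x /= /le_trans; apply; exact: ltW].
Qed.

Lemma continuous_supported_integrable (f : 'rV[R]_n -> R) (r : R) : continuous f ->
  (forall x, r < `|x| -> f x = 0) -> leb.-integrable setT (EFin \o f).
Proof.
move=> cf fr; rewrite (_ : EFin \o f = (EFin \o f) \_ [set x : 'rV[R]_n | `|x| <= r]).
  apply/(integrable_mkcond _ (measurable_ball_leb r)).
  apply: continuous_integrable => //; [exact: measurable_ball_leb | exact: bounded_set_ball].
apply/funext => x; rewrite /patch /=; case: ifPn => // /negP; rewrite inE /= => xr.
by rewrite fr// ltNge; apply/negP.
Qed.

Lemma partial_eq0_near (w : 'rV[R]_n -> R) i x :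
  (\forall y \near x, w y = 0) -> partial w i x = 0.
Proof.
move=> w0; rewrite /partial (_ : 'D_(delta_mx 0 i) w x = 'D_(delta_mx 0 i) (cst 0) x).
  by rewrite derive_cst.
by apply: near_eq_derive.
Qed.

(** Each difference quotient has integral zero by translation invariance. With steps at most 1, all
    of them are supported in the ball of radius r + 1 and bounded by the supremum of the partial
    derivative, which dominates the passage to the limit. *)
Lemma integral_partial_eq0 (w : 'rV[R]_n -> R) (r : R) i : Ck 1 w ->
  (forall x, r < `|x| -> w x = 0) -> (\int[leb]_x (partial w i x)%:E = 0)%E.
Proof.
move=> C1w wr; have [cw dw] := C1w; have [dwi cwi] := dw i.
set e : 'rV[R]_n := delta_mx 0 i.
have e1 : `|e| <= 1.
  apply: rV_norm_leP => // j; rewrite mxE; case: (_ && _); rewrite ?normr1 ?normr0//.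
have pr x : r < `|x| -> partial w i x = 0.
  move=> rx; apply: partial_eq0_near.
  have : nbhs x [set y : 'rV[R]_n | r < `|y|].
    apply: open_nbhs_nbhs; split=> //.
    apply: (@open_comp _ _ _ [set x : R | r < x]); last exact: open_gt.
    by move=> y _; exact: norm_continuous.
  by apply: filterS => y; exact: wr.
have [M M0 pM'] := continuous_bounded_ball r cwi.
have pM x : `|partial w i x| <= M.
  by have [/pM'//|/pr ->] := leP `|x| r; rewrite normr0.
pose t k : R := k.+1%:R^-1.
have t0 k : 0 < t k by rewrite invr_gt0.
have t1 k : t k <= 1 by rewrite invf_le1// ler1n.
pose q k (x : lebT) : \bar R := ((t k)^-1 * (w (translate (t k *: e) x) - w x))%:E.
have iw : leb.-integrable setT (EFin \o w) by exact: continuous_supported_integrable wr.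
have mw : measurable_fun [set: lebT] (fun x => (w x)%:E) by exact: (measurable_int leb iw).
have cwt k : continuous (fun x : 'rV[R]_n => w (x + t k *: e)).
  move=> x; apply: (@continuous_comp _ _ _ (fun x : 'rV[R]_n => x + t k *: e) w); last exact: cw.
  exact: (@continuousD R _ _ idfun (cst (t k *: e)) x (fun A nA => nA) (@cst_continuous _ _ _ x)).
have tle k x : `|w (translate (t k *: e) x) - w x| <= M * t k.
  have := @is_derive_bounded_increment R (fun s : R => w ((x : 'rV[R]_n) + s *: (t k *: e)))
    (fun s : R => dot (grad w ((x : 'rV[R]_n) + s *: (t k *: e))) (t k *: e)) (M * t k).
  rewrite scale1r scale0r addr0; apply=> s _.
    by apply/is_derive_lineP; exact: C1_is_derive.
  by rewrite dotZr dot_delta mxE normrM mulrC (ger0_norm (ltW (t0 k))) ler_wpM2r// ltW.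
have wt0 k x : r + 1 < `|x| -> w (translate (t k *: e) x) = 0.
  move=> rx; apply: wr; rewrite /translate.
  have : `|(x : 'rV[R]_n)| <= `|(x : 'rV[R]_n) + t k *: e| + `|t k *: e|.
    by rewrite -{1}[x in `|x|](addrK (t k *: e)) ler_normB.
  have : `|t k *: e| <= 1.
    by rewrite normrZ (ger0_norm (ltW (t0 k))) mulr_ile1// ltW.
  lra.
have iwt k : leb.-integrable setT (EFin \o (fun x => w (translate (t k *: e) x))).
  apply: (@continuous_supported_integrable _ (r + 1)); first exact: cwt.
  exact: wt0.
have q0 k : (\int[leb]_x q k x = 0)%E.
  have E1 : (\int[leb]_x ((w (translate (t k *: e) x))%:E - (w x)%:E) =
      \int[leb]_x (w (translate (t k *: e) x))%:E - \int[leb]_x (w x)%:E)%E.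
    exact: (integralB measurableT (iwt k) iw).
  have E2 := @integral_translate (t k *: e) (fun x => (w x)%:E) mw.
  have fw : (\int[leb]_x (w x)%:E)%E \is a fin_num by exact: integrable_fin_num iw.
  rewrite E2 subee// in E1.
  have iB := integrableB measurableT (iwt k) iw.
  by rewrite /q; have := integralZl measurableT iB (t k)^-1; rewrite E1 mule0.
pose B : set lebT := [set x : 'rV[R]_n | `|x| <= r + 1].
have mB : measurable B by exact: measurable_ball_leb.
have [|||||_ _] := @dominated_convergence _ lebT R leb setT measurableT q
  (fun x => (partial w i x)%:E) ((EFin \o cst M) \_ B).
- move=> k; apply/measurable_EFinP; apply: measurable_funM; first exact: measurable_cst.
  apply: measurable_funB; last by apply/measurable_EFinP.
  exact: (cara_measurable_fun_continuous measurable_halfspace_lebesgue (cwt k)).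
- by apply/measurable_EFinP; exact: (cara_measurable_fun_continuous measurable_halfspace_lebesgue).
- apply: aeW => x _; rewrite /q; apply: cvg_EFin; first by near=> k.
  have [D1 D2] := C1_is_derive C1w x e.
  have L : (fun s : R => s^-1 *: ((w \o pseudometric_normed_Zmodule.shift (x : 'rV[R]_n)) (s *: e) - w x))
      @ 0^' --> partial w i x by exact: D1.
  have tc : t @ \oo --> (0 : R)^'.
    move=> A [d /= d0 dA]; suff : \forall k \near \oo, A (t k) by [].
    near=> k; apply: dA.
      rewrite /= sub0r normrN ger0_norm ?ltW//; near: k.
      exact: near_infty_natSinv_lt (PosNum d0).
    by apply: lt0r_neq0; exact: t0.
  have := cvg_comp _ _ tc L; apply: cvg_trans; apply: near_eq_cvg; near=> k.
  by rewrite /= /translate; congr (_ * (w _ - _)); exact: addrC.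
- apply/(integrable_mkcond _ mB); apply: measurable_bounded_integrable => //.
    exact: leb_ball_lty.
  exists M; split; first exact: num_real.
  by move=> x Mx y _ /=; rewrite ger0_norm// ltW.
- apply: aeW => x k _; rewrite /patch; case: ifPn => [_|/negP].
    rewrite /= lee_fin normrM normfV (ger0_norm (ltW (t0 k))) mulrC ler_pdivrMr//.
  rewrite inE /B /= => /negP; rewrite -ltNge => rx; rewrite /q wt0// wr ?subrr ?mulr0 ?normr0//.
  by apply: lt_trans rx; rewrite ltrDl.
move=> L; apply/esym.
have L0 : (fun k => \int[leb]_x q k x)%E @ \oo --> 0%E.
  rewrite (_ : (fun k => _) = cst 0%E); first exact: cvg_cst.
  by apply/funext => k; rewrite q0.
exact: (cvg_unique (@ereal_hausdorff R) L0 L).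
Unshelve. all: by end_near. Qed.

Lemma is_derive_mul_partial (f g : 'rV[R]_n -> R) i x : Ck 1 f -> Ck 1 g ->
  is_derive x (delta_mx 0 i) (fun y => f y * g y) (f x * partial g i x + g x * partial f i x).
Proof.
move=> [_ /(_ i)[df _]] [_ /(_ i)[dg _]].
have Hf : is_derive x (delta_mx 0 i) f (partial f i x) by constructor.
have Hg : is_derive x (delta_mx 0 i) g (partial g i x) by constructor.
exact: is_deriveM Hf Hg.
Qed.

Lemma partial_mul (f g : 'rV[R]_n -> R) i : Ck 1 f -> Ck 1 g ->
  partial (fun y => f y * g y) i = fun x => f x * partial g i x + g x * partial f i x.
Proof.
move=> C1f C1g; apply/funext => x; rewrite /partial.
by case: (is_derive_mul_partial i x C1f C1g).
Qed.

Lemma C1_mul (f g : 'rV[R]_n -> R) : Ck 1 f -> Ck 1 g -> Ck 1 (fun y => f y * g y).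
Proof.
move=> C1f C1g; have [cf df] := C1f; have [cg dg] := C1g; split.
  by move=> x; apply: (@continuousM _ _ f g); [exact: cf | exact: cg].
move=> i; split; first by move=> x; case: (is_derive_mul_partial i x C1f C1g).
rewrite partial_mul//; have [_ cdf] := df i; have [_ cdg] := dg i.
have c2 (x : 'rV[R]_n) : {for x, continuous (fun x => f x * partial g i x + g x * partial f i x)}.
  apply: (@continuousD _ _ _ (fun x => f x * partial g i x)).
    by apply: (@continuousM _ _ f); [exact: cf | exact: cdg].
  by apply: (@continuousM _ _ g); [exact: cg | exact: cdf].
exact: c2.
Qed.

Lemma continuous_L2_leb (A : set lebT) (f : 'rV[R]_n -> R) : measurable A ->
  bounded_set (A : set 'rV[R]_n) -> continuous f -> L2 (@lebesgue_outer R n) A f.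
Proof.
move=> mA bA cf; split.
  exact: (cara_measurable_fun_continuous measurable_halfspace_lebesgue).
have cf2 : continuous (fun x => f x ^+ 2).
  by move=> x; apply: (@continuousM _ _ f f); exact: cf.
have := continuous_integrable mA bA cf2.
move=> /integrableP[_]; apply: le_lt_trans; rewrite le_eqVlt; apply/orP; left; apply/eqP.
by apply: eq_integral => x _ /=; rewrite ger0_norm// sqr_ge0.
Qed.

(** The product of V and a test function is C^1 on the whole space and vanishes off a compact subset
    of omega, so its partial derivatives have integral zero. *)
Lemma H1_bulk_C1 (omega : set 'rV[R]_n) (V : 'rV[R]_n -> R) : open omega ->
  bounded_set omega -> Ck 1 V -> H1_bulk omega V (grad V).
Proof.
move=> oo bo C1V; have [cV dV] := C1V.
have mo : measurable (omega : set lebT) := open_cara_measurable measurable_halfspace_lebesgue oo.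
split; first exact: continuous_L2_leb.
  move=> i; rewrite (_ : (fun _ => _) = partial V i); last by apply/funext => x; rewrite mxE.
  by apply: continuous_L2_leb => //; case: (dV i).
move=> phi i [sphi [K [cK Ko phiK]]]; have C1phi := smoothC1 sphi.
have [cphi dphi] := C1phi.
have [r r0 Kr] : exists2 r, 0 < r & forall x, K x -> `|x| <= r.
  by have /pinfty_ex_gt0[r r0 Kr] := compact_bounded cK; exists r.
have closedK : closed K.
  apply: compact_closed cK; exact: norm_hausdorff.
pose chi x := V x * phi x.
have C1chi : Ck 1 chi by exact: C1_mul.
have chi0 x : r < `|x| -> chi x = 0.
  move=> rx; rewrite /chi phiK ?mulr0// => /Kr; by rewrite leNgt rx.
have := integral_partial_eq0 i C1chi chi0.
have dchi0 x : ~ omega x -> partial chi i x = 0.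
  move=> xo; apply: partial_eq0_near.
  have : nbhs x (~` K).
    by apply: open_nbhs_nbhs; split; [exact: closed_openC | move=> /Ko].
  by apply: filterS => y Ky; rewrite /chi phiK ?mulr0.
have -> : (\int[leb]_x (partial chi i x)%:E = \int[leb]_(x in omega) (partial chi i x)%:E)%E.
  rewrite [RHS]integral_mkcond; apply: eq_integral => x _.
  by rewrite /patch; case: ifPn => // /negP; rewrite inE => /dchi0 ->.
have i1 : leb.-integrable omega (EFin \o (fun x => V x * partial phi i x)).
  apply: continuous_integrable => // x; apply: (@continuousM _ _ V); first exact: cV.
  by case: (dphi i) => _; exact.
have i2 : leb.-integrable omega (EFin \o (fun x => grad V x 0 i * phi x)).
  rewrite (_ : (fun x => _) = (fun x => partial V i x * phi x)); last first.
    by apply/funext => x; rewrite mxE.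
  apply: continuous_integrable => // x; apply: (@continuousM _ _ (partial V i)); last exact: cphi.
  by case: (dV i) => _; exact.
move=> E; have E' : \int[leb]_(x in omega) partial chi i x = 0 by rewrite /Rintegral E.
have E2 := RintegralD mo i1 i2.
apply/eqP; rewrite -addr_eq0; apply/eqP; rewrite -[RHS]E'.
transitivity (\int[leb]_(x in omega) (V x * partial phi i x + grad V x 0 i * phi x)).
  by rewrite E2.
apply: eq_Rintegral => x _; rewrite /chi partial_mul// mxE; congr (_ + _); exact: mulrC.
Qed.

End integration_by_parts.

(** * Surface measure of the boundary *)

Section finite_covers.
Context {T : ptopologicalType}.

(** The extraction of a finite subcover, done once: a property of sets that is inherited by subsets
    and finite unions is global as soon as it is local. *)
Lemma compact_local_property (P : set T -> Prop) (A : set T) : compact A ->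
  P set0 -> (forall B C, P B -> P C -> P (B `|` C)) -> (forall B C, B `<=` C -> P C -> P B) ->
  (forall x, A x -> exists2 U, open_nbhs x U & P U) -> P A.
Proof.
move=> cA P0 PU PS Ploc.
have /choice[U HU] : forall x, exists U, A x -> open_nbhs x U /\ P U.
  move=> x; have [/Ploc[U xU PUx]|nAx] := pselect (A x); first by exists U.
  by exists set0.
have := cA; rewrite compact_cover => /(_ T A U)[||D DA AD].
- by move=> x /HU[[]].
- by move=> x Ax; exists x => //; have [[]] := HU x Ax.
apply: PS AD _; rewrite /cover bigcup_fset.
have : forall x, x \in finmap.enum_fset D -> A x by move=> x /DA; rewrite inE.
elim: (finmap.enum_fset D) => [|x s IH] sA; first by rewrite big_nil.
rewrite big_cons; apply: PU.
  by have [] := HU x (sA x (mem_head _ _)).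
by apply: IH => y ys; apply: sA; rewrite inE ys orbT.
Qed.

End finite_covers.

Section sweeping.
Context {R : realType} {n : nat}.
Local Notation lo := (@lebesgue_outer R n.+1).
Implicit Types (e : 'rV[R]_n.+1) (E F : set 'rV[R]_n.+1).

(** The shadow cast by E along e. When E is the bad part of the boundary, the points of the domain
    that would leave it through E lie in this shadow. *)
Definition sweep e E : set 'rV[R]_n.+1 :=
  [set x | exists2 s : R, 0 <= s <= 1 & E (x + s *: e)].

Lemma unit_ball_volume_gt0 k : 0 < unit_ball_volume R k.
Proof.
have [m] := ubnP k; elim: m k => // m IH [|[|k]] km //=.
rewrite !mulr_gt0 ?pi_gt0 ?invr_gt0 ?IH//.
by move: km; rewrite !ltnS => /ltnW.
Qed.

Let C0 e : R := 3 * (2 * (1 + `|e|)) ^+ n.+1.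

Lemma lebesgue_outer_cube_le (c : 'rV[R]_n.+1) (r : R) F : 0 <= r ->
  (forall x, F x -> `|x - c| <= r) -> (lo F <= ((2 * r) ^+ n.+1)%:E)%E.
Proof.
move=> r0 Fr; apply: le_trans (lebesgue_outer_le_box_weight F) _.
have := @box_weight_le R n.+1 F (\row_i (c 0 i - r)) (\row_i (c 0 i + r)).
rewrite (_ : \prod_(i < n.+1) _ = (2 * r) ^+ n.+1).
  apply=> [i|x /Fr xr i]; rewrite !mxE.
    by rewrite -subr_ge0 (_ : _ - _ = 2 * r); [rewrite mulr_ge0 | ring].
  have := le_trans (normr_coord_le (x - c) i) xr.
  by rewrite !mxE ler_norml => /andP[h1 h2]; apply/andP; split; lra.
rewrite -[in RHS](card_ord n.+1) -prodr_const; apply: eq_bigr => i _.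
by rewrite !mxE; ring.
Qed.

(** With K > 1/D, the points y0 - (j/K) e for j <= K are spaced by less than D |e|, so cubes of
    radius D (1 + |e|) around them cover the shadow. There are K + 1 <= 3/D of them, each of volume
    (2 D (1 + |e|))^(n+1): hence [C0 e] and the power D^n. *)
Lemma lebesgue_outer_sweep_piece e F (D : R) : F !=set0 -> 0 < D <= 1 ->
  (ediam F <= D%:E)%E -> (lo (sweep e F) <= (C0 e * D ^+ n)%:E)%E.
Proof.
move=> [y0 Fy0] /andP[D0 D1] FD.
pose K := (Num.truncn D^-1).+1.
have KD : D^-1 < K%:R by exact: truncnS_gt.
have K0 : 0 < K%:R :> R by rewrite ltr0n.
have KD2 : K%:R <= 2 * D^-1.
  have D1' : 1 <= D^-1 by rewrite invf_ge1.
  have : (Num.truncn D^-1)%:R <= D^-1 by rewrite truncn_le invr_ge0 ltW.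
  rewrite /K -natr1; lra.
pose r := D * (1 + `|e|).
have r0 : 0 <= r by rewrite mulr_ge0 ?(ltW D0)// addr_ge0.
pose c (j : nat) : 'rV[R]_n.+1 := y0 - (j%:R / K%:R) *: e.
pose Q (j : nat) := [set x : 'rV[R]_n.+1 | `|x - c j| <= r].
have cov : sweep e F `<=` \big[setU/set0]_(j < K.+1) Q j.
  move=> x [s /andP[s0 s1] Fxs].
  pose j := Num.truncn (s * K%:R).
  have sK0 : 0 <= s * K%:R by rewrite mulr_ge0// ltW.
  have j1 : j%:R <= s * K%:R by rewrite /j truncn_le.
  have j2 : s * K%:R < j%:R + 1 by rewrite natr1; exact: truncnS_gt.
  have jK : (j < K.+1)%N.
    by rewrite ltnS -(ler_nat R) (le_trans j1)// ler_piMl// ltW.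
  rewrite (bigD1 (Ordinal jK))//=; left; rewrite /Q /= /c.
  have -> : x - (y0 - (j%:R / K%:R) *: e) =
      (x + s *: e - y0) - (s - j%:R / K%:R) *: e.
    by rewrite scalerBl; apply/rowP => i; rewrite !mxE; ring.
  apply: le_trans (ler_normB _ _) _; rewrite /r mulrDr mulr1; apply: lerD.
    apply: rV_norm_leP; first exact: ltW.
    move=> i; apply: le_trans (normr_coord_le_enorm _ _) _.
    rewrite -lee_fin; apply: le_trans FD.
    by apply: ereal_sup_ubound; exists (x + s *: e), y0.
  rewrite normrZ; apply: ler_wpM2r => //.
  have -> : s - j%:R / K%:R = (s * K%:R - j%:R) / K%:R by field; rewrite gt_eqF.
  rewrite ger0_norm; last by rewrite divr_ge0 ?(ltW K0)// subr_ge0.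
  rewrite ler_pdivrMr//; apply: (@le_trans _ _ 1); first by rewrite lerBlDr addrC ltW.
  by rewrite -ler_pdivrMl// mulr1 ltW.
apply: le_trans (le_outer_measure _ _ _ cov) _.
apply: le_trans (outer_measure_subadditive _ _ _) _.
apply: (@le_trans _ _ (\sum_(j < K.+1) ((2 * r) ^+ n.+1)%:E)%E).
  by apply: lee_sum => j _; exact: (@lebesgue_outer_cube_le (c j) r).
set a : R := 2 * (1 + `|e|); have a0 : 0 <= a by rewrite mulr_ge0// addr_ge0.
have ra : 2 * r = a * D by rewrite /r /a; ring.
rewrite sumEFin sumr_const card_ord lee_fin /C0 -/a ra exprMn -[leLHS]mulr_natl.
rewrite mulrCA [leRHS](_ : _ = a ^+ n.+1 * (3 * D ^+ n)); last by rewrite mulrA [3 * _]mulrC.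
apply: ler_wpM2l; first by rewrite exprn_ge0.
rewrite exprS mulrA; apply: ler_wpM2r; first by rewrite exprn_ge0// ltW.
rewrite -ler_pdivlMr// -natr1.
have : 1 <= D^-1 by rewrite invf_ge1.
lra.
Qed.

Lemma lebesgue_outer_sweep_le_weight e F : (lo (sweep e F) <=
  (C0 e / (unit_ball_volume R n / 2 ^+ n))%:E * hausdorff_weight n 1 F)%E.
Proof.
set c := unit_ball_volume R n / 2 ^+ n.
have c0 : 0 < c by rewrite divr_gt0 ?exprn_gt0// unit_ball_volume_gt0.
have C00 : 0 < C0 e by rewrite /C0 mulr_gt0// exprn_gt0// mulr_gt0// ltr_pwDl.
have [->|/set0P F0] := eqVneq F set0.
  rewrite hausdorff_weight0 mule0 (_ : sweep e set0 = set0) ?outer_measure0//.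
  by rewrite -subset0 => x [].
rewrite /hausdorff_weight ifN; last by apply/asboolPn/eqP/set0P.
case: ifPn => [F1|_]; last by rewrite gt0_muley ?leey// lte_fin divr_gt0.
have Fge0 := ediam_ge0 F0.
have Ffin : ediam F \is a fin_num by rewrite ge0_fin_numE// (le_lt_trans F1)// ltry.
rewrite -/c muleA -EFinM mulfVK ?gt_eqF// -(fineK Ffin) -EFin_expe -EFinM.
have piece D : 0 < D <= 1 -> fine (ediam F) <= D -> (lo (sweep e F) <= (C0 e * D ^+ n)%:E)%E.
  by move=> D01 FD; apply: lebesgue_outer_sweep_piece => //; rewrite -(fineK Ffin) lee_fin.
have f0 : 0 <= fine (ediam F) by exact: fine_ge0.
have f1 : fine (ediam F) <= 1 by rewrite -lee_fin fineK.
(* Diameter 0 is not an admissible D. For n = 0 the weight is that of counting measure and D = 1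
   serves; for n > 0 the weight is 0 and D tends to 0. *)
move: f0; rewrite le_eqVlt => /predU1P[f0|f0]; last by apply: piece; rewrite ?f0 ?f1.
rewrite -f0 in piece *; rewrite expr0n.
have [n0|n0] := eqVneq n 0%N.
  by rewrite mulr1; have := piece 1; rewrite expr1n mulr1 ler01 lexx ltr01; exact.
rewrite mulr0; apply/lee_addgt0Pr => d d0; rewrite add0e.
pose D := Num.min 1 (d / C0 e).
have D0 : 0 < D by rewrite lt_min ltr01 divr_gt0.
have D1 : D <= 1 by rewrite ge_min lexx.
apply: le_trans (piece D _ _) _; rewrite ?D0 ?D1 ?(ltW D0)//.
rewrite lee_fin -ler_pdivlMl// mulrC.
apply: (@le_trans _ _ D); last by rewrite ge_min lexx orbT.
by rewrite -[leRHS]expr1 ler_wiXn2l ?lt0n// ltW.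
Qed.

(* The sets of a cover of E by pieces of diameter at most 1, swept along e, are
   covered by about 1/D cubes of side comparable to the diameter D. *)
Lemma lebesgue_outer_sweep_le e : exists2 C : R, 0 < C &
  forall E, (lo (sweep e E) <= C%:E * hausdorff_outer n E)%E.
Proof.
set c := unit_ball_volume R n / 2 ^+ n.
have c0 : 0 < c by rewrite divr_gt0 ?exprn_gt0// unit_ball_volume_gt0.
have C00 : 0 < C0 e by rewrite /C0 mulr_gt0// exprn_gt0// mulr_gt0// ltr_pwDl.
set C := C0 e / c; have Cgt0 : 0 < C by rewrite divr_gt0.
exists C => // E.
suff H : (C^-1%:E * lo (sweep e E) <= hausdorff_outer n E)%E.
  apply: (@le_trans _ _ (C%:E * (C^-1%:E * lo (sweep e E)))%E).
    by rewrite muleA -EFinM divff ?mul1e// gt_eqF.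
  by apply: lee_wpmul2l => //; rewrite lee_fin ltW.
apply: le_trans (hausdorff_content_le n E (@ltr01 R)).
apply: le_ereal_inf_tmp => _ [F [mF EF] <-].
have le1 : (lo (sweep e E) <= \sum_(k <oo) (C%:E * hausdorff_weight n 1 (F k)))%E.
  apply: (@le_trans _ _ (lo (\bigcup_k sweep e (F k)))).
    apply: le_outer_measure => x [s s01 /EF[k _ Fk]]; exists k => //; by exists s.
  apply: le_trans (outer_measure_sigma_subadditive _ _) _.
  apply: lee_nneseries => k _ => [_|]; first exact: outer_measure_ge0.
  exact: lebesgue_outer_sweep_le_weight.
rewrite nneseriesZl in le1; last by move=> *; exact: hausdorff_weight_ge0.
apply: (@le_trans _ _ (C^-1%:E * (C%:E * \sum_(k <oo) hausdorff_weight n 1 (F k)))%E).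
  by apply: lee_wpmul2l => //; rewrite lee_fin invr_ge0 ltW.
by rewrite muleA -EFinM mulVf ?mul1e// gt_eqF.
Qed.

End sweeping.

Section level_sets.
Context {R : realType} {n : nat}.
Implicit Types (rho w : 'rV[R]_n.+1 -> R) (p x y h : 'rV[R]_n.+1).

Lemma C1_segment_mvt (m : nat) (w : 'rV[R]_m -> R) (x h : 'rV[R]_m) : Ck 1 w ->
  exists2 c : R, 0 <= c <= 1 & w (x + h) - w x = dot (grad w (x + c *: h)) h.
Proof.
move=> C1w; pose f (s : R) := w (x + s *: h).
have df (s : R) : is_derive s (1 : R) f (dot (grad w (x + s *: h)) h).
  by apply/is_derive_lineP; exact: C1_is_derive.
have [|c] := @MVT_segment R f (fun s => dot (grad w (x + s *: h)) h) 0 1 ler01.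
  apply: continuous_in_subspaceT => s _.
  by apply: differentiable_continuous; apply/derivable1_diffP; case: (df s).
rewrite in_itv /= /f scale1r scale0r addr0 subr0 mulr1 => c01 E.
by exists c.
Qed.

Lemma ball_convex (m : nat) (p x h : 'rV[R]_m) (r c : R) : `|p - x| < r -> `|p - (x + h)| < r ->
  0 <= c <= 1 -> `|p - (x + c *: h)| < r.
Proof.
move=> xr yr /andP[c0 c1].
have -> : p - (x + c *: h) = (1 - c) *: (p - x) + c *: (p - (x + h)).
  by apply/rowP => i; rewrite !mxE; ring.
apply: le_lt_trans (ler_normD _ _) _.
rewrite !normrZ (ger0_norm c0) ger0_norm ?subr_ge0//.
have [->|cn0] := eqVneq c 0; first by rewrite subr0 mul1r mul0r addr0.
rewrite (_ : r = (1 - c) * r + c * r); last by ring.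
by apply: ler_ltD; [rewrite ler_wpM2l ?subr_ge0// ltW | rewrite ltr_pM2l// lt_def cn0].
Qed.

Lemma enorm_le_norm (m : nat) (x : 'rV[R]_m) : enorm x <= m%:R * `|x|.
Proof.
rewrite /enorm -[leRHS]ger0_norm ?mulr_ge0// -sqrtr_sqr ler_sqrt ?sqr_ge0//.
apply: le_trans (dot_le_norm x) _; rewrite exprMn; apply: ler_wpM2r; first exact: sqr_ge0.
case: m x => [|m] _; first by rewrite expr0n.
by rewrite expr2 -[leLHS]mulr1 ler_wpM2l// ler1n.
Qed.

(* Where some partial derivative does not vanish, a level set is a Lipschitz
   graph over the other coordinates. *)
Lemma level_set_lipschitz rho p : Ck 1 rho -> grad rho p != 0 ->
  exists k : 'I_n.+1, exists r L : R, [/\ 0 < r, 0 <= L &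
    forall x y (d : R), `|p - x| < r -> `|p - y| < r -> rho x = 0 -> rho y = 0 ->
      (forall j, `|(y - x) 0 (lift k j)| <= d) -> 0 <= d -> `|y - x| <= L * d].
Proof.
move=> C1rho gp0.
have [k gk] : exists k, grad rho p 0 k != 0.
  apply/existsP; apply: contraNT gp0; rewrite negb_exists => /forallP g0.
  by apply/eqP/rowP => k; rewrite [RHS]mxE; have := g0 k; rewrite negbK => /eqP.
set c := `|grad rho p 0 k|; have c0 : 0 < c by rewrite normr_gt0.
have c2 : 0 < c / 2 by rewrite divr_gt0.
have /nbhs_ballP[r /= r0 pr] := C1_uniform_partial p C1rho c2.
pose M := `|grad rho p| + c / 2.
have M0 : 0 <= M by rewrite addr_ge0// ltW.
have gM y i : `|p - y| < r -> `|grad rho y 0 i| <= M.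
  move=> py; have := pr y; rewrite /= rV_ballE => /(_ py i) H.
  rewrite /M -lerBlDr; apply: le_trans (normr_coord_le (grad rho p) i).
  rewrite lerBlDr; apply: le_trans (_ : `|grad rho p 0 i| + `|partial rho i y - partial rho i p| <= _).
    rewrite [grad rho y 0 i]mxE [grad rho p 0 i]mxE.
    by rewrite -{1}[partial rho i y](subrK (partial rho i p)) addrC ler_normD.
  by apply: lerD.
have gc y : `|p - y| < r -> c / 2 <= `|grad rho y 0 k|.
  move=> py; have := pr y; rewrite /= rV_ballE => /(_ py k) H.
  have : c <= `|grad rho y 0 k| + `|partial rho k y - partial rho k p|.
    rewrite /c [grad rho p 0 k]mxE [grad rho y 0 k]mxE.
    by rewrite -{1}[partial rho k p](subKr (partial rho k y)) ler_normB.
  lra.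
pose L0 := n%:R * M / (c / 2); have L00 : 0 <= L0 by rewrite divr_ge0 ?mulr_ge0// ltW.
exists k, r, (L0 + 1); split=> //; first by rewrite addr_ge0.
move=> x y d px py rx ry yxd d0.
have xyK : x + (y - x) = y by rewrite addrC subrK.
(* The mean value theorem makes y - x orthogonal to the gradient at some point of the segment; its
   k-th component, of size at least c/2 there, allows solving for the k-th coordinate of y - x. *)
have [s s01] := @C1_segment_mvt _ rho x (y - x) C1rho.
rewrite {1}xyK rx ry subrr => E.
have pxi : `|p - (x + s *: (y - x))| < r by apply: ball_convex => //; rewrite xyK.
set xi := x + s *: (y - x) in E pxi.
have kd : `|(y - x) 0 k| <= L0 * d.
  have E2 : grad rho xi 0 k * (y - x) 0 k =
      - \sum_(j < n) grad rho xi 0 (lift k j) * (y - x) 0 (lift k j).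
    apply/eqP; rewrite -addr_eq0; apply/eqP; rewrite [RHS]E /dot.
    by rewrite (bigD1_ord k).
  have : `|grad rho xi 0 k * (y - x) 0 k| <= n%:R * M * d.
    rewrite E2 normrN; apply: le_trans (ler_norm_sum _ _ _) _.
    have -> : n%:R * M * d = \sum_(j < n) M * d by rewrite sumr_const card_ord -mulrA mulr_natl.
    apply: ler_sum => j _; rewrite normrM; apply: ler_pM => //; exact: gM.
  rewrite normrM => H; rewrite /L0 mulrAC ler_pdivlMr// mulrC.
  by apply: le_trans H; apply: ler_wpM2r => //; exact: gc.
apply: rV_norm_leP; first by rewrite mulr_ge0// addr_ge0.
move=> i; have [j ->|->] := unliftP k i; last first.
  by apply: le_trans kd _; rewrite ler_wpM2r// lerDl.
by apply: le_trans (yxd j) _; rewrite -{1}[d]mul1r ler_wpM2r// lerDr.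
Qed.

Lemma hausdorff_content_le_sum (I : finType) (Z : I -> set 'rV[R]_n.+1) (A : set 'rV[R]_n.+1)
    (s : nat) (delta B : R) : A `<=` [set x | exists i, Z i x] ->
  (forall i, hausdorff_weight s delta (Z i) <= B%:E)%E ->
  (hausdorff_content s delta A <= (#|I|%:R * B)%:E)%E.
Proof.
move=> AZ ZB; pose F k := nth set0 [seq Z i | i <- enum I] k.
apply: (@le_trans _ _ (\sum_(k <oo) hausdorff_weight s delta (F k))%E).
  apply: ereal_inf_lbound; exists F => //; split=> // x /AZ[i Zx].
  exists (index i (enum I)) => //.
  by rewrite /F (nth_map i) ?index_mem ?mem_enum// nth_index// mem_enum.
rewrite (nneseries_split _ #|I|); last by move=> *; exact: hausdorff_weight_ge0.
rewrite add0n [X in (_ + X)%E]eseries0 ?adde0; last first.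
  by move=> k Ik _; rewrite /F nth_default ?hausdorff_weight0// size_map -cardE.
have -> : (#|I|%:R * B)%:E = (\sum_(k < #|I|) B%:E)%E.
  by rewrite sumEFin sumr_const card_ord mulr_natl.
rewrite big_mkord; apply: lee_sum => k _.
have kI : (k < size (enum I))%N by rewrite -cardE.
have [i0|] := pickP I; last first.
  move=> I0; have I0' : #|I| = 0%N by rewrite eq_card0.
  by have : (k < 0)%N by rewrite -I0' ltn_ord.
by rewrite /F (nth_map i0).
Qed.

Lemma open_sublevel (m : nat) (f : 'rV[R]_m -> R) c : continuous f -> open [set y | f y < c].
Proof.
move=> cf; apply: (@open_comp _ _ f [set x : R | x < c]); last exact: open_lt.
by move=> y _; exact: cf.
Qed.

Lemma open_superlevel (m : nat) (f : 'rV[R]_m -> R) c : continuous f -> open [set y | c < f y].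
Proof.
move=> cf; apply: (@open_comp _ _ f [set x : R | c < x]); last exact: open_gt.
by move=> y _; exact: cf.
Qed.

Lemma bdry_local_eq0 (omega : set 'rV[R]_n.+1) rho x : continuous rho ->
  (\forall y \near x, omega y <-> rho y < 0) -> bdry omega x -> rho x = 0.
Proof.
move=> crho near_x [clx nintx].
have [rx|rx|//] := ltrgtP (rho x) 0.
  case: nintx; rewrite /interior /=.
  have : nbhs x [set y | rho y < 0].
    by apply: open_nbhs_nbhs; split=> //; exact: open_sublevel.
  by move=> H; apply: filterS2 H near_x => y ry [_]; exact.
have : nbhs x [set y | 0 < rho y].
  by apply: open_nbhs_nbhs; split=> //; exact: open_superlevel.
move=> H; have : nbhs x (~` omega).
  apply: filterS2 H near_x => y /= ry [oy _] /oy; by rewrite ltNge ltW.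
by move=> /clx[y [oy]]; exact.
Qed.

Lemma bounded_closure (omega : set 'rV[R]_n.+1) : bounded_set omega -> bounded_set (closure omega).
Proof.
move=> /pinfty_ex_gt0[M M0 oM]; exists M; split; first exact: num_real.
move=> r Mr x clx; apply: (@le_trans _ _ M); last exact: ltW.
have cA : closed [set y : 'rV[R]_n.+1 | `|y| <= M].
  apply: (@closed_comp _ _ _ [set x : R | x <= M]); last exact: closed_le.
  by move=> y _; exact: norm_continuous.
have := closureS oM; rewrite -((closure_id _).1 cA); exact.
Qed.

Lemma compact_closure (omega : set 'rV[R]_n.+1) : bounded_set omega -> compact (closure omega).
Proof.
by move=> bo; apply: bounded_closed_compact; [exact: bounded_closure | exact: closed_closure].
Qed.

Lemma compact_bdry (omega : set 'rV[R]_n.+1) : bounded_set omega -> compact (bdry omega).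
Proof.
move=> bo; apply: (subclosed_compact _ (compact_closure bo)) => [|x []//].
rewrite /bdry setDE; apply: closedI; first exact: closed_closure.
by apply: open_closedC; exact: open_interior.
Qed.

(** Near a boundary point the boundary is a Lipschitz graph over n coordinates. A grid of m^n cells
    in these coordinates lifts to pieces of diameter at most c1/m, whose total weight is at most m^n
    c (c1/m)^n = c c1^n for every m; m is taken so large that c1/m is below the prescribed scale. *)
Lemma hausdorff_bdry_lty (omega : set 'rV[R]_n.+1) : bounded_set omega ->
  smooth_boundary omega -> (hausdorff_outer n (bdry omega) < +oo)%E.
Proof.
move=> bo so; rewrite -[X in hausdorff_outer n X]setIid.
apply: (@compact_local_property _ (fun B => hausdorff_outer n (B `&` bdry omega) < +oo)%E
  (bdry omega) (compact_bdry bo)).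
- by rewrite set0I outer_measure0.
- move=> B C HB HC; rewrite setIUl.
  by apply: le_lt_trans (outer_measureU2 _ _ _) _; rewrite lte_add_pinfty.
- move=> B C BC; apply: le_lt_trans; apply: le_outer_measure; exact: setSI.
move=> p bp; have [rho [srho gp0 near_p]] := so p bp.
have C1rho := smoothC1 srho.
have [k [r1 [L [r10 L0 lip]]]] := level_set_lipschitz C1rho gp0.
have /nbhs_ballP[r2 /= r20 pr2] := near_p.
pose r := Num.min r1 r2; have r0 : 0 < r by rewrite lt_min r10.
exists (ball p r); first by split; [exact: ball_open | exact: ballxx].
pose c := unit_ball_volume R n / 2 ^+ n.
have c0 : 0 < c by rewrite divr_gt0 ?exprn_gt0// unit_ball_volume_gt0.
pose c1 := n.+1%:R * (L * (2 * r)).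
have c10 : 0 <= c1 by rewrite !mulr_ge0// ltW.
suff : (hausdorff_outer n (ball p r `&` bdry omega) <= (c * c1 ^+ n)%:E)%E.
  by move=> /le_lt_trans; apply; exact: ltry.
apply: ge_ereal_sup => _ [d /= d0 <-].
pose m := (Num.truncn (c1 / d)).+1.
have m0 : 0 < m%:R :> R by rewrite ltr0n.
have md : c1 / m%:R <= d.
  have : c1 / d < m%:R by exact: truncnS_gt.
  by rewrite ltr_pdivrMr// ler_pdivrMr// mulrC => /ltW.
pose t := 2 * r / m%:R; have t0 : 0 < t by rewrite divr_gt0// mulr_gt0.
pose Z (a : {ffun 'I_n -> 'I_m}) : set 'rV[R]_n.+1 := [set x | [/\ bdry omega x, ball p r x &
  forall j, (a j)%:R * t <= x 0 (lift k j) - p 0 (lift k j) + r <= (a j)%:R * t + t]].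
have rhoZ x : bdry omega x -> ball p r x -> rho x = 0.
  move=> bx px; apply: (@bdry_local_eq0 omega) => //; first exact: C1_continuous.
  have : nbhs x (ball p r) by apply: open_nbhs_nbhs; split => //; exact: ball_open.
  apply: filterS => y py; apply: pr2; apply: le_ball py; by rewrite ge_min lexx orbT.
have Zd a : (hausdorff_weight n d (Z a) <= (c * (c1 / m%:R) ^+ n)%:E)%E.
  have [->|/set0P Z0] := eqVneq (Z a) set0.
    by rewrite hausdorff_weight0 lee_fin mulr_ge0 ?(ltW c0)// exprn_ge0// divr_ge0// ltW.
  have diamZ : (ediam (Z a) <= (c1 / m%:R)%:E)%E.
    apply: ge_ereal_sup => _ [y [z [[by_ py Hy] [bz pz Hz] ->]]]; rewrite lee_fin.
    apply: le_trans (enorm_le_norm _) _; rewrite /c1 -!mulrA; apply: ler_wpM2l => //.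
    rewrite [L * _](_ : _ = L * t); last by rewrite /t !mulrA.
    apply: lip.
    - by have := pz; rewrite rV_ballE => /lt_le_trans; apply; rewrite ge_min lexx.
    - by have := py; rewrite rV_ballE => /lt_le_trans; apply; rewrite ge_min lexx.
    - exact: rhoZ.
    - exact: rhoZ.
    - move=> j; rewrite !mxE; have /andP[h1 h2] := Hy j; have /andP[h3 h4] := Hz j.
      rewrite ler_norml; apply/andP; split; lra.
    - exact: ltW.
  rewrite /hausdorff_weight ifN; last by apply/asboolPn/eqP/set0P.
  rewrite (le_trans diamZ) ?lee_fin// -/c [(c * _)%:E]EFinM EFin_expe; apply: lee_wpmul2l.
    by rewrite lee_fin ltW.
  by apply: lee_expe => //; exact: ediam_ge0.
apply: le_trans (hausdorff_content_le_sum _ Zd) _; last first.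
  rewrite card_ffun !card_ord lee_fin natrX mulrCA -exprMn.
  by rewrite (_ : m%:R * (c1 / m%:R) = c1)// mulrC mulfVK// gt_eqF.
move=> x [px bx].
have xk j : 0 < x 0 (lift k j) - p 0 (lift k j) + r < 2 * r.
  have := px; rewrite rV_ballE => /(le_lt_trans (normr_coord_le _ (lift k j))).
  rewrite !mxE ltr_norml => /andP[h1 h2]; apply/andP; split; lra.
pose u j := (x 0 (lift k j) - p 0 (lift k j) + r) / t.
have u0 j : 0 <= u j by have /andP[h1 _] := xk j; rewrite divr_ge0// ltW.
have um j : (Num.truncn (u j) < m)%N.
  rewrite -(ltr_nat R); apply: (@le_lt_trans _ _ (u j)); first by rewrite truncn_le.
  by have /andP[_ h2] := xk j; rewrite ltr_pdivrMr// /t mulrCA divff ?gt_eqF// mulr1.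
exists [ffun j => Ordinal (um j)]; split=> // j; rewrite ffunE /=; apply/andP; split.
  by rewrite -ler_pdivlMr// truncn_le.
by rewrite -[X in _ <= _ + X]mul1r -mulrDl natr1 -ler_pdivrMr// ltW// truncnS_gt.
Qed.

End level_sets.

(** * Geometry of the domain near its boundary *)

Section boundary_geometry.
Context {R : realType} {n : nat}.
Implicit Types (omega : set 'rV[R]_n) (p x y h : 'rV[R]_n).

Lemma dot_norm_le (a b : 'rV[R]_n) : `|dot a b| <= n%:R * `|a| * `|b|.
Proof.
apply: le_trans (ler_norm_sum _ _ _) _.
have -> : n%:R * `|a| * `|b| = \sum_(i < n) `|a| * `|b|.
  by rewrite sumr_const card_ord -mulrA mulr_natl.
by apply: ler_sum => i _; rewrite normrM ler_pM// normr_coord_le.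
Qed.

Lemma dot_gt0 (a : 'rV[R]_n) : a != 0 -> 0 < dot a a.
Proof.
move=> a0; rewrite lt_neqAle dot_ge0 andbT eq_sym; apply: contra a0.
rewrite psumr_eq0 => [/allP a0|i _]; last by rewrite -expr2 sqr_ge0.
apply/eqP/rowP => i; rewrite mxE; have := a0 i (mem_index_enum i).
by rewrite mulf_eq0 orbb => /eqP.
Qed.

Lemma transversal_direction omega p : smooth_boundary omega -> bdry omega p ->
  exists (rho : 'rV[R]_n -> R) (nu : 'rV[R]_n) (r c M : R),
  [/\ Ck 1 rho, [/\ rho p = 0, 0 < r, 0 < c & 0 < M],
      forall y, `|p - y| < r -> omega y <-> rho y < 0,
      forall y, `|p - y| < r -> c <= dot (grad rho y) nu
    & forall y h, `|p - y| < r -> `|dot (grad rho y) h| <= M * `|h| ].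
Proof.
move=> so bp; have [rho [srho gp0 near_p]] := so p bp.
have C1rho := smoothC1 srho; set nu := grad rho p in gp0.
have nn0 : 0 < dot nu nu by exact: dot_gt0.
have /nbhs_ballP[r1 /= r10 H1] : nbhs p [set y : 'rV[R]_n | dot nu nu / 2 < dot (grad rho y) nu].
  apply: open_nbhs_nbhs; split.
    by apply: open_superlevel; exact: continuous_dot_grad.
  by rewrite /= ltr_pdivrMr// ltr_pMr// ltr1n.
have /nbhs_ballP[r2 /= r20 H2] := C1_uniform_partial p C1rho (@ltr01 R).
have /nbhs_ballP[r3 /= r30 H3] := near_p.
pose r := Num.min r1 (Num.min r2 r3).
have inb y : `|p - y| < r -> [/\ ball p r1 y, ball p r2 y & ball p r3 y].
  by rewrite !lt_min !rV_ballE => /and3P[].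
exists rho, nu, r, (dot nu nu / 2), (n%:R * (`|nu| + 1) + 1); split.
- exact: C1rho.
- split; [|by rewrite !lt_min r10 r20|by rewrite divr_gt0|by rewrite ltr_wpDl// mulr_ge0// addr_ge0].
  have [clp nintp] := bp.
  have [rx|rx|//] := ltrgtP (rho p) 0.
    case: nintp; rewrite /interior /=.
    have : nbhs p [set y | rho y < 0].
      apply: open_nbhs_nbhs; split=> //; by apply: open_sublevel; exact: C1_continuous.
    by move=> H; apply: filterS2 H near_p => y ry [_]; exact.
  have : nbhs p [set y | 0 < rho y].
    apply: open_nbhs_nbhs; split=> //; by apply: open_superlevel; exact: C1_continuous.
  move=> H; have : nbhs p (~` omega).
    by apply: filterS2 H near_p => y /= ry [oy _] /oy; rewrite ltNge ltW.
  by move=> /clp[y [oy]]; exact.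
- by move=> y /inb[_ _ /H3].
- by move=> y /inb[/H1 /= /ltW].
move=> y h /inb[_ /H2 /= Hy _]; apply: le_trans (dot_norm_le _ _) _.
apply: ler_wpM2r => //; apply: (@le_trans _ _ (n%:R * (`|nu| + 1))); last by rewrite lerDl.
apply: ler_wpM2l => //; apply: rV_norm_leP; first by rewrite addr_ge0.
move=> i; rewrite mxE -(subrK (partial rho i p) (partial rho i y)) addrC.
apply: le_trans (ler_normD _ _) _; apply: lerD; last exact: Hy.
by have := normr_coord_le nu i; rewrite mxE.
Qed.

Lemma bdry_openE omega p : open omega -> bdry omega p <-> closure omega p /\ ~ omega p.
Proof. by move=> /interior_id oo; rewrite /bdry oo. Qed.

(** At a boundary point, H is a small ball of displacements around -t0 nu, along which the defining
    function decreases. The radius r is fixed before R0, so one neighbourhood of p serves for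
    arbitrarily short displacements. *)
Lemma cone_condition omega p : open omega -> smooth_boundary omega -> closure omega p ->
  exists2 r : R, 0 < r & forall R0 : R, 0 < R0 ->
  exists H : set 'rV[R]_n, [/\ open H, H !=set0, forall h, H h -> `|h| < R0
    & forall x h (t : R), omega x -> `|p - x| < r -> H h -> 0 <= t <= 1 -> omega (x + t *: h)].
Proof.
move=> oo so clp; have [op|nop] := pselect (omega p).
  have /nbhs_ballP[r /= r0 pr] : nbhs p omega by exact: open_nbhs_nbhs.
  exists (r / 2); first by rewrite divr_gt0.
  move=> R0 R00; pose q := Num.min R0 (r / 2).
  have q0 : 0 < q by rewrite lt_min R00 divr_gt0.
  exists (ball 0 q); split.
  - exact: ball_open.
  - by exists 0; exact: ballxx.
  - by move=> h; rewrite rV_ballE sub0r normrN => /lt_le_trans; apply; rewrite ge_min lexx.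
  move=> x h t _ px; rewrite rV_ballE sub0r normrN => hq /andP[t0 t1].
  apply: pr; rewrite rV_ballE opprD addrA; apply: le_lt_trans (ler_normB _ _) _.
  rewrite normrZ (ger0_norm t0).
  have : t * `|h| <= `|h| by rewrite ler_piMl.
  have : `|h| < r / 2 by apply: lt_le_trans hq _; rewrite ge_min lexx orbT.
  lra.
have bp : bdry omega p by apply/bdry_openE.
have [rho [nu [r [c [M [C1rho [rp r0 c0 M0] Hom Hc HM]]]]]] := transversal_direction so bp.
exists (r / 2); first by rewrite divr_gt0.
move=> R0 R00; pose q := Num.min R0 (r / 2).
have q0 : 0 < q by rewrite lt_min R00 divr_gt0.
have nu1 : 0 < `|nu| + 1 by rewrite ltr_wpDl.
pose t0 := q / 2 / (`|nu| + 1).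
have t00 : 0 < t0 by rewrite !divr_gt0.
(* The second bound gives M s <= t0 c / 2: the deviation from -t0 nu cannot compensate the decrease,
   of at least t0 c, along -t0 nu. *)
pose s := Num.min (q / 2) (t0 * c / (2 * M)).
have s0 : 0 < s by rewrite lt_min !divr_gt0 ?mulr_gt0.
have t0nu : `|t0 *: nu| <= q / 2.
  rewrite normrZ (ger0_norm (ltW t00)) /t0 mulrAC ler_pdivrMr//.
  by rewrite ler_pM2l ?divr_gt0// lerDl.
have Hq h : ball (- (t0 *: nu)) s h -> `|h| < q.
  rewrite rV_ballE => hs.
  have : `|h| <= `|- (t0 *: nu) - h| + `|t0 *: nu|.
    rewrite -[X in `|X| <= _]opprK -normrN opprK.
    by rewrite -[X in `|X| <= _](addKr (- (t0 *: nu))) addrC opprK ler_normD.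
  have : s <= q / 2 by rewrite ge_min lexx.
  lra.
exists (ball (- (t0 *: nu)) s); split.
- exact: ball_open.
- by exists (- (t0 *: nu)); exact: ballxx.
- by move=> h /Hq /lt_le_trans; apply; rewrite ge_min lexx.
move=> x h t ox px Hh /andP[tge0 t1].
have hq := Hq h Hh.
have qr : q <= r / 2 by rewrite ge_min lexx orbT.
have inball (u : R) : 0 <= u <= 1 -> `|p - (x + u *: (t *: h))| < r.
  move=> /andP[u0 u1]; rewrite opprD addrA; apply: le_lt_trans (ler_normB _ _) _.
  rewrite !normrZ (ger0_norm tge0) (ger0_norm u0).
  have : u * (t * `|h|) <= `|h|.
    by rewrite mulrA ler_piMl// mulr_ile1.
  lra.
have rx : rho x < 0.
  apply/(Hom x) => //; have := inball 0; rewrite lexx ler01 scale0r addr0; exact.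
apply/(Hom (x + t *: h)); first by have := inball 1; rewrite lexx ler01 scale1r; exact.
have [u u01 E] := C1_segment_mvt x (t *: h) C1rho.
have {}E : rho (x + t *: h) = rho x + dot (grad rho (x + u *: (t *: h))) (t *: h) by rewrite -E; ring.
rewrite E dotZr; set y := x + u *: (t *: h).
have py : `|p - y| < r by exact: inball.
suff : dot (grad rho y) h <= 0.
  move=> d0; have : t * dot (grad rho y) h <= 0 by rewrite mulr_ge0_le0.
  lra.
have -> : h = (h + t0 *: nu) + (- t0) *: nu by rewrite scaleNr addrK.
rewrite dotDr dotZr; have h1 := Hc y py; have h2 := HM y (h + t0 *: nu) py.
have h3 : `|h + t0 *: nu| < s.
  by move: Hh; rewrite rV_ballE -normrN opprB opprK addrC.
have h4 : M * `|h + t0 *: nu| <= t0 * c.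
  have : s <= t0 * c / (2 * M) by rewrite ge_min lexx orbT.
  move=> /(lt_le_trans h3)/ltW; rewrite ler_pdivlMr ?mulr_gt0// mulrC -mulrA => h5.
  have : 0 <= M * `|h + t0 *: nu| by rewrite mulr_ge0// ltW.
  lra.
have h5 : t0 * c <= t0 * dot (grad rho y) nu by rewrite ler_pM2l.
have := ler_norm (dot (grad rho y) (h + t0 *: nu)).
rewrite mulNr; lra.
Qed.

(** The segment from p - t0 nu to p + t0 nu goes from inside to outside because the defining
    function increases along nu. Both strict inequalities persist for starting points close to p -
    t0 nu. *)
Lemma exit_configuration omega p (d : R) : smooth_boundary omega -> bdry omega p ->
  0 < d -> exists (U : set 'rV[R]_n) (e : 'rV[R]_n),
  [/\ open U, U !=set0, U `<=` omega, forall x, U x -> ~ omega (x + e)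
    & forall x (s : R), U x -> 0 <= s <= 1 -> `|p - (x + s *: e)| < d].
Proof.
move=> so bp d0.
have [rho [nu [r [c [M [C1rho [rp r0 c0 M0] Hom Hc HM]]]]]] := transversal_direction so bp.
pose q := Num.min d r; have q0 : 0 < q by rewrite lt_min d0.
have qd : q <= d by rewrite ge_min lexx.
have qr : q <= r by rewrite ge_min lexx orbT.
have nu1 : 0 < `|nu| + 1 by rewrite ltr_wpDl.
pose t0 := q / 2 / (`|nu| + 1).
have t00 : 0 < t0 by rewrite !divr_gt0.
have t0nu : `|t0 *: nu| <= q / 2.
  rewrite normrZ (ger0_norm (ltW t00)) /t0 mulrAC ler_pdivrMr//.
  by rewrite ler_pM2l ?divr_gt0// lerDl.
pose e := 2 *: (t0 *: nu); pose x0 := p - t0 *: nu.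
have line (u : R) : `|u| <= 1 -> `|p - (p + u *: (t0 *: nu))| <= q / 2.
  move=> u1; rewrite opprD addrA subrr sub0r normrN normrZ.
  by apply: le_trans t0nu; rewrite ler_piMl.
have crho := C1_continuous C1rho.
have pos : 0 < rho (x0 + e).
  have -> : x0 + e = p + t0 *: nu by rewrite /x0 /e; apply/rowP => i; rewrite !mxE; ring.
  have [u /andP[u0 u1] E] := C1_segment_mvt p (t0 *: nu) C1rho.
  rewrite -[rho _]subr0 -[X in _ - X]rp E dotZr mulr_gt0//; apply: lt_le_trans c0 _; apply: Hc.
  apply: le_lt_trans (line u _) _; first by rewrite ger0_norm.
  by apply: lt_le_trans qr; rewrite ltr_pdivrMr// ltr_pMr// ltr1n.
have neg : rho x0 < 0.
  have [u /andP[u0 u1] E] := C1_segment_mvt p (- (t0 *: nu)) C1rho.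
  rewrite /x0 -[rho _]subr0 -[X in _ - X]rp E -scaleNr dotZr mulNr oppr_lt0 mulr_gt0//.
  apply: lt_le_trans c0 _; apply: Hc; rewrite scaleNr scalerN -scaleNr.
  apply: le_lt_trans (line (- u) _) _; first by rewrite normrN ger0_norm.
  by apply: lt_le_trans qr; rewrite ltr_pdivrMr// ltr_pMr// ltr1n.
have near_line (x : 'rV[R]_n) (s : R) : `|x0 - x| < q / 2 -> 0 <= s <= 1 -> `|p - (x + s *: e)| < q.
  move=> xx0 /andP[s0 s1].
  have -> : p - (x + s *: e) = (x0 - x) + (p - (p + (2 * s - 1) *: (t0 *: nu))).
    by rewrite /x0 /e; apply/rowP => i; rewrite !mxE; ring.
  have := line (2 * s - 1); rewrite ler_norml => /(_ _) H.
  have {}H : `|p - (p + (2 * s - 1) *: (t0 *: nu))| <= q / 2 by apply: H; apply/andP; split; lra.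
  apply: le_lt_trans (ler_normD _ _) _; lra.
pose U : set 'rV[R]_n := ball x0 (q / 2) `&`
  ([set x : 'rV[R]_n | rho x < 0] `&` [set x : 'rV[R]_n | 0 < rho (x + e)]).
exists U, e; split.
- apply: openI; first exact: ball_open.
  apply: openI; first exact: open_sublevel.
  suff ce : continuous (fun x : 'rV[R]_n => rho (x + e)) by apply: open_superlevel; exact: ce.
  move=> x; apply: (@continuous_comp _ _ _ (fun x : 'rV[R]_n => x + e) rho); last exact: crho.
  exact: (@continuousD R _ _ idfun (cst e) x (fun A nA => nA) (@cst_continuous _ _ _ x)).
- by exists x0; split; [apply: ballxx; rewrite divr_gt0 | split].
- move=> x [+ [rx _]]; rewrite rV_ballE => xx0; apply/(Hom x) => //.
  have := near_line x 0 xx0; rewrite lexx ler01 scale0r addr0 => /(_ isT).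
  by move=> /lt_le_trans; exact.
- move=> x [+ [_ /= rxe]] oxe; rewrite rV_ballE => xx0.
  have /(Hom (x + e)) : `|p - (x + e)| < r.
    have := near_line x 1 xx0; rewrite lexx ler01 scale1r => /(_ isT).
    by move=> /lt_le_trans; exact.
  by move=> -[/(_ oxe)]; rewrite ltNge ltW.
- move=> x s [+ _] s01; rewrite rV_ballE => xx0.
  by have := near_line x s xx0 s01; move=> /lt_le_trans; exact.
Qed.

(** tau is the infimum of the parameters at which the segment is outside. Since omega is open, x +
    tau e is outside too, and it is a limit of earlier points, which are inside. *)
Lemma exit_point omega x e : open omega -> omega x -> ~ omega (x + e) ->
  exists tau : R, [/\ 0 <= tau <= 1, bdry omega (x + tau *: e)
    & forall s, 0 <= s < tau -> omega (x + s *: e)].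
Proof.
move=> oo ox nox.
pose A := [set s : R | 0 <= s <= 1 /\ ~ omega (x + s *: e)].
have A1 : A 1 by split; rewrite ?scale1r// ler01 lexx.
have hA : has_inf A by split; [exists 1 | exists 0 => s [/andP[]]].
set tau := inf A.
have t0 : 0 <= tau by apply: lb_le_inf; [exists 1 | move=> s [/andP[]]].
have t1 : tau <= 1 by apply: ge_inf => //; case: hA.
have below s : 0 <= s < tau -> omega (x + s *: e).
  move=> /andP[s0 st]; apply: contrapT => ns; have : tau <= s.
    by apply: ge_inf; [case: hA | split; rewrite // s0 (le_trans (ltW st))].
  by rewrite leNgt st.
have cline (s : R) : (fun s : R => x + s *: e) @ s --> x + s *: e.
  apply: cvgD; [exact: cvg_cst | exact: scalel_continuous].
have ntau : ~ omega (x + tau *: e).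
  move=> otau; have : nbhs (x + tau *: e) omega by exact: open_nbhs_nbhs.
  move=> /cline /nbhs_ballP[d /= d0 Hd].
  have [s As st] := inf_adherent d0 hA.
  have [_ ns] := As; apply: ns; apply: Hd; rewrite /ball /= distrC ger0_norm.
    by rewrite ltrBlDl.
  by rewrite subr_ge0; apply: ge_inf => //; case: hA.
exists tau; split; rewrite ?t0 ?t1//; apply/bdry_openE => //; split=> // B.
move=> /cline /nbhs_ballP[d /= d0 Hd].
have tpos : 0 < tau.
  by rewrite lt_neqAle t0 andbT; apply/eqP => t00; apply: ntau; rewrite -t00 scale0r addr0.
pose s := Num.max 0 (tau - d / 2).
have s0 : 0 <= s by rewrite le_max lexx.
have st : s < tau by rewrite gt_max tpos ltrBlDr ltrDl divr_gt0.
exists (x + s *: e); split; first by apply: below; rewrite s0.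
apply: Hd; rewrite /ball /= ger0_norm ?subr_ge0 ?ltW//.
have : tau - d / 2 <= s by rewrite le_max lexx orbT.
lra.
Qed.

End boundary_geometry.

(** * Uniform estimates under a Dirichlet bound *)

Lemma lee_pdivlE {R : realType} (a b : R) (x : \bar R) : 0 < a ->
  (a%:E * x <= b%:E -> x <= (b / a)%:E)%E.
Proof.
move=> a0 H.
have -> : x = (a^-1%:E * (a%:E * x))%E by rewrite muleA -EFinM mulVf ?gt_eqF// mul1e.
rewrite mulrC EFinM; apply: lee_wpmul2l => //.
by rewrite lee_fin invr_ge0 ltW.
Qed.

Section uniform_estimates.
Context {R : realType} {n : nat}.
Local Notation lebT := (caratheodory_type (@lebesgue_outer R n)).
Local Notation leb := (@leb R n).
Implicit Types (w : 'rV[R]_n -> R) (A B O : set 'rV[R]_n).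

Lemma open_leb_measurable O : open O -> measurable (O : set lebT).
Proof. exact: (open_cara_measurable measurable_halfspace_lebesgue). Qed.

Lemma measurable_sublevel_abs w (L : R) : continuous w ->
  measurable ([set x | `|w x| <= L] : set lebT).
Proof.
move=> cw; apply: (closed_cara_measurable measurable_halfspace_lebesgue).
apply: (@closed_comp _ _ (fun x => `|w x|) [set x : R | x <= L]); last exact: closed_le.
by move=> x _; apply: (@continuous_comp _ _ _ w (@Num.norm R R)); [exact: cw | exact: norm_continuous].
Qed.

Lemma measurable_sqr w (A : set lebT) : continuous w ->
  measurable_fun A (fun x : lebT => ((w x) ^+ 2)%:E).
Proof.
move=> cw; apply/measurable_EFinP; apply: measurable_funX.
exact: (cara_measurable_fun_continuous measurable_halfspace_lebesgue).
Qed.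

Lemma sqr_EFin_ge0 w x : (0 <= ((w x) ^+ 2)%:E)%E.
Proof. by rewrite lee_fin sqr_ge0. Qed.

Lemma leb_superlevel_le w (A : set lebT) (L M : R) : continuous w -> measurable A ->
  0 < L -> (\int[leb]_(x in A) ((w x) ^+ 2)%:E <= M%:E)%E ->
  (leb (A `&` [set x | (L < `|w x|)%R]) <= (M / L ^+ 2)%:E)%E.
Proof.
move=> cw mA L0 wM; have L20 : 0 < L ^+ 2 by rewrite exprn_gt0.
have := le_integral_abse leb mA (@measurable_sqr w A cw) L20 => H.
have H2 : ((L ^+ 2)%:E * leb (A `&` [set x | (L < `|w x|)%R]) <= M%:E)%E.
  apply: le_trans wM; apply: le_trans (le_trans H _).
    apply: lee_wpmul2l; first by rewrite lee_fin ltW.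
    apply: le_outer_measure => x [Ax /= Lx]; split=> //=.
    rewrite lee_fin ger0_norm ?sqr_ge0// -(real_normK (num_real (w x))).
    by rewrite lerXn2r ?nnegrE// ltW.
  rewrite le_eqVlt; apply/orP; left; apply/eqP; apply: eq_integral => x _ /=.
  by rewrite ger0_norm// sqr_ge0.
exact: lee_pdivlE L20 H2.
Qed.

Lemma integral_sqr_subset w (A B : set lebT) : measurable A -> measurable B -> continuous w ->
  A `<=` B -> (\int[leb]_(x in A) ((w x) ^+ 2)%:E <= \int[leb]_(x in B) ((w x) ^+ 2)%:E)%E.
Proof.
move=> mA mB cw AB.
apply: (@ge0_subset_integral _ lebT R leb A B mA mB _ (@measurable_sqr w B cw) _ AB) => x _.
exact: sqr_EFin_ge0.
Qed.

Lemma integral_sqr_setU_le w (A B : set lebT) : measurable A -> measurable B -> continuous w ->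
  (\int[leb]_(x in A `|` B) ((w x) ^+ 2)%:E <=
   \int[leb]_(x in A) ((w x) ^+ 2)%:E + \int[leb]_(x in B) ((w x) ^+ 2)%:E)%E.
Proof.
move=> mA mB cw; have mD : measurable (B `\` A) by exact: measurableD.
have -> : A `|` B = A `|` (B `\` A) by rewrite setUDr setDv setD0.
have -> := @ge0_integral_setU _ lebT R leb A (B `\` A) mA mD (fun x => ((w x) ^+ 2)%:E)
  (@measurable_sqr w _ cw) (fun x _ => sqr_EFin_ge0 w x).
  by apply: leeD2l; apply: integral_sqr_subset => // x [].
by rewrite disj_set2E setDIK.
Qed.

Variable W : set 'rV[R]_n.
Hypotheses (oW : open W) (bW : bounded_set W).

Lemma leb_ball_fin (z : 'rV[R]_n) (r : R) : (leb (ball z r) < +oo)%E.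
Proof.
apply: (@lebesgue_outer_ball_lty _ _ (`|z| + r)) => x; rewrite rV_ballE => zx.
have := ler_normB z (z - x); rewrite subKr => /le_trans; apply.
by rewrite lerD2l ltW.
Qed.

Lemma leb_fin A : (leb A < +oo)%E -> leb A = (fine (leb A))%:E.
Proof. by move=> Af; rewrite fineK// ge0_fin_numE ?outer_measure_ge0. Qed.

(** Any two points of the ball differ by a displacement of norm less than 2 r, along which one
    remains in the ball of radius 3 r. The bound M is uniform in w and in the set S, which may vary
    with w. *)
Lemma propagation_ball (z : 'rV[R]_n) (r K L m : R) : 0 < r -> 0 < m ->
  ball z (3 * r) `<=` W ->
  exists M : R, forall w (S : set lebT), Ck 1 w -> (dirichlet w W <= K%:E)%E ->
    measurable S -> S `<=` ball z r -> (m%:E <= leb S)%E -> (forall y, S y -> `|w y| <= L) ->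
    (\int[leb]_(x in ball z r) ((w x) ^+ 2)%:E <= M%:E)%E.
Proof.
move=> r0 m0 zW.
pose R2 : R := n%:R * (2 * r) ^+ 2.
pose H : set 'rV[R]_n := ball 0 (2 * r).
pose bU := fine (leb (ball z r)); pose bH := fine (leb H).
exists (2 * L ^+ 2 * bU + 2 / m * (R2 * K * bH)) => w S C1w wK mS Sz Sm SL.
have mU : measurable (ball z r : set lebT) by apply: open_leb_measurable; exact: ball_open.
have mH : measurable (H : set lebT) by apply: open_leb_measurable; exact: ball_open.
have R20 : 0 <= R2 by rewrite mulr_ge0// sqr_ge0.
have UHW x h (t : R) : ball z r x -> H h -> 0 <= t < 1 -> W (x + t *: h).
  rewrite /H !rV_ballE sub0r normrN => zx hr /andP[t0 t1]; apply: zW; rewrite rV_ballE.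
  rewrite opprD addrA; apply: le_lt_trans (ler_normB _ _) _; rewrite normrZ (ger0_norm t0).
  have : t * `|h| <= `|h| by rewrite ler_piMl// ltW.
  lra.
have HR2 h : H h -> dot h h <= R2.
  rewrite /H rV_ballE sub0r normrN => hr; apply: le_trans (dot_le_norm h) _.
  by apply: ler_wpM2l => //; rewrite lerXn2r ?nnegrE// ltW// mulr_gt0.
have Hm x : ball z r x -> (m%:E <= leb (H `&` translate x @^-1` S))%E.
  rewrite rV_ballE => zx; apply: le_trans Sm _.
  have <- : @lebesgue_outer R n (translate x @^-1` S) = leb S := lebesgue_outer_translate x S.
  apply: le_outer_measure => h Sxh; split=> //.
  rewrite /H rV_ballE sub0r normrN; have := Sz _ Sxh; rewrite /translate rV_ballE => zxh.
  have -> : h = (z - x) - (z - (h + x)) by rewrite opprB addrC [h + x]addrC addrA subrK addrC addKr.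
  apply: le_lt_trans (ler_normB _ _) _; lra.
have := @sqr_integral_propagation R n w W C1w oW (ball z r) H S R2 L m mU mH mS m0 UHW HR2 Hm SL.
move=> /le_trans; apply.
rewrite (leb_fin (leb_ball_fin z r)) (leb_fin (leb_ball_fin 0 (2 * r))) -/bU -/bH.
rewrite EFinD EFinM [(2 / m * _)%:E]EFinM [(R2 * K * bH)%:E]EFinM [(R2 * K)%:E]EFinM.
apply: leeD => //; apply: lee_wpmul2l; first by rewrite lee_fin divr_ge0// ltW.
apply: lee_wpmul2r; first by rewrite lee_fin fine_ge0// outer_measure_ge0.
by apply: lee_wpmul2l; rewrite ?lee_fin.
Qed.

Section tail.
Hypothesis cW : connected W.
Hypothesis W_gt0 : (0 < leb W)%E.
Variables (z0 : 'rV[R]_n) (r0 K L0 m0 : R).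
Hypotheses (r0_gt0 : 0 < r0) (m0_gt0 : 0 < m0) (z0W : ball z0 (3 * r0) `<=` W).

(** The part of the ball on which |w| <= L0 depends on w; only its measure is controlled. The bounds
    below are uniform over this family. *)
Let Fam w := [/\ Ck 1 w, (dirichlet w W <= K%:E)%E &
  (m0%:E <= leb (ball z0 r0 `&` [set x | (`|w x| <= L0)%R]))%E].

Let bnd O := exists M : R, forall w, Fam w -> (\int[leb]_(x in O) ((w x) ^+ 2)%:E <= M%:E)%E.

Let bndS O B : open O -> open B -> O `<=` B -> bnd B -> bnd O.
Proof.
move=> oO oB OB [M HM]; exists M => w Fw; apply: le_trans (HM w Fw).
have [C1w _ _] := Fw; apply: integral_sqr_subset OB; last exact: C1_continuous.
- exact: open_leb_measurable.
- exact: open_leb_measurable.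
Qed.

Let bndU O B : open O -> open B -> bnd O -> bnd B -> bnd (O `|` B).
Proof.
move=> oO oB [M HM] [M' HM']; exists (M + M') => w Fw.
have [C1w _ _] := Fw; rewrite EFinD; apply: le_trans (leeD (HM w Fw) (HM' w Fw)).
by apply: integral_sqr_setU_le; [exact: open_leb_measurable.. | exact: C1_continuous].
Qed.

(** By Chebyshev's inequality, a uniform bound on the square integral over B keeps |w| below a fixed
    L on at least half of B, and this is the input of [propagation_ball]. *)
Let bnd_step (z : 'rV[R]_n) (r : R) B : 0 < r -> ball z (3 * r) `<=` W -> open B -> B !=set0 ->
  B `<=` ball z r -> bnd B -> bnd (ball z r).
Proof.
move=> rgt0 zW oB B0 Bz [M HM].
have bB : (0 < leb B)%E by exact: leb_open_gt0 W_gt0 oB B0.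
have mB := open_leb_measurable oB.
have Bfin : (leb B < +oo)%E.
  by apply: le_lt_trans (leb_ball_fin z r); exact: le_outer_measure.
pose b := fine (leb B); have b0 : 0 < b by rewrite fine_gt0// bB Bfin.
pose M1 := `|M| + 1; have M10 : 0 < M1 by rewrite ltr_wpDl.
pose L := 2 * M1 / b + 1.
have L1 : 1 <= L by rewrite /L lerDr divr_ge0 ?mulr_ge0// ltW.
have L0' : 0 < L by exact: lt_le_trans ltr01 L1.
have b20 : 0 < b / 2 by rewrite divr_gt0.
have [M' HM'] := @propagation_ball z r K L (b / 2) rgt0 b20 zW.
exists M' => w Fw; have [C1w wK _] := Fw; have cw := C1_continuous C1w.
have mS := measurable_sublevel_abs L cw.
apply: (HM' w (B `&` [set x | `|w x| <= L])) => //.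
- exact: measurableI.
- by move=> x [/Bz].
- have wM1 : (\int[leb]_(x in B) ((w x) ^+ 2)%:E <= M1%:E)%E.
    by apply: le_trans (HM w Fw) _; rewrite lee_fin /M1 (le_trans (ler_norm _))// lerDl.
  have T := leb_superlevel_le cw mB L0' wM1.
  have : (leb B <= leb (B `&` [set x | (`|w x| <= L)%R]) + leb (B `&` [set x | (L < `|w x|)%R]))%E.
    apply: le_trans (outer_measureU2 _ _ _); apply: le_outer_measure => x Bx.
    by have [wL|Lw] := leP `|w x| L; [left | right].
  have T2 : (leb (B `&` [set x | (L < `|w x|)%R]) <= (b / 2)%:E)%E.
    apply: le_trans T _; rewrite lee_fin ler_pdivrMr ?exprn_gt0//.
    apply: (@le_trans _ _ (b / 2 * L)).
      by rewrite /L mulrDr mulr1 [b / 2 * _](_ : _ = M1); [rewrite lerDl divr_ge0// ltW | field; rewrite gt_eqF].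
    by rewrite ler_pM2l ?divr_gt0// -[leLHS]mulr1 expr2 ler_pM2l.
  move=> /le_trans /(_ (leeD (lexx _) T2)); rewrite -leeBlDr// (leb_fin Bfin) -/b -EFinB.
  by apply: le_trans; rewrite lee_fin; lra.
by move=> y [].
Qed.

Let good x := W x /\ exists O, [/\ open O, O x, O `<=` W & bnd O].

Let all_good x : W x -> good x.
Proof.
have inner_ball (y : 'rV[R]_n) : W y -> exists r : R, 0 < r /\ ball y (3 * r) `<=` W.
  move=> Wy; have /nbhs_ballP[r /= rp yW] : nbhs y W by exact: open_nbhs_nbhs.
  exists (r / 3); split; first by rewrite divr_gt0.
  by rewrite mulrC divfK// pnatr_eq0.
have sub_ball (y : 'rV[R]_n) (r : R) : 0 < r -> ball y r `<=` ball y (3 * r).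
  by move=> rp; apply: le_ball; rewrite -{1}[r]mul1r ler_pM2r// ler1n.
suff -> : good = W by [].
apply: cW.
- exists z0; split; first by apply: z0W; apply: ballxx; rewrite mulr_gt0.
  exists (ball z0 r0); split; [exact: ball_open | exact: ballxx | | ].
    exact: subset_trans (sub_ball _ _ r0_gt0) z0W.
  have [M HM] := propagation_ball K L0 r0_gt0 m0_gt0 z0W.
  exists M => w [C1w wK wm].
  apply: (HM w (ball z0 r0 `&` [set x | `|w x| <= L0])) => //.
  + apply: measurableI; first by apply: open_leb_measurable; exact: ball_open.
    by apply: measurable_sublevel_abs; exact: C1_continuous.
  + by move=> y [].
- exists good; last first.
    by apply/seteqP; split=> [y gy|y []//]; split=> //; case: gy.
  rewrite openE => y [Wy [ O [ oO Oy OW bO]]]; rewrite /interior.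
  have : nbhs y O by exact: open_nbhs_nbhs.
  by apply: filterS => t Ot; split; [exact: OW | exists O].
- exists (closure good); first exact: closed_closure.
  apply/seteqP; split=> [y gy|y [Wy cly]]; first by split; [case: gy | exact: subset_closure].
  split=> //; have [r [rp yW]] := inner_ball y Wy.
  have [|t [[Wt [ O [ oO Ot OW bO]]] yt]] := cly (ball y r); first exact: nbhsx_ballx.
  exists (ball y r); split; [exact: ball_open | exact: ballxx | exact: subset_trans (sub_ball _ _ rp) yW |].
  apply: (@bnd_step y r (O `&` ball y r)) => //.
  + by apply: openI => //; exact: ball_open.
  + by exists t.
  + by apply: bndS bO; [apply: openI => //; exact: ball_open | | move=> u []].
Qed.

(* The points near which the family is uniformly square integrable form a set that
   is open, closed in W by propagation across balls, and contains z0. *)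
Lemma uniform_tail (eta : R) : 0 < eta -> exists2 L : R, 0 < L &
  forall w, Fam w -> (leb (W `&` [set x | (L < `|w x|)%R]) <= eta%:E)%E.
Proof.
move=> eta0.
(* A compact exhaustion of W. The part of W off [Kc k] has measure at most eta/2 for large k; on
   [Kc k] the local bounds become one bound, and Chebyshev's inequality accounts for the other
   eta/2. *)
pose Kc k : set 'rV[R]_n := [set x | ball x k.+1%:R^-1 `<=` W].
have k0 k : 0 < k.+1%:R^-1 :> R by rewrite invr_gt0.
have KW k : Kc k `<=` W by move=> x; apply; exact: ballxx.
have cK k : closed (Kc k).
  rewrite -openC (_ : ~` Kc k = \bigcup_(y in ~` W) ball y k.+1%:R^-1).
    by apply: bigcup_open => y _; exact: ball_open.
  apply/seteqP; split=> [x /= /existsNP[y /not_implyP[xy Wy]]|x [y Wy yx] xW].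
    by exists y => //; exact: ball_sym.
  by apply: Wy; apply: xW; exact: ball_sym.
have bK k : bounded_set (Kc k).
  by move: bW => [M [Mr HM]]; exists M; split=> // s Ms x /KW; exact: HM.
have compK k : compact (Kc k) by apply: bounded_closed_compact; [exact: bK | exact: cK].
pose D k : set lebT := W `\` Kc k.
have mW := open_leb_measurable oW.
have mD k : measurable (D k).
  by apply: measurableD => //; exact: (closed_cara_measurable measurable_halfspace_lebesgue).
have Wfin : (leb W < +oo)%E by exact: leb_bounded_lty.
have D_cvg : leb \o D @ \oo --> 0%E.
  have D0 : \bigcap_k D k = set0.
    rewrite -subset0 => x Dx; have [Wx _] := Dx 0%N I.
    have /nbhs_ballP[r /= rp xW] : nbhs x W by exact: open_nbhs_nbhs.
    have [k kr] : exists k, 0 + k.+1%:R^-1 < r by exact: ltr_add_invr.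
    have [_] := Dx k I; apply; rewrite /Kc /=; apply: subset_trans xW.
    by apply: le_ball; rewrite add0r in kr; exact: ltW.
  rewrite -(measure0 leb) -D0; apply: nonincreasing_cvg_mu => //.
  - by apply: le_lt_trans Wfin; apply: le_outer_measure => x [].
  - by rewrite D0.
  apply/nonincreasing_seqP => k; apply/subsetPset => x [Wx nKx]; split=> // Kx; apply: nKx.
  apply: subset_trans Kx; apply: le_ball.
  by rewrite lef_pV2 ?posrE ?ltr0n// ler_nat.
have [k Dk] : exists k, (leb (D k) < (eta / 2)%:E)%E.
  have : \forall k \near \oo, (leb (D k) < (eta / 2)%:E)%E.
    have e2 : (0%R < (eta / 2)%:E)%E by rewrite lte_fin divr_gt0.
    apply: (D_cvg [set x | (x < (eta / 2)%:E)%E]).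
    by apply: open_nbhs_nbhs; split=> //; exact: open_ereal_lt_ereal.
  by move=> [k _ /(_ k (leqnn k))]; exists k.
pose P B := exists O, [/\ open O, B `<=` O, O `<=` W & bnd O].
have : P (Kc k).
  apply: (@compact_local_property _ P); first exact: compK.
  - exists set0; split; [exact: open0 | by [] | by [] |].
    by exists 0 => w _; rewrite integral_set0.
  - move=> B C [ O [ oO BO OW bO]] [ O' [ oO' CO' OW' bO']]; exists (O `|` O'); split.
    + exact: openU.
    + exact: setUSS.
    + by rewrite subUset.
    + exact: bndU.
  - by move=> B C BC [ O [ oO CO OW bO]]; exists O; split=> //; exact: subset_trans CO.
  move=> x /KW /all_good[Wx [ O [ oO Ox OW bO]]]; exists O => //.
  by exists O; split.
move=> [ O [ oO KO OW [M HM]]].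
pose M1 := `|M| + 1; have M10 : 0 < M1 by rewrite ltr_wpDl.
pose L := 2 * M1 / eta + 1.
have L1 : 1 <= L by rewrite /L lerDr divr_ge0 ?mulr_ge0// ltW.
have Lpos : 0 < L by exact: lt_le_trans ltr01 L1.
exists L => // w Fw; have [C1w _ _] := Fw; have cw := C1_continuous C1w.
have wM1 : (\int[leb]_(x in O) ((w x) ^+ 2)%:E <= M1%:E)%E.
  by apply: le_trans (HM w Fw) _; rewrite lee_fin /M1 (le_trans (ler_norm _))// lerDl.
have T := leb_superlevel_le cw (open_leb_measurable oO) Lpos wM1.
have T2 : (leb (O `&` [set x | (L < `|w x|)%R]) <= (eta / 2)%:E)%E.
  apply: le_trans T _; rewrite lee_fin ler_pdivrMr ?exprn_gt0//.
  apply: (@le_trans _ _ (eta / 2 * L)).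
    by rewrite /L mulrDr mulr1 [eta / 2 * _](_ : _ = M1); [rewrite lerDl divr_ge0// ltW | field; rewrite gt_eqF].
  by rewrite ler_pM2l ?divr_gt0// -[leLHS]mulr1 expr2 ler_pM2l.
apply: (@le_trans _ _ (leb (D k) + leb (O `&` [set x | (L < `|w x|)%R]))%E).
  apply: le_trans (outer_measureU2 _ _ _); apply: le_outer_measure => x [Wx Lx].
  by have [Kx|nKx] := pselect (Kc k x); [right; split=> //; exact: KO | left].
rewrite [eta in leRHS]splitr EFinD; apply: leeD => //; exact: ltW.
Qed.

End tail.

End uniform_estimates.

(** * Equi-integrability up to the boundary *)

Section equi_integrability.
Context {R : realType} {n : nat}.
Local Notation V := 'rV[R]_n.+1.
Local Notation lebT := (caratheodory_type (@lebesgue_outer R n.+1)).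
Local Notation leb := (@leb R n.+1).
Variable W : set V.
Hypotheses (oW : open W) (bW : bounded_set W) (sW : smooth_boundary W) (W_gt0 : (0 < leb W)%E).

Let piece (A R0 eta : R) (B : set V) := forall (phi : V -> R) (eps e : R), Ck 1 phi -> 0 <= eps ->
  (dirichlet phi W <= e%:E)%E -> (leb (W `&` [set x | (eps < `|phi x|)%R]) <= eta%:E)%E ->
  (\int[leb]_(x in W `&` B) ((phi x) ^+ 2)%:E <= (A * (eps ^+ 2 + R0 ^+ 2 * e))%:E)%E.

(** A is chosen before R0: the gradient term can be made as small as desired by shortening the
    displacements, at the sole cost of a smaller eta. *)
Let P B := exists2 O : set V, open O /\ B `<=` O & exists2 A : R, 0 <= A &
  forall R0 : R, 0 < R0 -> exists2 eta : R, 0 < eta & piece A R0 eta O.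

Let mW := open_leb_measurable oW.

Let dirichlet_bound_ge0 (phi : V -> R) (e : R) : (dirichlet phi W <= e%:E)%E -> 0 <= e.
Proof. by move=> He; rewrite -lee_fin; apply: le_trans He; exact: dirichlet_ge0. Qed.

Let PU B C : P B -> P C -> P (B `|` C).
Proof.
move=> [ O [ oO BO] [A A0 HA]] [ O' [ oO' CO'] [A' A0' HA']].
exists (O `|` O'); first by split; [exact: openU | exact: setUSS].
exists (A + A'); first by rewrite addr_ge0.
move=> R0 R00; have [eta eta0 H] := HA R0 R00; have [eta' eta0' H'] := HA' R0 R00.
exists (Num.min eta eta'); first by rewrite lt_min eta0.
move=> phi eps e C1phi eps0 phie small.
have s1 : (leb (W `&` [set x | (eps < `|phi x|)%R]) <= eta%:E)%E.
  by apply: le_trans small _; rewrite lee_fin ge_min lexx.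
have s2 : (leb (W `&` [set x | (eps < `|phi x|)%R]) <= eta'%:E)%E.
  by apply: le_trans small _; rewrite lee_fin ge_min lexx orbT.
rewrite setIUr mulrDl EFinD.
apply: le_trans (leeD (H phi eps e C1phi eps0 phie s1) (H' phi eps e C1phi eps0 phie s2)).
apply: integral_sqr_setU_le; last exact: C1_continuous.
- by apply: measurableI => //; exact: open_leb_measurable.
- by apply: measurableI => //; exact: open_leb_measurable.
Qed.

Let P_local x : closure W x -> exists2 O, open_nbhs x O & P O.
Proof.
move=> clx; have [r r0 HR] := cone_condition oW sW clx.
exists (ball x r); first by split; [exact: ball_open | exact: ballxx].
exists (ball x r); first by split; [exact: ball_open |].
pose bU := fine (leb (W `&` ball x r)).
have Ufin : (leb (W `&` ball x r) < +oo)%E.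
  by apply: le_lt_trans (leb_ball_fin x r); apply: le_outer_measure => y [].
have bU0 : 0 <= bU by rewrite fine_ge0// outer_measure_ge0.
(* The measure b of the cone of displacements cancels in (2 / (b/2)) (n+1) R0^2 e b = 4 (n+1) R0^2
   e; hence A does not involve R0. *)
pose A := 2 * bU + 4 * n.+1%:R.
have A0 : 0 <= A by rewrite addr_ge0 ?mulr_ge0.
exists A => // R0 R00; have [H [oH H0 HR0 Hcone]] := HR R0 R00.
have mH := open_leb_measurable oH.
have Hpos : (0 < leb H)%E by exact: leb_open_gt0 W_gt0 oH H0.
have Hfin : (leb H < +oo)%E.
  apply: (@lebesgue_outer_ball_lty _ _ R0) => h /HR0; exact: ltW.
pose b := fine (leb H); have b0 : 0 < b by rewrite fine_gt0// Hpos Hfin.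
(* The displacements leading to |phi| > eps fill at most half of the cone, so the other half leads
   to S. *)
exists (b / 2); first by rewrite divr_gt0.
move=> phi eps e C1phi eps0 phie small.
have e0 := dirichlet_bound_ge0 phie.
have cphi := C1_continuous C1phi.
pose S : set lebT := W `&` [set x | `|phi x| <= eps].
have mS : measurable S by apply: measurableI => //; exact: measurable_sublevel_abs.
have mU : measurable (W `&` ball x r : set lebT).
  by apply: measurableI => //; apply: open_leb_measurable; exact: ball_open.
have UHW y h (t : R) : (W `&` ball x r) y -> H h -> 0 <= t < 1 -> W (y + t *: h).
  move=> [Wy xy] Hh /andP[t0 t1]; apply: Hcone => //; first by rewrite -rV_ballE.
  by rewrite t0 ltW.
pose R2 : R := n.+1%:R * R0 ^+ 2.
have R20 : 0 <= R2 by rewrite mulr_ge0// sqr_ge0.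
have HR2 h : H h -> dot h h <= R2.
  move=> /HR0 hr; apply: le_trans (dot_le_norm h) _.
  by apply: ler_wpM2l => //; rewrite lerXn2r ?nnegrE// ltW.
have Hm y : (W `&` ball x r) y -> ((b / 2)%:E <= leb (H `&` translate y @^-1` S))%E.
  move=> [Wy xy].
  have : (leb H <= leb (H `&` translate y @^-1` S) +
      leb (translate y @^-1` (W `&` [set x | (eps < `|phi x|)%R])))%E.
    apply: le_trans (outer_measureU2 _ _ _); apply: le_outer_measure => h Hh.
    have Wyh : W (h + y).
      rewrite addrC -[h]scale1r; apply: Hcone => //; first by rewrite -rV_ballE.
      by rewrite ler01 lexx.
    by have [pe|ep] := leP `|phi (h + y)| eps; [left | right].
  have -> : leb (translate y @^-1` (W `&` [set x | (eps < `|phi x|)%R])) =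
      leb (W `&` [set x | (eps < `|phi x|)%R]) := lebesgue_outer_translate y _.
  move=> /le_trans /(_ (leeD (lexx _) small)); rewrite -leeBlDr// (leb_fin Hfin) -/b -EFinB.
  by apply: le_trans; rewrite lee_fin; lra.
have SL y : S y -> `|phi y| <= eps by case.
have b20 : 0 < b / 2 by rewrite divr_gt0.
have := @sqr_integral_propagation R n.+1 phi W C1phi oW _ H S R2 eps (b / 2) mU mH mS b20 UHW HR2 Hm SL.
move=> /le_trans; apply.
rewrite (leb_fin Ufin) (leb_fin Hfin) -/b -/bU.
apply: (@le_trans _ _ ((2 * eps ^+ 2)%:E * bU%:E + (2 / (b / 2))%:E * (R2%:E * e%:E * b%:E))%E).
  apply: leeD => //; apply: lee_wpmul2l; first by rewrite lee_fin divr_ge0// ltW.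
  apply: lee_wpmul2r; first by rewrite lee_fin ltW.
  by apply: lee_wpmul2l; rewrite ?lee_fin.
rewrite -!EFinM -EFinD lee_fin.
have -> : 2 / (b / 2) * (R2 * e * b) = 4 * n.+1%:R * (R0 ^+ 2 * e).
  by rewrite /R2; field; rewrite gt_eqF.
rewrite /A mulrDr; apply: lerD.
  rewrite [2 * _ * _](_ : _ = (2 * bU) * eps ^+ 2); last by ring.
  by apply: ler_wpM2r; rewrite ?sqr_ge0// lerDl mulr_ge0.
by apply: ler_wpM2r; [apply: mulr_ge0 => //; exact: sqr_ge0 | rewrite lerDr mulr_ge0].
Qed.

(* Every point of W sees a fixed proportion of a small cone contained in W, so a
   function that is small off a set of small measure has small square integral. *)
Lemma equi_integrability : exists2 A : R, 0 <= A & forall R0 : R, 0 < R0 ->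
  exists2 eta : R, 0 < eta & forall (phi : V -> R) (eps e : R), Ck 1 phi -> 0 <= eps ->
  (dirichlet phi W <= e%:E)%E -> (leb (W `&` [set x | (eps < `|phi x|)%R]) <= eta%:E)%E ->
  (\int[leb]_(x in W) ((phi x) ^+ 2)%:E <= (A * (eps ^+ 2 + R0 ^+ 2 * e))%:E)%E.
Proof.
have : P (closure W).
  apply: (@compact_local_property _ P); first exact: compact_closure.
  - exists set0; first by split; [exact: open0 |].
    exists 0 => // R0 R00; exists 1 => // phi eps e C1phi eps0 phie _.
    by rewrite setI0 integral_set0 mul0r.
  - exact: PU.
  - move=> B C BC [ O [ oO CO] H]; exists O => //; split=> //.
    exact: subset_trans CO.
  exact: P_local.
move=> [ O [ oO WO] [A A0 HA]]; exists A => // R0 R00.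
have [eta eta0 H] := HA R0 R00; exists eta => // phi eps e C1phi eps0 phie small.
have := H phi eps e C1phi eps0 phie small; rewrite (_ : W `&` O = W)//.
by apply/setIidPl => x Wx; apply: WO; exact: subset_closure.
Qed.

End equi_integrability.

(** * The key inequality *)

Section truncation.
Context {R : realType}.
Variable e : R.
Hypothesis e_gt0 : 0 < e.

Let v (s : R) := Num.sqrt (s ^+ 2 + e ^+ 2).

(* The derivatives F' of lift_away and w' of log_size satisfy F'^2 <= 1 - e^2 w'^2
   while F^2 = s^2 + O(e^2), so testing the form with F \o phi instead of phi
   leaves a gain of d e^2 times the Dirichlet integral of log_size \o phi. *)
Definition lift_away (s : R) : R := v s + e ^+ 2 / v s.

Definition log_size (s : R) : R := 2^-1 * ln (s ^+ 2 / e ^+ 2 + 1).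

Let v2_gt0 s : 0 < s ^+ 2 + e ^+ 2.
Proof. by rewrite ltr_wpDl ?sqr_ge0// exprn_gt0. Qed.

Let v_gt0 s : 0 < v s. Proof. by rewrite sqrtr_gt0. Qed.

Let v2 s : v s ^+ 2 = s ^+ 2 + e ^+ 2. Proof. by rewrite sqr_sqrtr// ltW. Qed.

Let e2_gt0 : 0 < e ^+ 2. Proof. by rewrite exprn_gt0. Qed.

Let is_derive_v s : is_derive s (1 : R) v (s / v s).
Proof.
have H1 : is_derive s (1 : R) (fun s : R => s ^+ 2 + e ^+ 2) (2 * s).
  by apply: is_derive_eq; rewrite addr0 /GRing.scale /=; ring.
have H2 : is_derive (s ^+ 2 + e ^+ 2) (1 : R) Num.sqrt (2 * v s)^-1.
  exact: is_derive1_sqrt.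
have := @is_derive1_comp R Num.sqrt (fun s : R => s ^+ 2 + e ^+ 2) s _ _ H2 H1.
rewrite (_ : _ * (2 * s) = s / v s)//.
by field; rewrite gt_eqF.
Qed.

Lemma is_derive_lift_away s : is_derive s (1 : R) lift_away ((s / v s) ^+ 3).
Proof.
have vs := is_derive_v s; have v0 : v s != 0 by rewrite gt_eqF.
have H : is_derive s (1 : R) (fun s => (v s)^-1) (- (v s) ^- 2 *: (s / v s)).
  exact: is_deriveV.
have H2 : is_derive s (1 : R) (fun s => e ^+ 2 * (v s)^-1) (e ^+ 2 *: (- (v s) ^- 2 *: (s / v s))).
  exact: is_deriveZ.
have := is_deriveD vs H2; rewrite (_ : s / v s + _ = (s / v s) ^+ 3)//.
rewrite /GRing.scale /=; apply: (mulIf (expf_neq0 3 v0)).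
rewrite [RHS](_ : _ = s * s ^+ 2); last by field.
have -> : s ^+ 2 = v s ^+ 2 - e ^+ 2 by rewrite v2 addrK.
by field.
Qed.

Lemma is_derive_log_size s : is_derive s (1 : R) log_size (s / (s ^+ 2 + e ^+ 2)).
Proof.
have H1 : is_derive s (1 : R) (fun s : R => s ^+ 2 / e ^+ 2 + 1) (2 * s / e ^+ 2).
  have H0 : is_derive s (1 : R) (fun s : R => (e ^+ 2)^-1 * s ^+ 2 + 1) (2 * s / e ^+ 2).
    by apply: is_derive_eq; rewrite /GRing.scale /=; field; rewrite gt_eqF.
  by move: H0; congr is_derive; apply/funext => t; rewrite mulrC.
have p0 : 0 < s ^+ 2 / e ^+ 2 + 1 by rewrite ltr_wpDl// divr_ge0// sqr_ge0.
have H2 : is_derive (s ^+ 2 / e ^+ 2 + 1) (1 : R) (@ln R) (s ^+ 2 / e ^+ 2 + 1)^-1.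
  exact: is_derive1_ln.
have H3 := @is_derive1_comp R (@ln R) (fun s : R => s ^+ 2 / e ^+ 2 + 1) s _ _ H2 H1.
have := is_deriveZ 2^-1 H3; rewrite /GRing.scale /= (_ : 2^-1 * _ = s / (s ^+ 2 + e ^+ 2))//.
by field; rewrite !gt_eqF// ltW.
Qed.

Lemma continuous_deriv_lift_away : continuous (fun s : R => (s / v s) ^+ 3).
Proof.
move=> s; apply: (@continuous_comp _ _ _ (fun s : R => s / v s) (fun y : R => y ^+ 3)); last exact: exprn_continuous.
apply: cvgM; first exact: cvg_id.
apply: cvgV; first by rewrite gt_eqF.
have /derivable1_diffP := @ex_derive _ _ _ _ _ _ _ (is_derive_v s).
exact: differentiable_continuous.
Qed.

Lemma continuous_deriv_log_size : continuous (fun s : R => s / (s ^+ 2 + e ^+ 2)).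
Proof.
move=> s; apply: cvgM; first exact: cvg_id.
apply: cvgV; first by rewrite gt_eqF.
by apply: cvgD; [exact: exprn_continuous | exact: cvg_cst].
Qed.

(** With p = s^2 / (s^2 + e^2) the claim reads p^3 <= 1 - p (1 - p), and the difference factors as
    (1 - p)(1 + p^2). *)
Lemma deriv_lift_away_le s :
  ((s / v s) ^+ 3) ^+ 2 <= 1 - e ^+ 2 * (s / (s ^+ 2 + e ^+ 2)) ^+ 2.
Proof.
set p := s ^+ 2 / (s ^+ 2 + e ^+ 2).
have -> : ((s / v s) ^+ 3) ^+ 2 = p ^+ 3.
  by rewrite /p -v2; field; rewrite gt_eqF.
have q0 : s ^+ 2 + e ^+ 2 != 0 by rewrite gt_eqF.
have -> : e ^+ 2 * (s / (s ^+ 2 + e ^+ 2)) ^+ 2 = p * (1 - p) by rewrite /p; field.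
have p0 : 0 <= p by rewrite divr_ge0 ?sqr_ge0// ltW.
have p1 : p <= 1 by rewrite ler_pdivrMr// mul1r lerDl ltW.
rewrite -subr_ge0 (_ : _ - _ = (1 - p) * (1 + p ^+ 2)); last by ring.
by rewrite mulr_ge0 ?subr_ge0// addr_ge0// sqr_ge0.
Qed.

Lemma sqr_lift_away s : s ^+ 2 <= lift_away s ^+ 2 <= s ^+ 2 + 4 * e ^+ 2.
Proof.
have -> : lift_away s ^+ 2 = s ^+ 2 + e ^+ 2 + 2 * e ^+ 2 + e ^+ 2 * (e ^+ 2 / (s ^+ 2 + e ^+ 2)).
  by rewrite /lift_away -!v2; field; rewrite gt_eqF.
have q0 : 0 <= e ^+ 2 / (s ^+ 2 + e ^+ 2) by rewrite divr_ge0// ltW.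
have q1 : e ^+ 2 / (s ^+ 2 + e ^+ 2) <= 1 by rewrite ler_pdivrMr// mul1r lerDr sqr_ge0.
have H1 : 0 <= e ^+ 2 * (e ^+ 2 / (s ^+ 2 + e ^+ 2)) by rewrite mulr_ge0// ltW.
have H2 : e ^+ 2 * (e ^+ 2 / (s ^+ 2 + e ^+ 2)) <= e ^+ 2 by rewrite ler_piMr// ltW.
by apply/andP; split; lra.
Qed.

Lemma sqr_lift_away_ge s : e ^+ 2 <= lift_away s ^+ 2.
Proof.
have ev : e <= v s.
  by rewrite -ler_sqr ?nnegrE ?(ltW e_gt0) ?(ltW (v_gt0 s))// v2 lerDr sqr_ge0.
have F0 : v s <= lift_away s by rewrite /lift_away lerDl divr_ge0// ltW.
by rewrite ler_sqr ?nnegrE ?(ltW e_gt0) ?(le_trans _ F0) ?(ltW (v_gt0 s)).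
Qed.

Lemma log_size_ge0 s : 0 <= log_size s.
Proof. by rewrite mulr_ge0// ln_ge0// lerDr divr_ge0// sqr_ge0. Qed.

Lemma log_size_le1 s : `|s| <= e -> log_size s <= 1.
Proof.
move=> se.
have : s ^+ 2 / e ^+ 2 <= 1.
  by rewrite ler_pdivrMr// mul1r -(real_normK (num_real s)) ler_sqr ?nnegrE// ltW.
have H0 : 0 <= s ^+ 2 / e ^+ 2 by rewrite divr_ge0 ?sqr_ge0// ltW.
have := @le_ln1Dx R (s ^+ 2 / e ^+ 2); rewrite /log_size addrC => H H1.
have : ln (s ^+ 2 / e ^+ 2 + 1) <= 1 by apply: le_trans H1; apply: H; exact: lt_le_trans H0.
lra.
Qed.

Lemma log_size_leP s (L : R) : log_size s <= L -> `|s| <= e * expR L.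
Proof.
rewrite /log_size => H.
have p0 : 0 < s ^+ 2 / e ^+ 2 + 1 by rewrite ltr_wpDl// divr_ge0// sqr_ge0.
have : ln (s ^+ 2 / e ^+ 2 + 1) <= L + L by lra.
rewrite -ler_expR lnK// expRD -expr2 => H2.
rewrite -ler_sqr ?nnegrE ?normr_ge0 ?mulr_ge0 ?expR_ge0 ?(ltW e_gt0)// real_normK ?num_real//.
have -> : s ^+ 2 = e ^+ 2 * (s ^+ 2 / e ^+ 2) by field; rewrite gt_eqF.
by rewrite exprMn ler_wpM2l ?sqr_ge0//; lra.
Qed.

End truncation.

Section reaction_form.
Context {R : realType} {n : nat}.
Local Notation lebT := (caratheodory_type (@lebesgue_outer R n)).
Local Notation leb := (@leb R n).
Variable W : set 'rV[R]_n.
Hypotheses (oW : open W) (bW : bounded_set W).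
Variables (c : 'rV[R]_n -> R) (C d : R).
Hypotheses (mc : measurable_fun (W : set lebT) c) (cC : forall x, W x -> `|c x| <= C) (d_gt0 : 0 < d).

Definition dirichlet_int (w : 'rV[R]_n -> R) : R :=
  (\int[leb]_(x in W) dot (grad w x) (grad w x))%R.

Definition bulk_form (w : 'rV[R]_n -> R) : R :=
  d * dirichlet_int w - (\int[leb]_(x in W) (c x * w x ^+ 2))%R.

Lemma continuous_grad_sqr (w : 'rV[R]_n -> R) : Ck 1 w ->
  continuous (fun x : 'rV[R]_n => dot (grad w x) (grad w x)).
Proof.
move=> [_ dw].
rewrite (_ : (fun _ => _) = (fun y : 'rV[R]_n => \sum_(i < n) partial w i y * partial w i y)).
  apply: continuous_big => [|i _ y]; first exact: add_continuous.
  by apply: (@continuousM _ _ (partial w i) (partial w i)); case: (dw i) => _; exact.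
by apply/funext => y; apply: eq_bigr => i _; rewrite mxE.
Qed.

Lemma open_bounded_integrable (h : 'rV[R]_n -> R) : continuous h -> leb.-integrable W (EFin \o h).
Proof. by move=> ch; apply: continuous_integrable => //; exact: open_leb_measurable. Qed.

Lemma dirichletE (w : 'rV[R]_n -> R) : Ck 1 w -> dirichlet w W = (dirichlet_int w)%:E.
Proof.
move=> C1w; have I := open_bounded_integrable (continuous_grad_sqr C1w).
rewrite /dirichlet_int /Rintegral fineK//.
exact: (integrable_fin_num (open_leb_measurable oW) I).
Qed.

Lemma bounded_mul_integrable (h : 'rV[R]_n -> R) : continuous h ->
  leb.-integrable W (EFin \o (fun x => c x * h x)).
Proof.
move=> ch; apply: (@integrableMr _ lebT R leb W (open_leb_measurable oW) c (EFin \o h) mc).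
  by exists C; split; [exact: num_real|move=> M CM x /cC /le_trans; apply; exact: ltW].
exact: open_bounded_integrable.
Qed.

Lemma continuous_sqr (h : 'rV[R]_n -> R) : continuous h -> continuous (fun x : 'rV[R]_n => h x ^+ 2).
Proof. by move=> ch x; apply: (@continuous_comp _ _ _ h (fun y : R => y ^+ 2)); [exact: ch | exact: exprn_continuous]. Qed.

Let vol := fine (leb W).

Let leb_vol : leb W = vol%:E.
Proof. by rewrite leb_fin//; exact: leb_bounded_lty. Qed.

(** The Dirichlet part yields the gain through [deriv_lift_away_le]; the reaction part changes by at
    most C times the excess of the squares, itself at most 4 e^2, integrated over W. *)
Lemma bulk_form_lift_away (e : R) (phi : 'rV[R]_n -> R) : 0 < e -> Ck 1 phi ->
  bulk_form (lift_away e \o phi) + d * e ^+ 2 * dirichlet_int (log_size e \o phi) <=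
  bulk_form phi + 4 * e ^+ 2 * C * vol.
Proof.
have aux (k l m a b q : R) : k + l <= m -> a - b <= q -> (k - b) + l <= m - a + q by lra.
move=> e0 C1phi; have mW := open_leb_measurable oW.
have C1F := C1_comp (is_derive_lift_away e0) (continuous_deriv_lift_away e0) C1phi.
have C1w := C1_comp (is_derive_log_size e0) (continuous_deriv_log_size e0) C1phi.
set F := _ \o _ in C1F *; set w := _ \o _ in C1w *.
have IF := open_bounded_integrable (continuous_grad_sqr C1F).
have Iw := open_bounded_integrable (continuous_grad_sqr C1w).
have Ip := open_bounded_integrable (continuous_grad_sqr C1phi).
have Iew : leb.-integrable W (EFin \o (fun x => e ^+ 2 * dot (grad w x) (grad w x))).
  by apply: open_bounded_integrable => x; apply: (@continuousM _ _ (cst (e ^+ 2)) (fun x : 'rV[R]_n => dot (grad w x) (grad w x))); [exact: cst_continuous | exact: continuous_grad_sqr].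
have D : dirichlet_int F + e ^+ 2 * dirichlet_int w <= dirichlet_int phi.
  rewrite -lerBrDr /dirichlet_int -(RintegralZl _ mW Iw) -(RintegralB mW Ip Iew).
  apply: le_Rintegral => //; first exact: (integrableB mW Ip Iew).
  move=> x Wx; rewrite (grad_comp (is_derive_lift_away e0) C1phi) (grad_comp (is_derive_log_size e0) C1phi).
  have dZ (s : R) (a : 'rV[R]_n) : dot (s *: a) (s *: a) = s ^+ 2 * dot a a.
    by rewrite /dot mulr_sumr; apply: eq_bigr => i _; rewrite !mxE; ring.
  rewrite !dZ mulrA -[X in _ <= X - _]mul1r -mulrBl.
  by apply: ler_wpM2r; [exact: dot_ge0 | exact: deriv_lift_away_le].
have cphi := C1_continuous C1phi; have cF := C1_continuous C1F.
have IcF := bounded_mul_integrable (continuous_sqr cF).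
have Icp := bounded_mul_integrable (continuous_sqr cphi).
have Icst : leb.-integrable W (EFin \o (fun=> 4 * e ^+ 2 * C)).
  by apply: open_bounded_integrable; exact: cst_continuous.
have B : (\int[leb]_(x in W) (c x * phi x ^+ 2) - \int[leb]_(x in W) (c x * F x ^+ 2) <= 4 * e ^+ 2 * C * vol)%R.
  rewrite -(RintegralB mW Icp IcF) -(Rintegral_cst leb mW).
  apply: le_Rintegral => //; first exact: (integrableB mW Icp IcF).
  move=> x Wx; rewrite -mulrBr; apply: le_trans (ler_norm _) _; rewrite normrM mulrC.
  have /andP[] := sqr_lift_away e0 (phi x); rewrite -/(F x).
  move: (F x ^+ 2) (phi x ^+ 2) (e ^+ 2) => a b k l1 l2.
  apply: ler_pM => //; last exact: cC.
  by rewrite ler0_norm ?subr_le0// opprB lerBlDl.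
apply: (aux _ _ _ _ _ _ _ B); rewrite -mulrA -mulrDr.
exact: (ler_wpM2l (ltW d_gt0) D).
Qed.

End reaction_form.

Section boundary_integrals.
Context {R : realType} {n : nat}.
Variable mu : {outer_measure set 'rV[R]_n -> \bar R}.
Hypothesis mH : forall i c, mu.-cara.-measurable (halfspace i c).
Local Notation mus := (cara_measure mu).
Variable A : set (caratheodory_type mu).
Hypotheses (mA : measurable A) (A_fin : (mus A < +oo)%E) (bA : bounded_set (A : set 'rV[R]_n)).

Lemma cara_continuous_integrable (h : 'rV[R]_n -> R) : continuous h -> mus.-integrable A (EFin \o h).
Proof.
move=> ch; apply: measurable_bounded_integrable => //.
- exact: (cara_measurable_fun_continuous mH).
- have [M M0 hM] := continuous_bounded_on ch bA.
  by exists M; split; [exact: num_real | move=> x Mx y Ay; exact: le_trans (hM _ Ay) (ltW Mx)].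
Qed.

Lemma cara_superlevel_le (h : 'rV[R]_n -> R) (e : R) : continuous h -> 0 < e ->
  (mus (A `&` [set x | (e < `|h x|)%R]) <= ((\int[mus]_(x in A) (h x ^+ 2))%R / e ^+ 2)%:E)%E.
Proof.
move=> ch e0; have e20 : 0 < e ^+ 2 by rewrite exprn_gt0.
have I := cara_continuous_integrable (continuous_sqr ch).
have := le_integral_abse mus mA (measurable_int _ I) e20.
have -> : (\int[mus]_(x in A) `|(EFin \o (fun x => h x ^+ 2)%R) x| = (\int[mus]_(x in A) (h x ^+ 2))%:E)%E.
  rewrite /Rintegral fineK; last exact: (integrable_fin_num mA I).
  by apply: eq_integral => x _ /=; rewrite ger0_norm// sqr_ge0.
move=> H.
apply: lee_pdivlE => //.
apply: le_trans H; apply: lee_wpmul2l; first by rewrite lee_fin ltW.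
apply: le_outer_measure => x [Ax /= Lx]; split=> //=.
rewrite lee_fin ger0_norm ?sqr_ge0// -(real_normK (num_real (h x))).
by rewrite lerXn2r ?nnegrE// ltW.
Qed.

Lemma cara_integral_sqr_ge0 (h : 'rV[R]_n -> R) : 0 <= (\int[mus]_(x in A) (h x ^+ 2))%R.
Proof. by apply: Rintegral_ge0 => x _; exact: sqr_ge0. Qed.

End boundary_integrals.

(** * Entering the domain from its boundary *)

Section exit_estimate.
Context {R : realType} {n : nat}.
Local Notation lebT := (caratheodory_type (@lebesgue_outer R n.+1)).
Local Notation leb := (@leb R n.+1).
Variables (W U E : set 'rV[R]_n.+1) (e : 'rV[R]_n.+1).
Hypotheses (oW : open W) (UW : U `<=` W) (Uexit : forall x, U x -> ~ W (x + e)).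

(** Each point of U leaves W along e. Unless it lies in the shadow of E or has line energy at least
    L, it leaves at a boundary point where |w| <= 1, and w changes by at most sqrt L on the way.
    Each exceptional set has measure at most a quarter of that of U. *)
Lemma exit_estimate (w : 'rV[R]_n.+1 -> R) (K L u : R) : Ck 1 w -> 0 < L ->
  (dirichlet w W <= K%:E)%E -> leb U = u%:E ->
  (forall x s, U x -> 0 <= s <= 1 -> bdry W (x + s *: e) -> ~ E (x + s *: e) ->
    `|w (x + s *: e)| <= 1) ->
  (leb (sweep e E) <= (u / 4)%:E)%E -> dot e e * K / L <= u / 4 ->
  ((u / 2)%:E <= leb (U `&` [set x | (`|w x| <= 1 + Num.sqrt L)%R]))%E.
Proof.
have aux : u / 2 <= u - (u / 4 + u / 4) by lra.
move=> C1w L0 wK Uu wE sweepE KL.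
have mJ := measurable_line_energy C1w oW e.
pose J : set lebT := [set x | (L%:E <= `|line_energy w W e x|)%E].
have JL : (leb J <= (u / 4)%:E)%E.
  have := le_integral_abse leb measurableT mJ L0; rewrite setTI -/J => H.
  have H2 : (L%:E * leb J <= (dot e e * K)%:E)%E.
    apply: (le_trans H); rewrite (@eq_integral _ _ _ leb setT (line_energy w W e)).
      apply: le_trans (integral_line_energy_le C1w oW e) _.
      by rewrite EFinM; apply: lee_wpmul2l => //; rewrite lee_fin dot_ge0.
    by move=> x _; rewrite gee0_abs// line_energy_ge0.
  by apply: (le_trans (lee_pdivlE L0 H2)).
have : (leb U <= leb (U `&` [set x | (`|w x| <= 1 + Num.sqrt L)%R]) + (leb (sweep e E) + leb J))%E.
  apply: (@le_trans _ _ (leb (U `&` [set x | (`|w x| <= 1 + Num.sqrt L)%R]) + leb (sweep e E `|` J))%E).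
    apply: le_trans (outer_measureU2 _ _ _); apply: le_outer_measure => x Ux.
    have [Jx|nJx] := pselect (J x); first by right; right.
    have [Sx|nSx] := pselect (sweep e E x); first by right; left.
    left; split=> //=.
    have [t [t01 bt Wt]] := exit_point oW (UW Ux) (Uexit Ux).
    have wt : `|w (x + t *: e)| <= 1.
      by apply: wE => // Et; apply: nSx; exists t.
    have := sqr_increment_le_line_energy C1w oW t01 Wt.
    have Jlt : (line_energy w W e x < L%:E)%E.
      by rewrite ltNge; apply/negP => LJ; apply: nJx; rewrite /J /= gee0_abs// line_energy_ge0.
    move=> /le_lt_trans /(_ Jlt); rewrite lte_fin => sq.
    have : `|w (x + t *: e) - w x| <= Num.sqrt L.
      rewrite -sqrtr_sqr; apply: ler_wsqrtr; exact: ltW.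
    move=> H; have := ler_normB (w (x + t *: e)) (w (x + t *: e) - w x); rewrite subKr.
    by move=> /le_trans; apply; exact: lerD.
  apply: leeD => //; exact: outer_measureU2.
move=> /le_trans /(_ (leeD (lexx _) (leeD sweepE JL))).
rewrite Uu -EFinD -leeBlDr// -EFinB; apply: le_trans; rewrite lee_fin.
exact: aux.
Qed.

End exit_estimate.

Section key_inequality.
Context {R : realType} {n : nat}.
Local Notation V := 'rV[R]_n.+1.
Local Notation lebT := (caratheodory_type (@lebesgue_outer R n.+1)).
Local Notation leb := (@leb R n.+1).
Local Notation surf := (cara_measure (@hausdorff_outer R n.+1 n)).
Variable W : set V.
Hypotheses (oW : open W) (bW : bounded_set W) (cW : connected W) (sW : smooth_boundary W)
  (W_gt0 : (0 < leb W)%E).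
Variables (c : V -> R) (C d : R).
Hypotheses (mc : measurable_fun (W : set lebT) c) (cC : forall x, W x -> `|c x| <= C) (d_gt0 : 0 < d).
Hypothesis form_ge0 : forall psi, Ck 1 psi -> (\int[leb]_(x in W) (psi x ^+ 2))%R != 0 ->
  0 <= bulk_form W c d psi.

Let vol := fine (leb W).
Let mW := open_leb_measurable oW.

Let leb_vol : leb W = vol%:E.
Proof. by rewrite leb_fin//; exact: leb_bounded_lty. Qed.

Let vol_gt0 : 0 < vol.
Proof. by rewrite -lte_fin -leb_vol. Qed.

Let C_ge0 : 0 <= C.
Proof.
have [x Wx] : W !=set0.
  by apply/set0P/eqP => W0; move: W_gt0; rewrite W0 measure0 ltxx.
exact: le_trans (cC Wx).
Qed.

Lemma dirichlet_bulk_form_le phi : Ck 1 phi -> (\int[leb]_(x in W) (phi x ^+ 2))%R = 1 ->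
  d * dirichlet_int W phi <= bulk_form W c d phi + C.
Proof.
have aux (a b k : R) : b <= k -> a <= a - b + k by lra.
move=> C1phi phi1; apply: aux.
have cphi2 := continuous_sqr (C1_continuous C1phi).
have I := open_bounded_integrable oW bW cphi2.
rewrite -[leRHS]mulr1 -phi1 -(RintegralZl _ mW I).
apply: le_Rintegral => //; first exact: (bounded_mul_integrable oW bW mc cC cphi2).
  by apply: open_bounded_integrable => // x; apply: (@continuousM _ _ (cst C) (fun x : V => phi x ^+ 2)); [exact: cst_continuous | exact: cphi2].
move=> x Wx; apply: ler_wpM2r; first exact: sqr_ge0.
exact: le_trans (ler_norm _) (cC Wx).
Qed.

(** Nonnegativity of the form at [lift_away e \o phi] leaves d e^2 times the Dirichlet integral
    below e^2 + 4 e^2 C vol. The factor e^2 cancels, so the bound is the same for all e. *)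
Lemma dirichlet_log_size_le (e : R) phi : 0 < e -> Ck 1 phi -> bulk_form W c d phi <= e ^+ 2 ->
  (dirichlet (log_size e \o phi) W <= ((1 + 4 * C * vol) / d)%:E)%E.
Proof.
have aux (a b x y : R) : a + x <= b + y -> 0 <= a -> x <= b + y by lra.
have aux2 (a b x : R) : a * (x * b) = b * a * x by ring.
move=> e0 C1phi phie.
have C1F := C1_comp (is_derive_lift_away e0) (continuous_deriv_lift_away e0) C1phi.
have C1w := C1_comp (is_derive_log_size e0) (continuous_deriv_log_size e0) C1phi.
have F0 : (\int[leb]_(x in W) ((lift_away e \o phi) x ^+ 2))%R != 0.
  apply: lt0r_neq0; apply: (@lt_le_trans _ _ (\int[leb]_(x in W) (e ^+ 2))%R).
    by rewrite Rintegral_cst// mulr_gt0 ?exprn_gt0.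
  apply: le_Rintegral => //.
  - by apply: open_bounded_integrable => //; exact: cst_continuous.
  - by apply: open_bounded_integrable => //; apply: continuous_sqr; exact: C1_continuous.
  - by move=> x Wx; exact: sqr_lift_away_ge.
have := bulk_form_lift_away oW bW mc cC d_gt0 e0 C1phi.
move=> /aux /(_ (form_ge0 C1F F0)) H.
rewrite dirichletE// lee_fin ler_pdivlMr// -(ler_pM2l (exprn_gt0 2 e0)).
rewrite aux2; apply: (le_trans H).
have -> : 4 * e ^+ 2 * C * fine (leb W) = e ^+ 2 * (4 * C * vol) by rewrite -/vol; ring.
by rewrite mulrDr mulr1 lerD2r.
Qed.

(* If the right-hand side were tiny, log_size \o phi would have a bounded Dirichlet
   integral and, entering W from the part of bdry W near p where phi is small, be
   bounded on half of a ball; then phi would be small off a set of small measure,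
   contradicting its normalization. *)
Lemma key_inequality p (delta : R) : bdry W p -> 0 < delta -> exists2 q : R, 0 < q &
  forall phi, Ck 1 phi -> (\int[leb]_(x in W) (phi x ^+ 2))%R = 1 ->
  q <= bulk_form W c d phi + (\int[surf]_(x in bdry W `&` ball p delta) (phi x ^+ 2))%R.
Proof.
move=> bp d0.
have aux1 (a b q : R) : a + b < q -> 0 <= a -> 0 <= b -> a <= q /\ b <= q by move=> *; split; lra.
have aux2 (D' b q : R) : d * D' <= b + C -> b <= q -> q <= 1 -> d * D' <= 1 + C by lra.
have aux3 (a : R) : 0 <= a -> a < 2 * (a + 1) by lra.
have [U0 [ev [oU0 [z U0z] U0W Uexit Unear]]] := exit_configuration sW bp d0.
have /nbhs_ballP[r3 /= r30 zr3] : nbhs z U0 by exact: open_nbhs_nbhs.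
pose r := r3 / 3.
have r0 : 0 < r by rewrite divr_gt0.
have r3E : 3 * r = r3 by rewrite /r mulrC divfK// pnatr_eq0.
pose U : set V := ball z r.
have UU0 : U `<=` U0.
  apply: subset_trans zr3; apply: le_ball.
  by rewrite -r3E -[X in X <= _]mul1r ler_pM2r// ler1n.
have zW : ball z (3 * r) `<=` W by rewrite r3E; exact: subset_trans U0W.
have oU : open U by exact: ball_open.
have U_pos : (0 < leb U)%E.
  by apply: (leb_open_gt0 W_gt0 oU); exists z; exact: ballxx.
pose u := fine (leb U).
have Uu : leb U = u%:E by rewrite leb_fin//; exact: leb_ball_fin.
have u0 : 0 < u by rewrite -lte_fin -Uu.
have [Csw Csw0 Hsw] := @lebesgue_outer_sweep_le R n ev.
pose K1 := (1 + 4 * C * vol) / d.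
have K10 : 0 <= K1.
  by rewrite divr_ge0 ?(ltW d_gt0)// addr_ge0// mulr_ge0 ?(ltW vol_gt0)// mulr_ge0.
pose de := dot ev ev.
have de0 : 0 <= de by exact: dot_ge0.
pose L1 := 4 * (de * K1) / u + 1.
have L10 : 0 < L1 by rewrite ltr_wpDl// divr_ge0 ?(ltW u0)// mulr_ge0// mulr_ge0.
have deL1 : de * K1 / L1 <= u / 4.
  rewrite ler_pdivrMr// /L1 mulrDr mulr1 [u / 4 * _](_ : _ = de * K1).
    by rewrite lerDl divr_ge0// ltW.
  by field; rewrite gt_eqF.
have m00 : 0 < u / 2 by rewrite divr_gt0.
have Htail := @uniform_tail R n.+1 W oW bW cW W_gt0 z r K1 (1 + Num.sqrt L1) (u / 2) r0 m00 zW.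
have [A A0 HA] := equi_integrability oW bW sW W_gt0.
pose K2 := (1 + C) / d.
have K20 : 0 < K2 by rewrite divr_gt0// ltr_pwDl.
have A40 : 0 < 4 * (A + 1) by rewrite mulr_gt0// ltr_wpDl.
(* R0 here and e1 below make the terms A e1^2 and A R0^2 K2 both equal to A / (4 (A + 1)): together
   they remain below 1, the square integral of phi. *)
pose R0 := Num.sqrt (4 * (A + 1) * K2)^-1.
have R00 : 0 < R0 by rewrite sqrtr_gt0 invr_gt0 mulr_gt0.
have [eta eta0 Heta] := HA R0 R00.
have [L L0 HL] := Htail eta eta0.
pose e1 := Num.sqrt (4 * (A + 1))^-1.
have e10 : 0 < e1 by rewrite sqrtr_gt0 invr_gt0.
(* L depends on K1, which does not involve e, so e may be chosen after it. Then [log_size e] at most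
   L means |phi| <= e exp(L) = e1. *)
pose e := e1 / expR L.
have e0 : 0 < e by rewrite divr_gt0// expR_gt0.
have e20 : 0 < e ^+ 2 by rewrite exprn_gt0.
have eL : e * expR L = e1 by rewrite divfK// gt_eqF// expR_gt0.
(* The three bounds give, in turn, the Dirichlet bound K2 for phi, the bound K1 for its logarithm,
   and, by Chebyshev's inequality on the boundary, a shadow of measure at most u/4 for the part
   where |phi| > e. *)
pose q := Num.min 1 (Num.min (e ^+ 2) (e ^+ 2 * (u / 4) / Csw)).
have q0 : 0 < q.
  rewrite /q !lt_min ltr01 e20 /= divr_gt0//; apply: mulr_gt0 => //.
  by rewrite divr_gt0.
have q1 : q <= 1 by rewrite ge_min lexx.
have q2 : q <= e ^+ 2 by rewrite !ge_min lexx orbT.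
have q3 : q <= e ^+ 2 * (u / 4) / Csw by rewrite !ge_min lexx !orbT.
exists q => // phi C1phi phi1; rewrite leNgt; apply/negP.
have bf0 : 0 <= bulk_form W c d phi by apply: form_ge0 => //; rewrite phi1 oner_neq0.
set S := (\int[surf]_(x in _) _)%R.
have S0 : 0 <= S by exact: cara_integral_sqr_ge0.
move=> /aux1 /(_ bf0 S0)[bq Sq].
have cphi := C1_continuous C1phi.
have phiK2 : (dirichlet phi W <= K2%:E)%E.
  rewrite dirichletE// lee_fin ler_pdivlMr// mulrC.
  by apply: aux2 bq q1; exact: dirichlet_bulk_form_le.
pose w := log_size e \o phi.
have C1w : Ck 1 w := C1_comp (is_derive_log_size e0) (continuous_deriv_log_size e0) C1phi.
have wK1 : (dirichlet w W <= K1%:E)%E.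
  by apply: dirichlet_log_size_le => //; exact: le_trans bq q2.
pose B := bdry W `&` ball p delta.
have mB : measurable (B : set (caratheodory_type (@hausdorff_outer R n.+1 n))).
  apply: measurableI; first exact: (bdry_cara_measurable measurable_halfspace_hausdorff).
  by apply: (open_cara_measurable measurable_halfspace_hausdorff); exact: ball_open.
have B_fin : (surf B < +oo)%E.
  apply: le_lt_trans (hausdorff_bdry_lty bW sW); apply: le_outer_measure; exact: subIsetl.
have bB : bounded_set B.
  have [M [Mr HM]] := bounded_closure bW.
  by exists M; split=> // x Mx y [[cy _] _]; apply: HM.
have surfE := cara_superlevel_le measurable_halfspace_hausdorff mB B_fin bB cphi e0.
rewrite -/S in surfE.
pose E := B `&` [set x | e < `|phi x|].
have sweepE : (leb (sweep ev E) <= (u / 4)%:E)%E.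
  apply: le_trans (Hsw E) _.
  have : (Csw%:E * hausdorff_outer n E <= Csw%:E * (S / e ^+ 2)%:E)%E.
    by apply: lee_wpmul2l => //; rewrite lee_fin ltW.
  move=> /le_trans; apply; rewrite -EFinM lee_fin.
  rewrite mulrA ler_pdivrMr// -ler_pdivlMl// mulrC [u / 4 * _]mulrC.
  exact: le_trans Sq q3.
have wlow : ((u / 2)%:E <= leb (U `&` [set x | (`|w x| <= 1 + Num.sqrt L1)%R]))%E.
  have UW : U `<=` W by exact: subset_trans U0W.
  have UE x : U x -> ~ W (x + ev) by move=> /UU0; exact: Uexit.
  apply: (exit_estimate oW UW UE C1w L10 wK1 Uu _ sweepE deL1).
  move=> x s Ux s01 bs nE; rewrite ger0_norm ?log_size_ge0//; apply: log_size_le1 => //.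
  rewrite leNgt; apply/negP => phis; apply: nE; split=> //; split=> //.
  by rewrite rV_ballE; apply: Unear => //; exact: UU0.
have small : (leb (W `&` [set x | (e1 < `|phi x|)%R]) <= eta%:E)%E.
  apply: le_trans (HL w _); last by split.
  apply: le_outer_measure => x [Wx phix]; split=> //=.
  rewrite ltNge; apply/negP; rewrite ger0_norm ?log_size_ge0// => /(log_size_leP e0).
  by rewrite eL leNgt phix.
have := Heta phi e1 K2 C1phi (ltW e10) phiK2 small.
have -> : (\int[leb]_(x in W) ((phi x) ^+ 2)%:E = 1)%E.
  rewrite -[1%E]/(1%R%:E) -phi1 /Rintegral fineK//.
  exact: (integrable_fin_num mW (open_bounded_integrable oW bW (continuous_sqr cphi))).
rewrite lee_fin /e1 /R0 !sqr_sqrtr ?invr_ge0 ?(ltW A40)//; last by rewrite mulr_ge0 ?(ltW A40) ?(ltW K20).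
have -> : A * ((4 * (A + 1))^-1 + (4 * (A + 1) * K2)^-1 * K2) = A / (2 * (A + 1)).
  by field; rewrite !gt_eqF// ltr_wpDl.
rewrite ler_pdivlMr ?mulr_gt0 ?ltr_wpDl// mul1r leNgt => /negP; apply.
exact: aux3.
Qed.

End key_inequality.

(** * Passage to H^1 *)

Section L2_limits.
Context {R : realType} {T : pointedType} (mu : {outer_measure set T -> \bar R}).
Local Notation muT := (caratheodory_type mu).
Local Notation mus := (cara_measure mu).
Variable A : set T.
Hypothesis mA : measurable (A : set muT).
Implicit Types (h b : T -> R).

Lemma L2_sqr_integrable h : L2 mu A h -> mus.-integrable A (EFin \o (fun x => h x ^+ 2)).
Proof.
move=> [mh hfin]; apply/integrableP; split.
  by apply/measurable_EFinP; exact: measurable_funX.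
apply: le_lt_trans hfin; rewrite /sqint le_eqVlt; apply/orP; left; apply/eqP.
by apply: eq_integral => x _ /=; rewrite ger0_norm// sqr_ge0.
Qed.

Lemma sqintE h : mus.-integrable A (EFin \o (fun x => h x ^+ 2)) ->
  sqint mu A h = (integ mu A (fun x => h x ^+ 2))%:E.
Proof. by move=> I; rewrite /sqint /integ /Rintegral fineK//; exact: (integrable_fin_num mA I). Qed.

Lemma L2_sub_sqr_integrable h (k : T -> R) : L2 mu A h -> L2 mu A k ->
  mus.-integrable A (EFin \o (fun x => (h x - k x) ^+ 2)).
Proof.
have aux (a b : R) : (a - b) ^+ 2 <= 2 * a ^+ 2 + 2 * b ^+ 2.
  by rewrite -subr_ge0 (_ : _ - _ = (a + b) ^+ 2) ?sqr_ge0//; ring.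
move=> Lh Lk; have Ih := L2_sqr_integrable Lh; have Ik := L2_sqr_integrable Lk.
apply: (@le_integrable _ muT R mus A mA _ (EFin \o (fun x => 2 * h x ^+ 2 + 2 * k x ^+ 2))).
- by apply/measurable_EFinP; apply: measurable_funX; apply: measurable_funB; [case: Lh | case: Lk].
- move=> x Ax /=; rewrite lee_fin ger0_norm ?sqr_ge0// ger0_norm; first exact: aux.
  by rewrite addr_ge0// mulr_ge0// sqr_ge0.
exact: (integrableD mA (integrableZl mA 2 Ih) (integrableZl mA 2 Ik)).
Qed.

Lemma L2_mul_integrable b (C : R) h : measurable_fun (A : set muT) b ->
  (forall x, A x -> `|b x| <= C) -> L2 mu A h ->
  mus.-integrable A (EFin \o (fun x => b x * h x ^+ 2)).
Proof.
move=> mb bC Lh; apply: (@integrableMr _ muT R mus A mA b (EFin \o (fun x => h x ^+ 2)) mb).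
  by exists C; split; [exact: num_real|move=> M CM x /bC /le_trans; apply; exact: ltW].
exact: L2_sqr_integrable.
Qed.

(** Integrates |x^2 - y^2| <= (1 + 1/t)(x - y)^2 + t y^2, a weighted Young inequality. For
    convergence, t is fixed small before the first integral is made small. *)
Lemma integ_sqr_dist_le b (C t : R) h (k : T -> R) : measurable_fun (A : set muT) b ->
  (forall x, A x -> `|b x| <= C) -> 0 <= C -> 0 < t -> L2 mu A h -> L2 mu A k ->
  `|integ mu A (fun x => b x * h x ^+ 2) - integ mu A (fun x => b x * k x ^+ 2)| <=
  C * ((1 + t^-1) * integ mu A (fun x => (h x - k x) ^+ 2) + t * integ mu A (fun x => k x ^+ 2)).
Proof.
have aux (x y : R) : 0 < t -> `|x ^+ 2 - y ^+ 2| <= (1 + t^-1) * (x - y) ^+ 2 + t * y ^+ 2.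
  move=> t0; rewrite ler_norml; apply/andP; split.
    rewrite -subr_ge0 (_ : _ - _ = 2 * (x - y) ^+ 2 + ((x - y) / t + y) ^+ 2 * t); last by field; rewrite gt_eqF.
    by rewrite addr_ge0// mulr_ge0 ?sqr_ge0// ltW.
  rewrite -subr_ge0 (_ : _ - _ = ((x - y) / t - y) ^+ 2 * t); last by field; rewrite gt_eqF.
  by rewrite mulr_ge0 ?sqr_ge0// ltW.
move=> mb bC C0 t0 Lh Lk.
have Ih := L2_mul_integrable mb bC Lh; have Ik := L2_mul_integrable mb bC Lk.
have Id := L2_sub_sqr_integrable Lh Lk; have Ik2 := L2_sqr_integrable Lk.
have I1 := integrableZl mA (1 + t^-1) Id; have I2 := integrableZl mA t Ik2.
have I3 := integrableD mA I1 I2; have I4 := integrableZl mA C I3.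
rewrite /integ -(RintegralB mA Ih Ik).
apply: le_trans (le_normr_Rintegral mA (integrableB mA Ih Ik)) _.
rewrite -(RintegralZl _ mA Id) -(RintegralZl _ mA Ik2) -(RintegralD mA I1 I2) -(RintegralZl _ mA I3).
apply: (@le_Rintegral _ muT R mus A) => //.
  exact: (integrable_norm (integrableB mA Ih Ik)).
by move=> x Ax; rewrite -mulrBr normrM; apply: ler_pM => //; [exact: bC | exact: aux].
Qed.

Lemma cvg_integ_sqr b (C : R) (h_ : nat -> T -> R) h : measurable_fun (A : set muT) b ->
  (forall x, A x -> `|b x| <= C) -> (forall k, L2 mu A (h_ k)) -> L2 mu A h ->
  L2_cvg mu A h_ h ->
  integ mu A (fun x => b x * h_ k x ^+ 2) @[k --> \oo] --> integ mu A (fun x => b x * h x ^+ 2).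
Proof.
have aux (c H e : R) : 0 < c -> 0 <= H -> 0 < e -> exists2 t, 0 < t & exists2 s, 0 < s &
    forall y, y <= s -> c * ((1 + t^-1) * y + t * H) <= e.
  move=> c0 H0 e0; pose t := e / (2 * c * (H + 1)).
  have t0 : 0 < t by rewrite divr_gt0// mulr_gt0 ?mulr_gt0// ltr_wpDl.
  have r0 : 0 < c * (1 + t^-1) by rewrite mulr_gt0// ltr_wpDr// invr_ge0 ltW.
  exists t => //; exists (e / 2 / (c * (1 + t^-1))); first by rewrite !divr_gt0.
  move=> y; rewrite ler_pdivlMr// mulrC => ys.
  have : c * (t * H) <= e / 2.
    rewrite (_ : c * (t * H) = e / 2 * (H / (H + 1))); last first.
      by rewrite /t; field; rewrite !gt_eqF// ltr_wpDl.
    by rewrite ler_piMr ?divr_ge0 ?(ltW e0)// ler_pdivrMr ?mul1r ?ltr_wpDl// lerDl.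
  by rewrite mulrDr mulrA; lra.
move=> mb bC Lk Lh cv; apply/cvgrPdist_le => e e0.
pose C1 := `|C| + 1; have C10 : 0 < C1 by rewrite ltr_wpDl.
have bC1 x : A x -> `|b x| <= C1.
  by move=> /bC /le_trans; apply; rewrite /C1 (le_trans (ler_norm _))// lerDl.
have H0 : 0 <= integ mu A (fun x => h x ^+ 2) by apply: Rintegral_ge0 => x _; exact: sqr_ge0.
have [t t0 [s s0 ts]] := aux _ _ _ C10 H0 e0.
have : \forall k \near \oo, (sqint mu A (h_ k \- h)%R < s%:E)%E.
  have s0' : (0%R < s%:E)%E by rewrite lte_fin.
  apply: (cv [set x | (x < s%:E)%E]).
  by apply: open_nbhs_nbhs; split=> //; exact: open_ereal_lt_ereal.
apply: filterS => k; rewrite sqintE; last exact: L2_sub_sqr_integrable.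
rewrite lte_fin => /ltW ks; rewrite distrC.
by apply: le_trans (integ_sqr_dist_le mb bC1 (ltW C10) t0 (Lk k) Lh) (ts _ ks).
Qed.

Lemma cvg_integ_sqr1 (h_ : nat -> T -> R) h : (forall k, L2 mu A (h_ k)) -> L2 mu A h ->
  L2_cvg mu A h_ h ->
  integ mu A (fun x => h_ k x ^+ 2) @[k --> \oo] --> integ mu A (fun x => h x ^+ 2).
Proof.
move=> Lk Lh cv; have := @cvg_integ_sqr (fun=> 1) 1 h_ h (measurable_cst _).
have E u : (fun x : T => 1 * u x ^+ 2) = (fun x => u x ^+ 2) :> (T -> R).
  by apply/funext => x; rewrite mul1r.
under eq_cvg do rewrite E; rewrite E; apply => //.
by move=> x _; rewrite normr1.
Qed.

Lemma integ_sum (I : Type) (r : seq I) (F : I -> T -> R) :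
  (forall i, mus.-integrable A (EFin \o F i)) ->
  integ mu A (fun x => \sum_(i <- r) F i x) = \sum_(i <- r) integ mu A (F i).
Proof.
move=> IF; suff [] : mus.-integrable A (EFin \o (fun x => \sum_(i <- r) F i x)) /\
    integ mu A (fun x => \sum_(i <- r) F i x) = \sum_(i <- r) integ mu A (F i) by [].
elim: r => [|i r [Ir E]].
  have E0 : (fun x : T => \sum_(i <- [::]) F i x) = (fun=> 0).
    by apply/funext => x; rewrite big_nil.
  rewrite E0 big_nil; split; first exact: (@integrable0 _ muT R mus A).
  by rewrite /integ (Rintegral_cst mus mA) mul0r.
have E1 : (fun x : T => \sum_(j <- i :: r) F j x) = (fun x => F i x + \sum_(j <- r) F j x).
  by apply/funext => x; rewrite big_cons.
rewrite E1 big_cons -E; split; first exact: (integrableD mA (IF i) Ir).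
by rewrite /integ (RintegralD mA (IF i) Ir).
Qed.

Lemma integ_dot (m : nat) (G : T -> 'rV[R]_m) : (forall i, L2 mu A (fun x => G x 0 i)) ->
  integ mu A (fun x => dot (G x) (G x)) = \sum_(i < m) integ mu A (fun x => G x 0 i ^+ 2).
Proof.
move=> LG; rewrite -(integ_sum _ (fun i => L2_sqr_integrable (LG i))).
by congr integ; apply/funext => x; apply: eq_bigr => i _; rewrite expr2.
Qed.

End L2_limits.

Section key_inequality_H1.
Context {R : realType} {n : nat}.
Local Notation lebT := (caratheodory_type (@lebesgue_outer R n.+1)).
Local Notation leb := (@leb R n.+1).
Local Notation Leb := (@lebesgue_outer R n.+1).
Local Notation Surf := (@hausdorff_outer R n.+1 n).
Local Notation surf := (cara_measure Surf).
Variable W : set 'rV[R]_n.+1.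
Hypotheses (oW : open W) (bW : bounded_set W) (cW : connected W) (sW : smooth_boundary W)
  (W_gt0 : (0 < leb W)%E).
Variables (c : 'rV[R]_n.+1 -> R) (C d : R).
Hypotheses (mc : measurable_fun (W : set lebT) c) (cC : forall x, W x -> `|c x| <= C) (d_gt0 : 0 < d).
Hypothesis form_ge0 : forall psi, Ck 1 psi -> (\int[leb]_(x in W) (psi x ^+ 2))%R != 0 ->
  0 <= bulk_form W c d psi.

Let mW := open_leb_measurable oW.
Let mbW : measurable (bdry W : set (caratheodory_type Surf)) :=
  bdry_cara_measurable measurable_halfspace_hausdorff W.

Lemma bounded_bdry : bounded_set (bdry W).
Proof.
by have [M [Mr HM]] := bounded_closure bW; exists M; split=> // x Mx y [cy _]; apply: HM.
Qed.

Lemma continuous_L2_surf (h : 'rV[R]_n.+1 -> R) : continuous h -> L2 Surf (bdry W) h.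
Proof.
move=> ch; split; first exact: (cara_measurable_fun_continuous measurable_halfspace_hausdorff).
have I := cara_continuous_integrable measurable_halfspace_hausdorff mbW (hausdorff_bdry_lty bW sW)
  bounded_bdry (continuous_sqr ch).
by rewrite sqintE// ltry.
Qed.

(** Scaling removes the normalization, which the functions approximating an H^1 function do not
    satisfy. *)
Lemma key_inequality_homogeneous p (delta : R) : bdry W p -> 0 < delta -> exists2 q : R, 0 < q &
  forall phi, Ck 1 phi -> q * (\int[leb]_(x in W) (phi x ^+ 2))%R <=
    bulk_form W c d phi + (\int[surf]_(x in bdry W) (\1_(ball p delta) x * phi x ^+ 2))%R.
Proof.
have aux (a b s : R) : 0 < s -> 1 = s ^+ 2 * (s ^+ 2)^-1 -> b <= s ^+ 2 * a -> b * (s ^+ 2)^-1 <= a.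
  by move=> s0 _ H; rewrite ler_pdivrMr ?exprn_gt0// mulrC.
move=> bp d0; have [q q0 Hq] := key_inequality oW bW cW sW W_gt0 mc cC d_gt0 form_ge0 bp d0.
exists q => // phi C1phi.
have cphi := C1_continuous C1phi.
have I := open_bounded_integrable oW bW (continuous_sqr cphi).
have Ic := bounded_mul_integrable oW bW mc cC (continuous_sqr cphi).
have ID := open_bounded_integrable oW bW (continuous_grad_sqr C1phi).
have E1 (psi : 'rV[R]_n.+1 -> R) : (\int[surf]_(x in bdry W `&` ball p delta) (psi x ^+ 2) =
    \int[surf]_(x in bdry W) (\1_(ball p delta) x * psi x ^+ 2))%R.
  rewrite Rintegral_mkcondr; apply: eq_Rintegral => x _.
  rewrite patchE indicE; case: ifPn => _; first by rewrite mul1r.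
  by rewrite mul0r.
have S0 : 0 <= (\int[surf]_(x in bdry W) (\1_(ball p delta) x * phi x ^+ 2))%R.
  by apply: Rintegral_ge0 => x _; rewrite mulr_ge0 ?sqr_ge0.
have N0 : 0 <= (\int[leb]_(x in W) (phi x ^+ 2))%R by apply: Rintegral_ge0 => x _; exact: sqr_ge0.
have [Z|NZ] := eqVneq (\int[leb]_(x in W) (phi x ^+ 2))%R 0.
  rewrite Z mulr0 addr_ge0// /bulk_form subr_ge0.
  apply: (@le_trans _ _ 0); last first.
    rewrite mulr_ge0 ?(ltW d_gt0)//; apply: Rintegral_ge0 => x _; exact: dot_ge0.
  rewrite -(mulr0 C) -Z -(RintegralZl _ mW I).
  apply: le_Rintegral => //; first exact: (integrableZl mW C I).
  move=> x Wx; apply: ler_wpM2r; first exact: sqr_ge0.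
  exact: le_trans (ler_norm _) (cC Wx).
set N := (\int[leb]_(x in W) (phi x ^+ 2))%R in N0 NZ *.
have Npos : 0 < N by rewrite lt_neqAle eq_sym NZ.
pose s := Num.sqrt N^-1; have s2 : s ^+ 2 = N^-1 by rewrite sqr_sqrtr// invr_ge0.
have Ds (x : R) : is_derive x (1 : R) (fun t : R => s * t) s.
  have := is_derive_affine 0 s x; congr is_derive; apply/funext => t.
  by rewrite add0r mulrC.
have C1s : Ck 1 ((fun t : R => s * t) \o phi) by exact: (C1_comp Ds (@cst_continuous _ _ s) C1phi).
have sE x : ((fun t : R => s * t) \o phi) x ^+ 2 = s ^+ 2 * phi x ^+ 2 by rewrite /= exprMn.
have := Hq _ C1s; rewrite E1.
have -> : (\int[leb]_(x in W) (((fun t : R => s * t) \o phi) x ^+ 2) = s ^+ 2 * N)%R.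
  rewrite -(RintegralZl _ mW I); apply: eq_Rintegral => x _; exact: sE.
have -> : bulk_form W c d ((fun t : R => s * t) \o phi) = s ^+ 2 * bulk_form W c d phi.
  rewrite /bulk_form /dirichlet_int mulrBr mulrCA; congr (_ * _ - _).
    rewrite -(RintegralZl _ mW ID); apply: eq_Rintegral => x _.
    rewrite (grad_comp Ds C1phi) /dot mulr_sumr; apply: eq_bigr => i _.
    by rewrite !mxE expr2 mulrACA.
  rewrite -(RintegralZl _ mW Ic); apply: eq_Rintegral => x _.
  by rewrite sE mulrCA.
have I1 : surf.-integrable (bdry W) (EFin \o (fun x => \1_(ball p delta) x * phi x ^+ 2)).
  apply: (@L2_mul_integrable _ _ _ _ mbW _ 1).
  - apply: (@measurable_indic _ _ _ (bdry W : set (caratheodory_type Surf))).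
    apply: (open_cara_measurable measurable_halfspace_hausdorff); exact: ball_open.
  - by move=> x _; rewrite indicE normr_nat; case: (_ \in _).
  - exact: continuous_L2_surf.
have -> : (\int[surf]_(x in bdry W) (\1_(ball p delta) x * ((fun t : R => (s * t)%R) \o phi) x ^+ 2) =
    s ^+ 2 * \int[surf]_(x in bdry W) (\1_(ball p delta) x * phi x ^+ 2))%R.
  rewrite -(RintegralZl _ mbW I1); apply: eq_Rintegral => x _.
  by rewrite sE mulrCA.
rewrite s2 mulVf// => /(_ erefl).
by rewrite -mulrDr mulrC ler_pdivlMr.
Qed.

(** The smooth sequence provided by [trace_of] converges simultaneously in L^2(omega), with its
    gradient, and on the boundary, so each term of the inequality for smooth functions passes to the
    limit. *)
Lemma key_inequality_H1 p (delta : R) : bdry W p -> 0 < delta -> exists2 q : R, 0 < q &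
  forall V GV T, H1_bulk W V GV -> trace_of W V GV T ->
  q * int_bulk W (fun y => V y ^+ 2) <=
  d * int_bulk W (fun y => dot (GV y) (GV y)) - int_bulk W (fun y => c y * V y ^+ 2) +
  int_bdry W (fun y => \1_(ball p delta) y * T y ^+ 2).
Proof.
move=> bp d0; have [q q0 Hq] := key_inequality_homogeneous bp d0.
exists q => // V GV T [LV LG _] [LT [phi [sphi cV cG cT]]].
have cphi k : continuous (phi k) by apply: C1_continuous; exact: smoothC1.
have Lphi k : L2 Leb W (phi k) by exact: continuous_L2_leb.
have Lpart k i : L2 Leb W (partial (phi k) i).
  by apply: continuous_L2_leb => //; have [_ /(_ i)[]] := sphi k 1%N.
have Lsurf k : L2 Surf (bdry W) (phi k) by exact: continuous_L2_surf.
have l1 := cvg_integ_sqr1 mW Lphi LV cV.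
have l2 := cvg_integ_sqr mW mc cC Lphi LV cV.
have mb : measurable_fun (bdry W : set (caratheodory_type Surf)) (\1_(ball p delta) : _ -> R).
  apply: (@measurable_indic _ _ _ (bdry W : set (caratheodory_type Surf))).
  by apply: (open_cara_measurable measurable_halfspace_hausdorff); exact: ball_open.
have bb x : bdry W x -> `|\1_(ball p delta) x : R| <= 1.
  by move=> _; rewrite indicE normr_nat; case: (_ \in _).
have l3 := cvg_integ_sqr mbW mb bb Lsurf LT cT.
have l4 : dirichlet_int W (phi k) @[k --> \oo] --> int_bulk W (fun y => dot (GV y) (GV y)).
  rewrite /int_bulk (integ_dot mW LG).
  have E k : dirichlet_int W (phi k) = \sum_(i < n.+1) integ Leb W (fun x => partial (phi k) i x ^+ 2).
    rewrite -(integ_sum mW _ (fun i => L2_sqr_integrable (Lpart k i))).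
    apply: eq_Rintegral => x _; apply: eq_bigr => i _; by rewrite !mxE expr2.
  under eq_cvg do rewrite E.
  by apply: cvg_big => [|i _]; [exact: add_continuous | exact: (cvg_integ_sqr1 mW (Lpart^~ i) (LG i) (cG i))].
rewrite -subr_ge0.
have L : d * dirichlet_int W (phi k) - integ Leb W (fun y => c y * phi k y ^+ 2) +
    integ Surf (bdry W) (fun y => \1_(ball p delta) y * phi k y ^+ 2) -
    q * integ Leb W (fun y => phi k y ^+ 2) @[k --> \oo] -->
  d * int_bulk W (fun y => dot (GV y) (GV y)) - int_bulk W (fun y => c y * V y ^+ 2) +
  int_bdry W (fun y => \1_(ball p delta) y * T y ^+ 2) - q * int_bulk W (fun y => V y ^+ 2).
  apply: cvgB; last by apply: cvgM; [exact: cvg_cst | exact: l1].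
  apply: cvgD; last exact: l3.
  by apply: cvgB; [apply: cvgM; [exact: cvg_cst | exact: l4] | exact: l2].
apply: (cvgr_to_ge L); apply: nearW => k.
by rewrite subr_ge0; exact: Hq (smoothC1 (sphi k)).
Qed.

End key_inequality_H1.

(** * Regularity of the coefficients *)

Section coefficient_regularity.
Context {R : realType} {n : nat}.
Implicit Types (A B : set 'rV[R]_n) (h : 'rV[R]_n -> R -> R).

Lemma rV_continuous_at (u : 'rV[R]_n -> R) (y : 'rV[R]_n) :
  (forall e : R, 0 < e -> exists2 d : R, 0 < d & forall z, `|y - z| < d -> `|u y - u z| <= e) ->
  {for y, continuous u}.
Proof.
move=> H P /nbhs_ballP[e /= e0 eP]; have [d d0 Hd] := H (e / 2) (divr_gt0 e0 (@ltr0Sn R 1)).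
have : nbhs y (ball y d) by exact: nbhsx_ballx.
apply: filterS => z; rewrite rV_ballE => yz; apply: eP; rewrite /ball /=.
by apply: le_lt_trans (Hd z yz) _; rewrite ltr_pdivrMr// ltr_pMr// ltr1n.
Qed.

Lemma cvg_of_holder A (u : 'rV[R]_n -> R) (C r : R) : open A -> 0 < r ->
  (forall y z, A y -> A z -> `|u y - u z| <= C * `|y - z| `^ r) ->
  forall y, A y -> {for y, continuous u}.
Proof.
move=> oA r0 uC y Ay; apply: rV_continuous_at => e e0.
pose C1 := `|C| + 1; have C10 : 0 < C1 by rewrite ltr_wpDl.
pose s := (e / C1) `^ r^-1.
have s0 : 0 < s by rewrite powR_gt0// divr_gt0.
have sr : C1 * s `^ r = e.
  by rewrite /s -powRrM mulVf ?gt_eqF// powRr1 ?divr_ge0 ?ltW// mulrC divfK// gt_eqF.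
have /nbhs_ballP[a /= a0 aA] : nbhs y A by exact: open_nbhs_nbhs.
exists (Num.min a s); first by rewrite lt_min a0.
move=> z; rewrite lt_min => /andP[ya ys].
have Az : A z by apply: aA; rewrite rV_ballE.
apply: le_trans (uC y z Ay Az) _.
apply: (@le_trans _ _ (C1 * `|y - z| `^ r)).
  by apply: ler_wpM2r; rewrite ?powR_ge0// (le_trans (ler_norm _))// lerDl.
rewrite -sr; apply: ler_wpM2l; first exact: ltW.
by apply: ge0_ler_powR; rewrite ?nnegrE ?normr_ge0 ?(ltW s0) ?(ltW r0)// ltW.
Qed.

Lemma bounded_of_holder A B (u : 'rV[R]_n -> R) (C r : R) : 0 <= r ->
  (forall y z, A y -> A z -> `|u y - u z| <= C * `|y - z| `^ r) ->
  bounded_set B -> B `<=` A -> exists2 M : R, 0 <= M & forall y, B y -> `|u y| <= M.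
Proof.
move=> r0 uC /pinfty_ex_gt0[b b0 Bb] BA.
have [->|/set0P[p Bp]] := eqVneq B set0; first by exists 0.
pose C1 := `|C|; have C10 : 0 <= C1 := normr_ge0 C.
exists (C1 * (b + b) `^ r + `|u p|); first by rewrite addr_ge0// mulr_ge0// powR_ge0.
move=> y By; rewrite -[u y](subrK (u p)); apply: le_trans (ler_normD _ _) _.
rewrite lerD2r; apply: le_trans (uC y p (BA _ By) (BA _ Bp)) _.
apply: (@le_trans _ _ (C1 * `|y - p| `^ r)).
  by apply: ler_wpM2r; rewrite ?powR_ge0// ler_norm.
apply: ler_wpM2l => //; apply: ge0_ler_powR; rewrite ?nnegrE ?normr_ge0 ?addr_ge0 ?(ltW b0)//.
by apply: le_trans (ler_normB _ _) _; apply: lerD; exact: Bb.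
Qed.

(** Regularity specialized to v = 0, where the one-sided derivative of the definition coincides with
    the right limit [dv0]. *)
Lemma C1r_holder (r : R) A h : C1r r A h -> exists (C : R) (hy : 'rV[R]_n -> 'rV[R]_n),
  [/\ forall y i, A y -> is_derive y (delta_mx 0 i) (h^~ 0) (hy y 0 i),
      forall y z, A y -> A z -> `|dv0 h y - dv0 h z| <= C * `|y - z| `^ r
    & forall y z, A y -> A z -> `|hy y - hy z| <= C * `|y - z| `^ r].
Proof.
move=> [hy [hv [dh lh /(_ 1)[C HC]]]].
have dvE y : A y -> dv0 h y = hv y 0.
  move=> Ay; rewrite /dv0; apply: cvg_lim; first exact: Rhausdorff.
  have := lh y 0 Ay (lexx 0).
  have E : (fun t : R => t^-1 * (h y (0 + t) - h y 0)) = (fun t : R => t^-1 * (h y t - h y 0)).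
    by apply/funext => t; rewrite add0r.
  rewrite E; apply: cvg_trans; apply: cvg_app => P; move=> H.
  have H' : nbhs (0 : R) (fun t => t != 0 -> 0 <= 0 + t -> P t) := H.
  suff : nbhs (0 : R) (fun t => 0 < t -> P t) by [].
  apply: filterS H' => t H't t0; apply: H't; first by rewrite gt_eqF.
  by rewrite add0r ltW.
exists C, (hy^~ 0); split=> [y i Ay|y z Ay Az|y z Ay Az]; first exact: dh.
- have := HC y z 0 0 Ay Az; rewrite lexx ler01 subrr normr0 addr0 !dvE//.
  by move=> /(_ isT isT)[].
- have := HC y z 0 0 Ay Az; rewrite lexx ler01 subrr normr0 addr0.
  by move=> /(_ isT isT)[].
Qed.

Lemma C1r_dv0_continuous (r : R) A h : open A -> 0 < r -> C1r r A h ->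
  forall y, A y -> {for y, continuous (dv0 h)}.
Proof.
move=> oA r0 /C1r_holder[C [hy [_ H _]]]; exact: cvg_of_holder oA r0 H.
Qed.

Lemma C1r_dv0_bounded (r : R) A B h : 0 <= r -> C1r r A h -> bounded_set B -> B `<=` A ->
  exists2 M : R, 0 <= M & forall y, B y -> `|dv0 h y| <= M.
Proof.
move=> r0 /C1r_holder[C [hy [_ H _]]]; exact: bounded_of_holder r0 H.
Qed.

(** Hoelder continuous partial derivatives are locally bounded, hence the function is locally
    Lipschitz. This serves for kappa, which is presented as a function constant in its second
    variable. *)
Lemma C1r_continuous (r : R) A h : open A -> 0 <= r -> C1r r A h ->
  forall y, A y -> {for y, continuous (h^~ 0)}.
Proof.
move=> oA r0 /C1r_holder[C [hy [dh _ H]]] y Ay.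
have /nbhs_ballP[s /= s0 sA] : nbhs y A by exact: open_nbhs_nbhs.
pose M := `|C| * s `^ r + `|hy y|.
have M0 : 0 <= M by rewrite addr_ge0// mulr_ge0// powR_ge0.
have L z : `|y - z| < s -> `|h z 0 - h y 0| <= n%:R * M * `|z - y|.
  move=> yz; apply: (@coord_increment_le _ _ (h^~ 0) y s M) => //; last by rewrite subrr normr0.
  - move=> t yt i; have At : A t by apply: sA; rewrite rV_ballE.
    by have := dh t i At => -[].
  - move=> t yt i; have At : A t by apply: sA; rewrite rV_ballE.
    have -> : partial (h^~ 0) i t = hy t 0 i by have [_] := dh t i At.
    apply: le_trans (normr_coord_le _ _) _.
    rewrite -[hy t](subrK (hy y)); apply: le_trans (ler_normD _ _) _.
    rewrite lerD2r; apply: le_trans (H t y At Ay) _.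
    apply: (@le_trans _ _ (`|C| * `|t - y| `^ r)).
      by apply: ler_wpM2r; rewrite ?powR_ge0// ler_norm.
    apply: ler_wpM2l => //; apply: ge0_ler_powR; rewrite ?nnegrE// ?(ltW s0)//.
    by rewrite distrC ltW.
apply: rV_continuous_at => e e0.
pose K := n%:R * M + 1; have K0 : 0 < K by rewrite ltr_wpDl// mulr_ge0.
exists (Num.min s (e / K)); first by rewrite lt_min s0 divr_gt0.
move=> z; rewrite lt_min => /andP[yzs yze].
rewrite distrC; apply: le_trans (L z yzs) _; rewrite distrC.
apply: (@le_trans _ _ (K * `|y - z|)); first by apply: ler_wpM2r => //; rewrite /K lerDl.
by rewrite mulrC -ler_pdivlMr// ltW.
Qed.

Lemma dv0_eq h (k : 'rV[R]_n -> R -> R) y : (forall v, 0 <= v -> h y v = k y v) -> dv0 h y = dv0 k y.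
Proof.
move=> hk; rewrite /dv0; congr (lim _).
apply/funext => P; apply/propext; split; apply: filterS2 (nbhs_right_gt 0) => t t0 /=.
  by rewrite (hk _ (ltW t0)) (hk _ (lexx 0)).
by rewrite (hk _ (ltW t0)) (hk _ (lexx 0)).
Qed.

Section bdry_coefficients.
Variables (mu : {outer_measure set 'rV[R]_n -> \bar R}).
Hypothesis mH : forall i c, mu.-cara.-measurable (halfspace i c).
Variables (r : R) (W : set 'rV[R]_n).
Hypotheses (r_gt0 : 0 < r) (bW : bounded_set (bdry W)) (compW : compact (bdry W)).

Let mbW : measurable (bdry W : set (caratheodory_type mu)) := bdry_cara_measurable mH W.

Lemma bdry_measurable_fun (O : set 'rV[R]_n) (u v : 'rV[R]_n -> R) : open O -> bdry W `<=` O ->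
  (forall y, O y -> {for y, continuous u}) -> (forall y, bdry W y -> u y = v y) ->
  measurable_fun (bdry W : set (caratheodory_type mu)) v.
Proof.
move=> oO WO cu uv; have mu' := cara_measurable_fun_continuous_on mH oO cu.
have := measurable_funS (open_cara_measurable mH oO) WO mu'.
by apply: eq_measurable_fun => y /set_mem; exact: uv.
Qed.

Lemma C1r_bdry_dv0 h : C1r_bdry r W h ->
  measurable_fun (bdry W : set (caratheodory_type mu)) (dv0 h) /\
  exists2 M : R, 0 <= M & forall y, bdry W y -> `|dv0 h y| <= M.
Proof.
move=> [ O [H [ oO WO CH Hh]]].
have E y : bdry W y -> dv0 H y = dv0 h y by move=> Wy; apply: dv0_eq => v; exact: Hh.
split; first exact: (bdry_measurable_fun oO WO (C1r_dv0_continuous oO r_gt0 CH) E).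
have [M M0 HM] := C1r_dv0_bounded (ltW r_gt0) CH bW WO.
by exists M => // y Wy; rewrite -E//; exact: HM.
Qed.

Lemma C1r_bdry_coefficient (kappa : 'rV[R]_n -> R) : C1r_bdry r W (fun y _ => kappa y) ->
  [/\ measurable_fun (bdry W : set (caratheodory_type mu)) kappa,
      exists2 M : R, 0 <= M & forall y, bdry W y -> `|kappa y| <= M
    & forall p e, bdry W p -> 0 < e -> exists2 d : R, 0 < d &
        forall y, bdry W y -> ball p d y -> kappa p - e <= kappa y].
Proof.
move=> [ O [H [ oO WO CH Hk]]].
have cH := C1r_continuous oO (ltW r_gt0) CH.
have E y : bdry W y -> H y 0 = kappa y by move=> Wy; exact: Hk.
split.
- exact: (bdry_measurable_fun oO WO cH E).
- pose P B := exists2 M : R, 0 <= M & forall y, B y -> bdry W y -> `|kappa y| <= M.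
  have [M M0 HM] : P (bdry W).
    apply: (@compact_local_property _ P _ compW).
    + by exists 0.
    + move=> B C [M M0 HM] [M' M0' HM']; exists (M + M'); first by rewrite addr_ge0.
      move=> y [By|Cy] Wy; first by apply: le_trans (HM y By Wy) _; rewrite lerDl.
      by apply: le_trans (HM' y Cy Wy) _; rewrite lerDr.
    + by move=> B C BC [M M0 HM]; exists M => // y /BC; exact: HM.
    + move=> p Wp; have cp : H z 0 @[z --> (p : 'rV[R]_n)] --> H p 0 := cH p (WO _ Wp).
      have /nbhs_ballP[s /= s0 Hs] : \forall z \near p, `|H p 0 - H z 0| <= 1.
        by move/cvgrPdist_le : cp => /(_ 1 ltr01).
      exists (ball p s); first by split; [exact: ball_open | exact: ballxx].
      exists (`|kappa p| + 1); first by rewrite addr_ge0.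
      move=> y py Wy; have := Hs y py; rewrite /= !E// => H1.
      rewrite -[kappa y](subKr (kappa p)); apply: le_trans (ler_normB _ _) _.
      by rewrite lerD2l.
  by exists M => // y Wy; exact: HM.
- move=> p e Wp e0; have cp : H z 0 @[z --> (p : 'rV[R]_n)] --> H p 0 := cH p (WO _ Wp).
  have /nbhs_ballP[s /= s0 Hs] : \forall z \near p, `|H p 0 - H z 0| <= e.
    by move/cvgrPdist_le : cp => /(_ e e0).
  exists s => // y Wy py.
  have := Hs y py; rewrite /= !E// => /ler_normlP[_]; rewrite lerBlDr => H1.
  by rewrite lerBlDr addrC.
Qed.

End bdry_coefficients.

End coefficient_regularity.

(** * Asymptotics of the speed in abstract form *)

Section speed_asymptotics.
Context {R : realType} {X : Type}.
Variables (S : set X) (G u v E : X -> R) (d C : R).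
Hypotheses (d_gt0 : 0 < d) (C_ge0 : 0 <= C).
Hypotheses (G_ge0 : forall x, S x -> 0 <= G x) (u_ge0 : forall x, S x -> 0 <= u x)
  (v_ge0 : forall x, S x -> 0 <= v x) (uv1 : forall x, S x -> u x + v x = 1)
  (E_ge : forall x, S x -> - C <= E x).
Variables x1 x2 : X.
Hypotheses (Sx1 : S x1) (Gx1 : G x1 = 0) (ux1 : u x1 = 1) (vx1 : v x1 = 0) (Ex1 : E x1 <= C).
Hypotheses (Sx2 : S x2) (Gx2 : G x2 = 0) (ux2 : u x2 = 0) (vx2 : v x2 = 1) (Ex2 : E x2 <= C).

Definition lam_form D a x : R := D * (G x - a ^+ 2 * u x) + E x - d * a ^+ 2 * v x.

Definition lam D a : R := inf [set lam_form D a x | x in S].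

Definition speed D : R := inf [set - lam D a / a | a in [set a : R | 0 < a]].

Hypothesis sup_lam_lt0 : sup [set lam D 0 | D in [set D : R | 0 < D]] < 0.

Let Delta : R := - sup [set lam D 0 | D in [set D : R | 0 < D]].

Let Delta_gt0 : 0 < Delta. Proof. by rewrite oppr_gt0. Qed.

Let lam_form_ge D a x : 0 <= D -> S x -> - (D * a ^+ 2 + d * a ^+ 2 + C) <= lam_form D a x.
Proof.
move=> D0 Sx; have := E_ge Sx; rewrite /lam_form.
have -> : u x = 1 - v x by rewrite -(uv1 Sx) addrK.
have a20 : 0 <= a ^+ 2 by exact: sqr_ge0.
have v1 : v x <= 1 by rewrite -(uv1 Sx) lerDr u_ge0.
have h1 : 0 <= D * G x by rewrite mulr_ge0// G_ge0.
have v0 := v_ge0 Sx.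
have h2 : 0 <= D * a ^+ 2 * v x by apply: mulr_ge0 => //; exact: mulr_ge0.
have h3 : 0 <= d * a ^+ 2 * (1 - v x).
  by apply: mulr_ge0; [apply: mulr_ge0 => //; exact: ltW | rewrite subr_ge0].
rewrite mulrBr mulrA mulrBr mulr1 in h3 *; move: h1 h2 h3.
have -> : D * (a ^+ 2 * (1 - v x)) = D * a ^+ 2 - D * a ^+ 2 * v x by ring.
move: (D * G x) (D * a ^+ 2) (d * a ^+ 2) => p q s *; lra.
Qed.

Let lam_bounded D a : 0 <= D -> has_lbound [set lam_form D a x | x in S].
Proof. by move=> D0; eexists => _ [x Sx <-]; exact: lam_form_ge. Qed.

Let lam_le D a x : 0 <= D -> S x -> lam D a <= lam_form D a x.
Proof. by move=> D0 Sx; apply: ge_inf; [exact: lam_bounded | exists x]. Qed.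

Let lam_ge D a (y : R) : (forall x, S x -> y <= lam_form D a x) -> y <= lam D a.
Proof.
move=> H; apply: lb_le_inf; first by exists (lam_form D a x1), x1.
by move=> _ [x Sx <-]; exact: H.
Qed.

Let lam_upper D a : 0 <= D -> - lam D a <= D * a ^+ 2 + d * a ^+ 2 + C.
Proof. by move=> D0; rewrite lerNl; apply: lam_ge => x; exact: lam_form_ge. Qed.

Let lam_lower_surf D a : 0 <= D -> D * a ^+ 2 - C <= - lam D a.
Proof.
move=> D0; rewrite lerNr; apply: le_trans (lam_le a D0 Sx1) _.
rewrite /lam_form Gx1 ux1 vx1 mulr1 mulr0 subr0 sub0r mulrN opprB addrC.
by move: (D * _) Ex1 => p; lra.
Qed.

Let lam_lower_bulk D a : 0 <= D -> d * a ^+ 2 - C <= - lam D a.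
Proof.
move=> D0; rewrite lerNr; apply: le_trans (lam_le a D0 Sx2) _.
rewrite /lam_form Gx2 ux2 vx2 mulr0 subr0 mulr0 add0r mulr1 opprB.
by move: (d * _) Ex2 => p; lra.
Qed.

Let lam_lower_Delta D a : 0 < D -> Delta <= - lam D a.
Proof.
move=> D0; rewrite /Delta lerN2.
(* The supremum of a set that has none is 0 by convention, so a negative value forces the set to be
   nonempty and bounded above. *)
have hs : has_sup [set lam D 0 | D in [set D : R | 0 < D]].
  apply: contrapT => /sup_out hs; have := sup_lam_lt0.
  by rewrite hs ltxx.
apply: (@le_trans _ _ (lam D 0)); last by apply: ub_le_sup; [case: hs | exists D].
apply: lam_ge => x Sx; apply: le_trans (lam_le a (ltW D0) Sx) _.
have h1 : 0 <= D * (a ^+ 2 * u x) by rewrite mulr_ge0 ?(ltW D0)// mulr_ge0 ?sqr_ge0// u_ge0.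
have h2 : 0 <= d * a ^+ 2 * v x by rewrite mulr_ge0 ?v_ge0// mulr_ge0 ?sqr_ge0// ltW.
rewrite /lam_form expr0n /= !(mul0r, mulr0, subr0) mulrBr; move: h1 h2.
by move: (D * (_ * _)) (d * _ * _) => p q *; lra.
Qed.

Let speed_bounded D : 0 < D -> has_lbound [set - lam D a / a | a in [set a : R | 0 < a]].
Proof.
move=> D0; exists 0 => _ [a a0 <-]; rewrite divr_ge0 ?(ltW a0)//.
exact: le_trans (ltW Delta_gt0) (lam_lower_Delta a D0).
Qed.

Let speed_le D a : 0 < D -> 0 < a -> speed D <= - lam D a / a.
Proof. by move=> D0 a0; apply: ge_inf; [exact: speed_bounded | exists a]. Qed.

Let speed_ge D (y : R) : (forall a, 0 < a -> y <= - lam D a / a) -> y <= speed D.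
Proof.
move=> H; apply: lb_le_inf; first by exists (- lam D 1 / 1); exists 1; rewrite //= ltr01.
by move=> _ [a a0 <-]; exact: H.
Qed.

(** The common scheme of the lower bounds: for a <= A1 the quotient is at least Delta / A1, and
    beyond A1 the quadratic growth of -[lam] takes over. *)
Let speed_lower D (m A1 : R) : 0 < D -> 0 < A1 -> m <= Delta / A1 ->
  (forall a, A1 <= a -> m * a <= - lam D a) -> m <= speed D.
Proof.
move=> D0 A10 mD H; apply: speed_ge => a a0.
have [aA|Aa] := leP a A1; last by rewrite ler_pdivlMr// H// ltW.
apply: (le_trans mD); apply: (@le_trans _ _ (Delta / a)).
  by apply: ler_wpM2l; [exact: ltW | rewrite lef_pV2 ?posrE].
by apply: ler_wpM2r; [rewrite invr_ge0 ltW | exact: lam_lower_Delta].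
Qed.

(** In terms of y = a sqrt D the surface state gives -[lam] >= y^2 - C, which is at least y once y
    >= 1 + C; the threshold is therefore a = (1 + C) / sqrt D. *)
Lemma speed_ge_sqrt : exists2 A, 0 < A & forall D, 0 < D -> A * Num.sqrt D <= speed D.
Proof.
have C10 : 0 < 1 + C by rewrite ltr_wpDr.
exists (Num.min 1 (Delta / (1 + C))); first by rewrite lt_min ltr01 divr_gt0.
move=> D D0; set A := Num.min _ _; pose s := Num.sqrt D.
have s0 : 0 < s by rewrite sqrtr_gt0.
have s2 : s ^+ 2 = D by rewrite sqr_sqrtr// ltW.
have A1 : A <= 1 by rewrite ge_min lexx.
have AD : A <= Delta / (1 + C) by rewrite ge_min lexx orbT.
apply: (@speed_lower D _ ((1 + C) / s)) => //; first by rewrite divr_gt0.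
  rewrite invf_div mulrCA mulrC; apply: ler_wpM2l; first exact: ltW.
  by rewrite -/s.
move=> a; rewrite ler_pdivrMr// => as1.
apply: le_trans (lam_lower_surf a (ltW D0)); rewrite -/s -s2.
have h1 : A * (a * s) <= a * s.
  by rewrite ler_piMl// (le_trans _ as1)// ltW.
have h2 : 0 <= (a * s - (1 + C)) * (a * s) + C * (a * s - 1).
  apply: addr_ge0; apply: mulr_ge0 => //; rewrite ?subr_ge0//.
    by rewrite (le_trans _ as1)// ltW.
  by rewrite (le_trans _ as1)// lerDl.
rewrite (_ : A * s * a = A * (a * s)); last by ring.
rewrite (_ : s ^+ 2 * a ^+ 2 = (a * s) * (a * s)); last by ring.
apply: (le_trans h1); rewrite -subr_ge0; apply: (le_trans h2).
by rewrite le_eqVlt; apply/orP; left; apply/eqP; ring.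
Qed.

(** The competitor a = 1 / sqrt D keeps D a^2 = 1 and d a^2 <= d. *)
Lemma speed_le_sqrt : exists2 B, 0 < B & forall D, 1 <= D -> speed D <= B * Num.sqrt D.
Proof.
exists (1 + d + C); first by rewrite ltr_wpDr// addr_gt0.
move=> D D1; have D0 : 0 < D by exact: lt_le_trans ltr01 D1.
pose s := Num.sqrt D; have s0 : 0 < s by rewrite sqrtr_gt0.
have s2 : s ^+ 2 = D by rewrite sqr_sqrtr// ltW.
have si : 0 < s^-1 by rewrite invr_gt0.
apply: le_trans (speed_le D0 si) _; rewrite invrK; apply: ler_wpM2r; first exact: ltW.
apply: le_trans (lam_upper _ (ltW D0)) _; rewrite lerD2r exprVn s2 mulfV ?gt_eqF//.
by rewrite lerD2l ler_pdivrMr// ler_peMr// ltW.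
Qed.

Let speed_lower_const : exists2 m, 0 < m & forall D, 0 < D -> m <= speed D.
Proof.
pose A1 := 1 + C / d.
have A11 : 1 <= A1 by rewrite lerDl divr_ge0// ltW.
have A10 : 0 < A1 by exact: lt_le_trans ltr01 A11.
exists (Num.min d (Delta / A1)); first by rewrite lt_min d_gt0 divr_gt0.
move=> D D0; set m := Num.min _ _.
have md : m <= d by rewrite ge_min lexx.
apply: (@speed_lower D _ A1) => //; first by rewrite ge_min lexx orbT.
move=> a Aa; apply: le_trans (lam_lower_bulk a (ltW D0)).
have a0 : 0 < a by exact: lt_le_trans Aa.
have a1 : 1 <= a by exact: le_trans Aa.
apply: (@le_trans _ _ (d * a)); first by rewrite ler_pM2r.
have : d * A1 <= d * a by rewrite ler_pM2l.
rewrite /A1 mulrDr mulr1 mulrCA divff ?gt_eqF// mulr1 => h.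
have : (d * a - (d + C)) * a >= 0 by rewrite mulr_ge0 ?subr_ge0// ltW.
have : 0 <= C * (a - 1) by rewrite mulr_ge0// subr_ge0.
rewrite (_ : d * a ^+ 2 = d * a * a); last by ring.
by rewrite !mulrBl mulrDl mulrBr mulr1 mulrC; move: (d * a * a) (d * a) (a * C) => p q s *; lra.
Qed.

(* For D <= 1 the infimum defining the speed is reached up to any error at a <= a1,
   where - lam D a / a - D a is nonincreasing in D; hence so is speed D - a1 D. *)
Lemma speed_cvg0 : exists2 c0 : R, 0 < c0 & speed D @[D --> 0^'+] --> c0.
Proof.
have [m m0 Hm] := speed_lower_const.
pose M := 1 + d + C.
have cM D : 0 < D -> D <= 1 -> speed D <= M.
  move=> D0 D1; apply: le_trans (speed_le D0 ltr01) _; rewrite divr1.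
  by apply: le_trans (lam_upper _ (ltW D0)) _; rewrite expr1n !mulr1 !lerD2r.
(* For a > a1 one has d a^2 - C >= M a, while M bounds the speed for D <= 1: such a cannot bring the
   quotient below the speed. *)
pose a1 := 1 + (M + C) / d.
have M0 : 0 < M by rewrite /M ltr_wpDr// addr_gt0.
have a10 : 0 < a1 by rewrite ltr_wpDr// divr_ge0 ?(ltW d_gt0)// addr_ge0// ltW.
pose phi D := speed D - a1 * D.
have mono D1 D2 : 0 < D1 -> D1 <= D2 -> D2 <= 1 -> phi D2 <= phi D1.
  move=> D10 D12 D21; have D20 : 0 < D2 by exact: lt_le_trans D12.
  suff : speed D2 - (D2 - D1) * a1 <= speed D1.
    by rewrite /phi [a1 * D1]mulrC [a1 * D2]mulrC mulrBl; move: (D1 * a1) (D2 * a1) => p q; lra.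
  apply: speed_ge => a a0; rewrite lerBlDr.
  have [aa|aa] := leP a a1.
    apply: le_trans (speed_le D20 a0) _.
    have : - lam D2 a <= - lam D1 a + (D2 - D1) * a ^+ 2.
      rewrite lerNl opprD opprK; apply: lam_ge => x Sx.
      rewrite lerBlDr; apply: le_trans (lam_le a (ltW D10) Sx) _.
      rewrite /lam_form -subr_ge0 (_ : _ - _ = (D2 - D1) * (G x + a ^+ 2 * (1 - u x))); last by ring.
      rewrite mulr_ge0 ?subr_ge0// addr_ge0 ?G_ge0// mulr_ge0 ?sqr_ge0//.
      by rewrite -(uv1 Sx) addrC addKr v_ge0.
    move=> /(ler_wpM2r (ltW _)) => /(_ a^-1); rewrite invr_gt0 => /(_ a0).
    rewrite mulrDl expr2 -!mulrA divff ?gt_eqF// mulr1 => /le_trans; apply.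
    by rewrite lerD2l ler_wpM2l ?subr_ge0.
  apply: (le_trans (cM D2 D20 D21)); apply: ler_wpDr.
    by rewrite mulr_ge0 ?subr_ge0// ltW.
  rewrite ler_pdivlMr//; apply: le_trans (lam_lower_bulk a (ltW D10)).
  have h1 : M + C <= d * (a - 1).
    by rewrite mulrC -ler_pdivrMr// lerBrDl ltW.
  have a_1 : 1 <= a by rewrite (le_trans _ (ltW aa))// lerDl divr_ge0 ?(ltW d_gt0)// addr_ge0// ltW.
  have h2 : 0 <= (d * (a - 1) - (M + C)) * a by rewrite mulr_ge0 ?subr_ge0// ltW.
  have h3 : 0 <= C * (a - 1) by rewrite mulr_ge0// subr_ge0.
  have h4 : 0 <= d * a by rewrite mulr_ge0// ltW.
  rewrite -subr_ge0 (_ : _ - _ = (d * (a - 1) - (M + C)) * a + C * (a - 1) + d * a); last by ring.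
  by rewrite !addr_ge0.
have ub : has_ubound (phi @` [set` Interval (BRight 0) (BRight 1)]).
  exists M; move=> _ [D /= + <-]; rewrite in_itv /= => /andP[D0 D1].
  rewrite /phi; apply: le_trans (cM D D0 D1); rewrite lerBlDr lerDl; apply: mulr_ge0; exact: ltW.
have cphi : phi D @[D --> 0^'+] --> sup (phi @` [set` Interval (BRight 0) (BRight 1)]).
  apply: nonincreasing_at_right_cvgr => //; first by rewrite bnd_simp.
  move=> x y; rewrite !in_itv /= => /andP[x0 x_1] /andP[y0 y_1] xy; exact: mono.
have cs : speed D @[D --> 0^'+] --> sup (phi @` [set` Interval (BRight 0) (BRight 1)]).
  have c2 : a1 * D @[D --> 0^'+] --> a1 * 0.
    by apply: cvgM; [exact: cvg_cst | apply: cvg_at_right_filter; exact: cvg_id].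
  have E2 : phi \+ (fun D : R => a1 * D) = speed.
    by apply/funext => D /=; rewrite /phi subrK.
  by rewrite -E2 -[X in _ --> X]addr0 -[X in _ + X](mulr0 a1); exact: cvgD cphi c2.
exists (sup (phi @` [set` Interval (BRight 0) (BRight 1)])) => //.
apply: lt_le_trans m0 _; apply: (cvgr_to_ge cs).
by apply: filterS (nbhs_right_gt 0) => D; exact: Hm.
Qed.

(** At the fixed competitor a, unit surface mass costs at most k + t + D a^2 and unit bulk mass l -
    e + d a^2 = 2 l - e. As D tends to 0 the former falls below 2 l, so both leave a gap. *)
Lemma speed_small_le (l k : R) (a : R) : 0 < l -> 0 < a -> d * a ^+ 2 = l -> k < 2 * l ->
  (forall t, 0 < t -> exists2 e, 0 < e & forall x, S x -> - ((k + t) * u x + (l - e) * v x) <= E x) ->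
  exists2 e, 0 < e & \forall D \near 0^'+, speed D <= (2 * l - e) / a.
Proof.
move=> l0 a0 dal kl HE.
(* One third of the gap pays for t itself, one third for D a^2 <= t, and one third remains. *)
pose t := (2 * l - k) / 3; have t0 : 0 < t by rewrite divr_gt0// subr_gt0.
have [e e0 He] := HE t t0.
exists (Num.min t e); first by rewrite lt_min t0.
set e' := Num.min t e; have e't : e' <= t by rewrite ge_min lexx.
have e'e : e' <= e by rewrite ge_min lexx orbT.
have a20 : 0 < a ^+ 2 by rewrite exprn_gt0.
near=> D.
have D0 : 0 < D by near: D; exact: nbhs_right_gt.
have Dt : D < t / a ^+ 2 by near: D; apply: nbhs_right_lt; rewrite divr_gt0.
have {}Dt : D * a ^+ 2 <= t by rewrite -ler_pdivlMr// ltW.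
apply: le_trans (speed_le D0 a0) _; apply: ler_wpM2r; first by rewrite invr_ge0 ltW.
rewrite lerNl; apply: lam_ge => x Sx; rewrite /lam_form dal.
have h0 : 0 <= D * G x by rewrite mulr_ge0 ?G_ge0// ltW.
have h1 : 0 <= (t - D * a ^+ 2) * u x by rewrite mulr_ge0 ?u_ge0// subr_ge0.
have h2 : 0 <= (t - e') * u x by rewrite mulr_ge0 ?u_ge0// subr_ge0.
have h3 : 0 <= (e - e') * v x by rewrite mulr_ge0 ?v_ge0// subr_ge0.
have h4 := He x Sx.
have h5 : k + t + t = 2 * l - t by rewrite /t; field.
rewrite -subr_ge0 (_ : _ - _ = D * G x + (t - D * a ^+ 2) * u x + (t - e') * u x + (e - e') * v x +
  (E x - (- ((k + t) * u x + (l - e) * v x))) + (2 * l - e') * (1 - (u x + v x)) +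
  (2 * l - t - (k + t + t)) * u x); last by ring.
rewrite uv1// subrr mulr0 h5 subrr mul0r !addr0.
by rewrite addr_ge0 ?subr_ge0// !addr_ge0.
Unshelve. all: by end_near. Qed.

End speed_asymptotics.

(** * The bulk-surface energy *)

Section weighted_L2.
Context {R : realType} {T : pointedType} (mu : {outer_measure set T -> \bar R}).
Local Notation muT := (caratheodory_type mu).
Local Notation mus := (cara_measure mu).
Variable A : set T.
Hypothesis mA : measurable (A : set muT).
Variables (b : T -> R) (C : R).
Hypotheses (mb : measurable_fun (A : set muT) b) (bC : forall x, A x -> `|b x| <= C).

Lemma integ_sqr_ge0 h : 0 <= integ mu A (fun x => h x ^+ 2).
Proof. by apply: Rintegral_ge0 => x _; exact: sqr_ge0. Qed.

Lemma integ_shifted_coefficient (a : R) h : L2 mu A h ->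
  integ mu A (fun x => (a + b x) * h x ^+ 2) =
  a * integ mu A (fun x => h x ^+ 2) + integ mu A (fun x => b x * h x ^+ 2).
Proof.
move=> Lh; have I := L2_sqr_integrable Lh; have Ib := L2_mul_integrable mA mb bC Lh.
rewrite /integ -(RintegralZl _ mA I) -(RintegralD mA (integrableZl mA a I) Ib).
by apply: eq_Rintegral => x _; rewrite mulrDl.
Qed.

Lemma integ_coefficient_le (k : R) h : (forall x, A x -> b x <= k) -> L2 mu A h ->
  integ mu A (fun x => b x * h x ^+ 2) <= k * integ mu A (fun x => h x ^+ 2).
Proof.
move=> bk Lh; have I := L2_sqr_integrable Lh; have Ib := L2_mul_integrable mA mb bC Lh.
rewrite /integ -(RintegralZl _ mA I).
apply: (@le_Rintegral _ muT R mus A _ _ mA Ib (integrableZl mA k I)) => x Ax.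
by apply: ler_wpM2r; [exact: sqr_ge0 | exact: bk].
Qed.

Lemma integ_coefficient_ge (k : R) h : (forall x, A x -> k <= b x) -> L2 mu A h ->
  k * integ mu A (fun x => h x ^+ 2) <= integ mu A (fun x => b x * h x ^+ 2).
Proof.
move=> bk Lh; have I := L2_sqr_integrable Lh; have Ib := L2_mul_integrable mA mb bC Lh.
rewrite /integ -(RintegralZl _ mA I).
apply: (@le_Rintegral _ muT R mus A _ _ mA (integrableZl mA k I) Ib) => x Ax.
by apply: ler_wpM2r; [exact: sqr_ge0 | exact: bk].
Qed.

Lemma L2_cvg_cst h : L2_cvg mu A (fun=> h) h.
Proof.
rewrite /L2_cvg (_ : sqint mu A (h \- h) = 0%E); first exact: cvg_cst.
rewrite /sqint; transitivity (\int[mus]_(x in A) cst 0 x)%E; last exact: integral0.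
by apply: eq_integral => x _ /=; rewrite subrr expr0n.
Qed.

Lemma integ_cst (k : R) : integ mu A (fun=> k) = k * fine (mus A).
Proof. by rewrite /integ (Rintegral_cst mus mA). Qed.

End weighted_L2.

Section constant_functions.
Context {R : realType} {n : nat}.
Implicit Types s : R.

Lemma partial_cst s i : partial (fun _ : 'rV[R]_n => s) i = fun=> 0.
Proof. by apply/funext => x; rewrite /partial; exact: (derive_cst s). Qed.

Lemma grad_cst s x : grad (fun _ : 'rV[R]_n => s) x = 0.
Proof. by apply/rowP => i; rewrite !mxE partial_cst. Qed.

Lemma smooth_cst s : smooth (fun _ : 'rV[R]_n => s).
Proof.
move=> k; elim: k s => [|k IH] s; first exact: cst_continuous.
split=> [|i]; first exact: cst_continuous.
by rewrite partial_cst; split=> // x; exact: derivable_cst.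
Qed.

Lemma dot0l (x : 'rV[R]_n) : dot 0 x = 0.
Proof. by rewrite /dot big1// => i _; rewrite mxE mul0r. Qed.

Lemma tangential_grad_cst (W : set 'rV[R]_n) s x : tangential_grad W (fun=> s) x = 0.
Proof. by rewrite /tangential_grad grad_cst dot0l scale0r subr0. Qed.

End constant_functions.

Section energies.
Context {R : realType} {n : nat}.
Local Notation V := 'rV[R]_n.+1.
Local Notation lebT := (caratheodory_type (@lebesgue_outer R n.+1)).
Local Notation leb := (@leb R n.+1).
Local Notation Leb := (@lebesgue_outer R n.+1).
Local Notation Surf := (@hausdorff_outer R n.+1 n).
Local Notation surfT := (caratheodory_type Surf).
Local Notation surf := (cara_measure Surf).
Variable W : set V.
Hypotheses (oW : open W) (bW : bounded_set W) (cW : connected W) (sW : smooth_boundary W).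
Variables (d mu nu : R) (kappa : V -> R) (f g : V -> R -> R) (Cf Cg Kk : R).
Hypotheses (d_gt0 : 0 < d) (mu_gt0 : 0 < mu) (nu_gt0 : 0 < nu).
Hypotheses (mf : measurable_fun (W : set lebT) (dv0 f)) (fC : forall y, W y -> `|dv0 f y| <= Cf).
Hypotheses (mg : measurable_fun (bdry W : set surfT) (dv0 g))
  (gC : forall y, bdry W y -> `|dv0 g y| <= Cg).
Hypotheses (mk : measurable_fun (bdry W : set surfT) kappa)
  (kC : forall y, bdry W y -> `|kappa y| <= Kk) (kappa_ge0 : forall y, bdry W y -> 0 <= kappa y).
Hypotheses (Cf_ge0 : 0 <= Cf) (Cg_ge0 : 0 <= Cg) (Ck_ge0 : 0 <= Kk).
Hypothesis Lambda_f_lt0 : Lambda_f W d f 0 < 0.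

Let mW := open_leb_measurable oW.
Let mbW : measurable (bdry W : set surfT) := bdry_cara_measurable measurable_halfspace_hausdorff W.

Local Notation lambda := (- Lambda_f W d f 0).

Definition bulk_energy (U : V -> R) (GU : V -> V) : R :=
  d * int_bulk W (fun y => dot (GU y) (GU y)) - int_bulk W (fun y => dv0 f y * U y ^+ 2).

Lemma energy_bulkE a U GU : L2 Leb W U ->
  energy_bulk W d f a U GU = bulk_energy U GU - d * a ^+ 2 * int_bulk W (fun y => U y ^+ 2).
Proof.
move=> LU; rewrite /energy_bulk /bulk_energy /int_bulk (integ_shifted_coefficient mW mf fC _ LU).
by rewrite opprD addrA addrAC.
Qed.

(** The infimum of a set that has none is 0 by convention, so its negativity shows that competitors
    exist and that their quotients are bounded below. *)
Lemma Lambda_f_has_inf : has_inf [set E | exists U GU,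
    [/\ H1_bulk W U GU, int_bulk W (fun y => U y ^+ 2) != 0
      & E = energy_bulk W d f 0 U GU / int_bulk W (fun y => U y ^+ 2)]].
Proof.
apply: contrapT => /inf_out H; have := Lambda_f_lt0.
by rewrite /Lambda_f H ltxx.
Qed.

(** Over a null domain every competitor would have zero mass, and at least one does not. *)
Lemma leb_domain_gt0 : (0 < leb W)%E.
Proof.
have [[E [U [GU [[LU _ _] U0 _]]]] _] := Lambda_f_has_inf.
rewrite lt0e outer_measure_ge0 andbT; apply/eqP => W0; move/eqP: U0; apply.
have I := L2_sqr_integrable LU.
by rewrite /int_bulk /integ /Rintegral (null_set_integral mW (measurable_int _ I) W0).
Qed.

Lemma bulk_energy_ge U GU : H1_bulk W U GU ->
  - lambda * int_bulk W (fun y => U y ^+ 2) <= bulk_energy U GU.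
Proof.
move=> HU; have [LU LGU _] := HU; rewrite opprK.
have [U0|U0] := eqVneq (int_bulk W (fun y => U y ^+ 2)) 0.
  rewrite U0 mulr0 /bulk_energy subr_ge0.
  apply: (@le_trans _ _ 0).
    rewrite -(mulr0 Cf) -U0; apply: (integ_coefficient_le mW mf fC) => // x Wx.
    exact: le_trans (ler_norm _) (fC Wx).
  rewrite mulr_ge0 ?(ltW d_gt0)//; apply: Rintegral_ge0 => x _; exact: dot_ge0.
have Upos : 0 < int_bulk W (fun y => U y ^+ 2).
  by rewrite lt_neqAle eq_sym U0 /int_bulk integ_sqr_ge0.
rewrite -ler_pdivlMr//; apply: ge_inf; first by case: Lambda_f_has_inf.
by exists U, GU; split=> //; rewrite energy_bulkE// expr0n /= mulr0 mul0r subr0.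
Qed.

Lemma Lambda_f_le a : Lambda_f W d f a <= - lambda - d * a ^+ 2.
Proof.
rewrite opprK; have [S0 [m Hm]] := Lambda_f_has_inf.
rewrite lerBrDr; apply: lb_le_inf => // E [U [GU [HU U0 ->]]].
have [LU _ _] := HU; rewrite -lerBrDr.
have E1 (U' : V -> R) (GU' : V -> V) : L2 Leb W U' -> int_bulk W (fun y => U' y ^+ 2) != 0 ->
    energy_bulk W d f a U' GU' / int_bulk W (fun y => U' y ^+ 2) =
    energy_bulk W d f 0 U' GU' / int_bulk W (fun y => U' y ^+ 2) - d * a ^+ 2.
  by move=> L N; rewrite !energy_bulkE// expr0n /= mulr0 mul0r subr0 mulrBl mulfK.
rewrite -E1//; apply: ge_inf; last by exists U, GU.
exists (m - d * a ^+ 2) => _ [U' [GU' [HU' N' ->]]]; have [LU' _ _] := HU'.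
by rewrite E1// lerD2r; apply: Hm; exists U', GU'.
Qed.

(** Completing the square: with lambda = d a^2, the difference (lambda + d b^2) a - 2 lambda b
    equals d a (a - b)^2. *)
Lemma cstar_f_ge a : 0 < a -> d * a ^+ 2 = lambda -> 2 * lambda / a <= cstar_f W d f.
Proof.
move=> a0 da; apply: lb_le_inf; first by exists (- Lambda_f W d f 1 / 1); exists 1 => //=.
move=> _ [b /= b0 <-]; rewrite ler_pdivlMr// mulrAC ler_pdivrMr//.
apply: (@le_trans _ _ ((lambda + d * b ^+ 2) * a)); last first.
  by apply: ler_wpM2r; [exact: ltW | have := Lambda_f_le b; rewrite lerNr opprD opprK].
rewrite -da -subr_ge0 (_ : _ - _ = d * a * (a - b) ^+ 2); last by ring.
by rewrite mulr_ge0 ?sqr_ge0// mulr_ge0// ltW.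
Qed.

(** This is the key inequality for the coefficient Lambda_f(0) + d_v f(., 0): its form is the bulk
    energy minus its bottom, nonnegative because C^1 functions are competitors for Lambda_f(0). *)
Lemma bulk_energy_gap p (delta : R) : bdry W p -> 0 < delta -> exists2 q : R, 0 < q &
  forall U GU T, H1_bulk W U GU -> trace_of W U GU T ->
  (q - lambda) * int_bulk W (fun y => U y ^+ 2) <=
  bulk_energy U GU + int_bdry W (fun y => \1_(ball p delta) y * T y ^+ 2).
Proof.
have aux (a b l i s : R) : a <= b + (l - i) + s -> a - l <= b - i + s by lra.
move=> bp d0; pose c y := - lambda + dv0 f y.
have mc : measurable_fun (W : set lebT) c by apply: measurable_funD => //; exact: measurable_cst.
have cC y : W y -> `|c y| <= `|lambda| + Cf.
  by move=> Wy; apply: le_trans (ler_normD _ _) _; rewrite normrN lerD2l; exact: fC.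
have form_ge0 psi : Ck 1 psi -> (\int[leb]_(x in W) (psi x ^+ 2))%R != 0 -> 0 <= bulk_form W c d psi.
  move=> C1psi _; have HU := H1_bulk_C1 oW bW C1psi; have [LU _ _] := HU.
  have := bulk_energy_ge HU; rewrite /bulk_form -subr_ge0 /bulk_energy.
  have -> : (\int[leb]_(x in W) (c x * psi x ^+ 2))%R = - lambda * int_bulk W (fun y => psi y ^+ 2)
      + int_bulk W (fun y => dv0 f y * psi y ^+ 2) := integ_shifted_coefficient mW mf fC _ LU.
  by rewrite opprD addrA addrAC.
have [q q0 Hq] := key_inequality_H1 oW bW cW sW leb_domain_gt0 mc cC d_gt0 form_ge0 bp d0.
exists q => // U GU T HU HT; have [LU _ _] := HU.
have := Hq U GU T HU HT.
have -> : int_bulk W (fun y => c y * U y ^+ 2) = - lambda * int_bulk W (fun y => U y ^+ 2)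
    + int_bulk W (fun y => dv0 f y * U y ^+ 2) := integ_shifted_coefficient mW mf fC _ LU.
rewrite /bulk_energy mulrBl opprD mulNr opprK => H.
exact: aux H.
Qed.

(** A null boundary would cast a null shadow, yet the shadow contains a nonempty open set of points
    that leave W along e. *)
Let sweep_bdry_gt0 p : bdry W p -> (0 < surf (bdry W))%E.
Proof.
move=> bp; have [U [e [oU U0 UW Ue _]]] := exit_configuration sW bp (@ltr01 R).
have [C C0 HC] := @lebesgue_outer_sweep_le R n e.
have Upos := leb_open_gt0 leb_domain_gt0 oU U0.
rewrite lt0e outer_measure_ge0 andbT; apply/eqP => S0.
have := HC (bdry W).
have -> : hausdorff_outer n (bdry W) = 0%E by exact: S0.
rewrite mule0 leNgt => /negP; apply; apply: lt_le_trans Upos _.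
apply: le_outer_measure => x Ux.
have [t [t01 bt _]] := exit_point oW (UW x Ux) (Ue x Ux).
by exists t.
Qed.

(** Bundles the five functions quantified in the definition of Lambda_D, so that the abstract speed
    estimates apply. The trace is a component because [trace_of] is a relation. *)
Record state := State { surf_fun : V -> R; surf_grad : V -> V;
  bulk_fun : V -> R; bulk_grad : V -> V; bulk_trace : V -> R }.

Definition admissible (x : state) : Prop :=
  [/\ H1_bdry W (surf_fun x) (surf_grad x), H1_bulk W (bulk_fun x) (bulk_grad x),
      trace_of W (bulk_fun x) (bulk_grad x) (bulk_trace x)
    & int_bdry W (fun y => surf_fun x y ^+ 2) + int_bulk W (fun y => bulk_fun x y ^+ 2) = 1].

Definition surf_dirichlet x := int_bdry W (fun y => dot (surf_grad x y) (surf_grad x y)).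
Definition surf_mass x := int_bdry W (fun y => surf_fun x y ^+ 2).
Definition bulk_mass x := int_bulk W (fun y => bulk_fun x y ^+ 2).

Definition exchange x := int_bdry W
  (fun y => kappa y * (Num.sqrt mu * surf_fun x y - Num.sqrt nu * bulk_trace x y) ^+ 2).

Definition static_energy x :=
  - int_bdry W (fun y => dv0 g y * surf_fun x y ^+ 2) + bulk_energy (bulk_fun x) (bulk_grad x) +
  exchange x.

Local Notation Lam := (lam admissible surf_dirichlet surf_mass bulk_mass static_energy d).

Lemma LambdaE D a : Lambda W d mu nu kappa f g D a = Lam D a.
Proof.
have aux (x G a2 u gi eb dv k : R) :
    x * G - (x * a2 * u + gi) + (eb - dv) + k = x * (G - a2 * u) + (- gi + eb + k) - dv by ring.
have E U GU U' GU' T : L2 Surf (bdry W) U -> L2 Leb W U' ->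
    energy W d mu nu kappa f g D a U GU U' GU' T =
    lam_form surf_dirichlet surf_mass bulk_mass static_energy d D a (State U GU U' GU' T).
  move=> LU LU'; rewrite /energy /lam_form /static_energy /exchange /surf_dirichlet /surf_mass /bulk_mass /=.
  rewrite energy_bulkE// /int_bdry (integ_shifted_coefficient mbW mg gC _ LU).
  exact: aux.
rewrite /Lambda /lam; congr inf; apply/seteqP; split=> x.
  move=> [U [GU [U' [GU' [T [HU HU' HT H1 ->]]]]]]; exists (State U GU U' GU' T) => //.
  by rewrite E//; [case: HU | case: HU'].
move=> [[U GU U' GU' T] [/= HU HU' HT H1] <-].
exists U, GU, U', GU', T; split=> //.
by rewrite E//; [case: HU | case: HU'].
Qed.

Lemma cstarE : cstar W d mu nu kappa f g =
  speed admissible surf_dirichlet surf_mass bulk_mass static_energy d.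
Proof.
apply/funext => D; rewrite /cstar /speed; congr inf; apply: eq_imagel => a _.
by rewrite LambdaE.
Qed.

Lemma surf_dirichlet_ge0 x : 0 <= surf_dirichlet x.
Proof. by apply: Rintegral_ge0 => y _; exact: dot_ge0. Qed.

Lemma surf_mass_ge0 x : 0 <= surf_mass x. Proof. exact: integ_sqr_ge0. Qed.

Lemma bulk_mass_ge0 x : 0 <= bulk_mass x. Proof. exact: integ_sqr_ge0. Qed.

Lemma exchange_ge0 x : 0 <= exchange x.
Proof.
rewrite /exchange /int_bdry /integ Rintegral_mkcond; apply: Rintegral_ge0 => y _.
rewrite patchE; case: ifPn => // /set_mem Wy.
by rewrite mulr_ge0 ?sqr_ge0//; exact: kappa_ge0.
Qed.

Lemma surf_reaction_le (k : R) x : (forall y, bdry W y -> dv0 g y <= k) -> admissible x ->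
  int_bdry W (fun y => dv0 g y * surf_fun x y ^+ 2) <= k * surf_mass x.
Proof. by move=> gk [[LU _ _] _ _ _]; exact: (integ_coefficient_le mbW mg gC). Qed.

Lemma static_energy_ge x : admissible x -> - (Cg + Cf) <= static_energy x.
Proof.
have aux (a b e u v : R) : 0 <= u -> 0 <= v -> u + v = 1 -> a <= Cg * u -> - Cf * v <= b -> 0 <= e ->
    - (Cg + Cf) <= - a + b + e.
  move=> u0 v0 uv ha hb he; have ev : v = 1 - u by rewrite -uv addrC addKr.
  have : 0 <= Cg * v by rewrite mulr_ge0.
  have : 0 <= Cf * u by rewrite mulr_ge0.
  by move: ha hb; rewrite ev mulrBr mulr1 mulrBr mulr1 mulNr; move: (Cg * u) (Cf * u) => p q; lra.
move=> Ax; have [HU HU' HT H1] := Ax.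
apply: (aux _ _ _ _ _ (surf_mass_ge0 x) (bulk_mass_ge0 x) H1).
- by apply: surf_reaction_le => // y Wy; exact: le_trans (ler_norm _) (gC Wy).
- rewrite /bulk_energy; apply: (@le_trans _ _ (- (Cf * bulk_mass x))); first by rewrite mulNr.
  apply: (@le_trans _ _ (- int_bulk W (fun y => dv0 f y * bulk_fun x y ^+ 2))).
    rewrite lerN2; have [LU' _ _] := HU'; apply: (integ_coefficient_le mW mf fC) => // y Wy.
    exact: le_trans (ler_norm _) (fC Wy).
  rewrite lerDr mulr_ge0 ?(ltW d_gt0)//; apply: Rintegral_ge0 => y _; exact: dot_ge0.
- exact: exchange_ge0.
Qed.

Let sigma := fine (surf (bdry W)).
Let vol := fine (leb W).

Definition constant_state (s t : R) : state :=
  State (fun=> s) (fun=> 0) (fun=> t) (grad (fun=> t)) (fun=> t).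

Lemma constant_state_surf_mass s t : surf_mass (constant_state s t) = s ^+ 2 * sigma.
Proof. exact: (integ_cst mbW (s ^+ 2)). Qed.

Lemma constant_state_bulk_mass s t : bulk_mass (constant_state s t) = t ^+ 2 * vol.
Proof. exact: (integ_cst mW (t ^+ 2)). Qed.

Lemma constant_state_surf_dirichlet s t : surf_dirichlet (constant_state s t) = 0.
Proof.
rewrite -(mul0r sigma) -(integ_cst mbW 0); congr integ; apply/funext => y.
by rewrite /= dot0l.
Qed.

Lemma constant_state_admissible s t : s ^+ 2 * sigma + t ^+ 2 * vol = 1 ->
  admissible (constant_state s t).
Proof.
move=> st; split.
- split; first by apply: continuous_L2_surf => //; exact: cst_continuous.
    move=> i /=; have -> : (fun _ : V => (0 : V) 0 i) = (fun=> 0) by apply/funext => y; rewrite mxE.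
    by apply: continuous_L2_surf => //; exact: cst_continuous.
  exists (fun _ _ => s); split=> [k| |i]; [exact: smooth_cst | exact: L2_cvg_cst |].
  have -> : (fun (k : nat) (x : V) => tangential_grad W (fun=> s) x 0 i) = (fun _ _ => 0).
    by apply/funext => k; apply/funext => y; rewrite tangential_grad_cst mxE.
  have -> : (fun x : V => surf_grad (constant_state s t) x 0 i) = (fun=> 0).
    by apply/funext => y; rewrite /= mxE.
  exact: L2_cvg_cst.
- by apply: H1_bulk_C1 => //; exact: smoothC1 (smooth_cst t).
- split; first by apply: continuous_L2_surf => //; exact: cst_continuous.
  exists (fun _ _ => t); split=> [k| |i|]; [exact: smooth_cst | exact: L2_cvg_cst | | exact: L2_cvg_cst].
  have -> : (fun x : V => bulk_grad (constant_state s t) x 0 i) = partial (fun=> t) i.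
    by apply/funext => y; rewrite /= mxE.
  exact: L2_cvg_cst.
- rewrite -st; congr (_ + _); [exact: constant_state_surf_mass | exact: constant_state_bulk_mass].
Qed.

Lemma constant_state_energy s t : s ^+ 2 * sigma + t ^+ 2 * vol = 1 ->
  static_energy (constant_state s t) <=
  Cg + Cf + Kk * ((Num.sqrt mu * s - Num.sqrt nu * t) ^+ 2 * sigma).
Proof.
have aux (a b e u v k : R) : 0 <= u -> 0 <= v -> u + v = 1 -> - Cg * u <= a -> - Cf * v <= b -> e <= k ->
    - a - b + e <= Cg + Cf + k.
  move=> u0 v0 uv ha hb he; have ev : v = 1 - u by rewrite -uv addrC addKr.
  have : 0 <= Cg * v by rewrite mulr_ge0.
  have : 0 <= Cf * u by rewrite mulr_ge0.
  by move: ha hb; rewrite ev !mulNr !mulrBr !mulr1; move: (Cg * u) (Cf * u) => p q; lra.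
move=> st; have [[LU _ _] [LU' _ _] _ H1] := constant_state_admissible st.
rewrite /static_energy /bulk_energy.
have -> : int_bulk W (fun y => dot (bulk_grad (constant_state s t) y) (bulk_grad (constant_state s t) y)) = 0.
  rewrite -(mul0r vol) -(integ_cst mW 0); congr integ; apply/funext => y.
  by rewrite /= grad_cst dot0l.
rewrite mulr0 add0r.
apply: (aux _ _ _ _ _ _ (surf_mass_ge0 _) (bulk_mass_ge0 (constant_state s t)) H1).
- apply: (integ_coefficient_ge mbW mg gC) => // y Wy; rewrite lerNl.
  by apply: le_trans (gC Wy); rewrite -normrN ler_norm.
- apply: (integ_coefficient_ge mW mf fC) => // y Wy; rewrite lerNl.
  by apply: le_trans (fC Wy); rewrite -normrN ler_norm.
- have -> : (Num.sqrt mu * s - Num.sqrt nu * t) ^+ 2 * sigma =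
      integ Surf (bdry W) (fun=> (Num.sqrt mu * s - Num.sqrt nu * t) ^+ 2).
    by rewrite (integ_cst mbW).
  apply: (@integ_coefficient_le _ _ _ _ mbW kappa Kk mk kC Kk (fun=> Num.sqrt mu * s - Num.sqrt nu * t)).
    by move=> y Wy; exact: le_trans (ler_norm _) (kC Wy).
  by apply: continuous_L2_surf => //; exact: cst_continuous.
Qed.

(* A convex combination of bulk_energy_ge and bulk_energy_gap, whose boundary term
   is absorbed by the exchange term near a point where kappa is positive. *)
Lemma static_energy_gap p (k theta : R) : bdry W p -> 0 < kappa p ->
  (forall e, 0 < e -> exists2 delta : R, 0 < delta &
    forall y, bdry W y -> ball p delta y -> kappa p - e <= kappa y) ->
  (forall y, bdry W y -> dv0 g y <= k) -> 0 < theta ->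
  exists2 e : R, 0 < e & forall x, admissible x ->
    - ((k + theta) * surf_mass x + (lambda - e) * bulk_mass x) <= static_energy x.
Proof.
have aux (l a be K tau u v q s eta k0 : R) : 0 <= s -> s <= 1 -> 0 <= u -> 0 <= v ->
    a <= k * u -> - l * v <= be -> (q - l) * v <= be + tau ->
    k0 * eta * (2^-1 * (nu * tau) - mu * u) <= K -> s = k0 * eta * nu / 2 -> k0 * eta * mu <= theta ->
    - ((k + theta) * u + (l - s * q) * v) <= - a + be + K.
  move=> s0 s1 u0 v0 ha hb1 hb2 hK hs ht.
  have h1 : 0 <= s * (be + tau - (q - l) * v) by rewrite mulr_ge0 ?subr_ge0.
  have h2 : 0 <= (1 - s) * (be - - l * v) by rewrite mulr_ge0 ?subr_ge0.
  have h3 : 0 <= (theta - k0 * eta * mu) * u by rewrite mulr_ge0 ?subr_ge0.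
  have h4 : 0 <= k * u - a by rewrite subr_ge0.
  have h5 : 0 <= K - k0 * eta * (2^-1 * (nu * tau) - mu * u) by rewrite subr_ge0.
  rewrite -subr_ge0 (_ : _ - _ = s * (be + tau - (q - l) * v) + (1 - s) * (be - - l * v) +
    (theta - k0 * eta * mu) * u + (k * u - a) + (K - k0 * eta * (2^-1 * (nu * tau) - mu * u)) +
    (k0 * eta * nu / 2 - s) * tau); last by field.
  rewrite -hs subrr mul0r addr0.
  exact: addr_ge0 (addr_ge0 (addr_ge0 (addr_ge0 h1 h2) h3) h4) h5.
have sq_le (a b : R) :
    (Num.sqrt mu * a - Num.sqrt nu * b) ^+ 2 <= 2 * mu * a ^+ 2 + 2 * nu * b ^+ 2.
  rewrite -{2}(sqr_sqrtr (ltW mu_gt0)) -{2}(sqr_sqrtr (ltW nu_gt0)) -subr_ge0.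
  by rewrite (_ : _ - _ = (Num.sqrt mu * a + Num.sqrt nu * b) ^+ 2) ?sqr_ge0//; ring.
have kappa_half (a b : R) : a - a / 2 <= b -> a / 2 <= b by lra.
have young (a b : R) : 2^-1 * b ^+ 2 - a ^+ 2 <= (a - b) ^+ 2.
  rewrite -subr_ge0 (_ : _ - _ = 2^-1 * (2 * a - b) ^+ 2); last by field.
  by rewrite mulr_ge0 ?sqr_ge0// invr_ge0.
move=> bp kp Hk gk t0; pose k0 := kappa p / 2.
have k00 : 0 < k0 by rewrite divr_gt0.
have [delta d0 Hd] := Hk k0 k00.
have [q q0 Hq] := bulk_energy_gap bp d0.
(* Only the fraction eta of the exchange is used. By (a - b)^2 >= b^2/2 - a^2 it yields s = k0 eta
   nu / 2 times the trace mass near p and costs k0 eta mu times the surface mass. The bounds on eta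
   keep k0 eta below kappa near p, the cost below theta, and s <= 1 for the convex combination. *)
pose eta := Num.min 1 (Num.min (theta / (k0 * mu)) (2 / (k0 * nu))).
have eta0 : 0 < eta by rewrite !lt_min ltr01 /= !divr_gt0// mulr_gt0.
have eta1 : eta <= 1 by rewrite ge_min lexx.
have etat : k0 * eta * mu <= theta.
  rewrite mulrAC mulrC -ler_pdivlMr ?mulr_gt0//.
  by rewrite !ge_min lexx orbT.
pose s := k0 * eta * nu / 2.
have s0 : 0 < s by rewrite /s !divr_gt0 ?mulr_gt0.
have s1 : s <= 1.
  rewrite ler_pdivrMr// mul1r mulrAC mulrC -ler_pdivlMr ?mulr_gt0//.
  by rewrite !ge_min lexx !orbT.
exists (s * q); first by rewrite mulr_gt0.
move=> x Ax; have [[LU _ _] HU' HT _] := Ax; have [LT _] := HT.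
pose ind : V -> R := \1_(ball p delta).
have mind : measurable_fun (bdry W : set surfT) ind.
  apply: (@measurable_indic _ _ _ (bdry W : set surfT)).
  by apply: (open_cara_measurable measurable_halfspace_hausdorff); exact: ball_open.
have ind01 y : 0 <= ind y <= 1 by rewrite /ind indicE; case: (_ \in _); rewrite /= ?lexx ler01.
have indC y : bdry W y -> `|ind y| <= 1 by move=> _; have /andP[i0 i1] := ind01 y; rewrite ger0_norm.
apply: (aux _ _ _ _ (int_bdry W (fun y => ind y * bulk_trace x y ^+ 2)) _ _ _ _ eta k0 (ltW s0) s1
  (surf_mass_ge0 x) (bulk_mass_ge0 x)) => //.
- exact: surf_reaction_le.
- exact: bulk_energy_ge.
- exact: Hq.
have I1 := L2_mul_integrable mbW mind indC LT; have I2 := L2_mul_integrable mbW mind indC LU.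
have I3 := integrableZl mbW (2^-1 * nu) I1; have I4 := integrableZl mbW mu I2.
have I5 := integrableB mbW I3 I4; have I6 := integrableZl mbW (k0 * eta) I5.
pose K y := (Num.sqrt mu * surf_fun x y - Num.sqrt nu * bulk_trace x y).
have LK : L2 Surf (bdry W) K.
  have mK : measurable_fun (bdry W : set surfT) K.
    have [mU _] := LU; have [mT _] := LT.
    exact: (measurable_funB (measurable_funM (measurable_cst (Num.sqrt mu)) mU)
      (measurable_funM (measurable_cst (Num.sqrt nu)) mT)).
  have I7 := L2_sqr_integrable LU; have I8 := L2_sqr_integrable LT.
  have I9 := integrableD mbW (integrableZl mbW (2 * mu) I7) (integrableZl mbW (2 * nu) I8).
  suff IK : surf.-integrable (bdry W) (EFin \o (fun y => K y ^+ 2)) by split=> //; rewrite sqintE// ltry.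
  apply: (@le_integrable _ surfT R surf _ mbW _ _ _ _ I9).
    by apply/measurable_EFinP; apply: measurable_funX.
  move=> y Wy /=; rewrite lee_fin ger0_norm ?sqr_ge0// ger0_norm.
    exact: sq_le.
  by rewrite addr_ge0// mulr_ge0 ?sqr_ge0// mulr_ge0// ltW.
have IK := L2_mul_integrable mbW mk kC LK.
apply: (@le_trans _ _ (integ Surf (bdry W) (fun y => k0 * eta *
    (2^-1 * nu * (ind y * bulk_trace x y ^+ 2) - mu * (ind y * surf_fun x y ^+ 2))))).
  rewrite /integ (RintegralZl _ mbW I5) (RintegralB mbW I3 I4) (RintegralZl _ mbW I1) (RintegralZl _ mbW I2).
  apply: ler_wpM2l; first by rewrite mulr_ge0// ltW.
  rewrite mulrA lerD2l lerN2; apply: ler_wpM2l; first exact: ltW.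
  rewrite -[surf_mass x]mul1r; apply: (integ_coefficient_le mbW mind indC) => // y _.
  by have /andP[] := ind01 y.
apply: (@le_Rintegral _ surfT R surf _ _ _ mbW I6 IK) => y Wy.
have [/mem_set yb|nyb] := pselect (ball p delta y); last first.
  rewrite /ind indicE memNset// !mul0r !mulr0 subrr mulr0.
  by rewrite mulr_ge0 ?sqr_ge0//; exact: kappa_ge0.
have ky : k0 <= kappa y.
  exact: kappa_half (Hd y Wy (set_mem yb)).
rewrite /ind indicE yb !mul1r.
have := young (Num.sqrt mu * surf_fun x y) (Num.sqrt nu * bulk_trace x y); rewrite -/(K y).
rewrite !exprMn !sqr_sqrtr ?(ltW mu_gt0) ?(ltW nu_gt0)// mulrA => Ky.
apply: (@le_trans _ _ (k0 * eta * K y ^+ 2)).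
  by apply: ler_wpM2l => //; rewrite mulr_ge0// ltW.
apply: ler_wpM2r; first exact: sqr_ge0.
by apply: le_trans ky; rewrite ler_piMr// ltW.
Qed.

Lemma surf_bdry_gt0 p : bdry W p -> 0 < sigma.
Proof.
move=> bp; rewrite fine_gt0// (sweep_bdry_gt0 bp) /=.
exact: hausdorff_bdry_lty.
Qed.

Lemma vol_gt0 : 0 < vol.
Proof. by rewrite fine_gt0// leb_domain_gt0 leb_bounded_lty. Qed.

End energies.

(** * Choice of constants and conclusion *)

Theorem theorem3p1 (R : realType) (N : nat) (omega : set 'rV[R]_N)
  (d mu nu r : R) (kappa : 'rV[R]_N -> R) (f g : 'rV[R]_N -> R -> R)
  (N_ge1 : (1 <= N)%N)
  (omega_open : open omega) (omega_bounded : bounded_set omega)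
  (omega_connected : connected omega) (omega_smooth : smooth_boundary omega)
  (d_gt0 : 0 < d) (mu_gt0 : 0 < mu) (nu_gt0 : 0 < nu) (r01 : 0 < r < 1)
  (kappa_C1r : C1r_bdry r omega (fun y _ => kappa y))
  (kappa_ge0 : forall y, bdry omega y -> 0 <= kappa y)
  (kappa_neq0 : exists2 y, bdry omega y & kappa y != 0)
  (f_C1r : C1r r omega f) (g_C1r : C1r_bdry r omega g)
  (f0 : forall y, omega y -> f y 0 = 0)
  (g0 : forall y, bdry omega y -> g y 0 = 0)
  (f_decr : forall y (v w : R), omega y -> 0 < v -> v < w -> f y w / w < f y v / v)
  (g_noninc : forall y (u w : R), bdry omega y -> 0 < u -> u <= w ->
    g y w / w <= g y u / u)
  (fg_sat : exists2 M : R, 0 < M & forall u v, M <= u -> M <= v ->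
    (forall y, omega y -> f y v <= 0) /\ (forall y, bdry omega y -> g y u <= 0))
  (sup_Lambda_lt0 : sup [set Lambda omega d mu nu kappa f g D 0
                        | D in [set D : R | 0 < D]] < 0)
  (Lambda_f_lt0 : Lambda_f omega d f 0 < 0) :
  (exists c0 : R,
     cstar omega d mu nu kappa f g D @[D --> 0^'+] --> c0 /\
     (sup [set dv0 g y | y in bdry omega] < - (2 * Lambda_f omega d f 0) ->
      0 < c0 /\ c0 < cstar_f omega d f)) /\
  (cstar omega d mu nu kappa f g D @[D --> +oo] --> +oo /\
   exists A B : R, [/\ 0 < A, 0 < B
     & \forall D \near +oo,
         A * Num.sqrt D <= cstar omega d mu nu kappa f g D <= B * Num.sqrt D]).
Proof.
destruct N as [|n]; first by [].
have /andP[r0 _] := r01; have [p bp kp_neq0] := kappa_neq0.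
have kp : 0 < kappa p by rewrite lt_neqAle eq_sym kp_neq0 kappa_ge0.
have bB := bounded_bdry omega_bounded.
have compB := compact_bdry omega_bounded.
have mf := cara_measurable_fun_continuous_on measurable_halfspace_lebesgue omega_open
  (C1r_dv0_continuous omega_open r0 f_C1r).
have [Cf Cf0 fC] := C1r_dv0_bounded (ltW r0) f_C1r omega_bounded (@subset_refl _ omega).
have [mg [Cg Cg0 gC]] := C1r_bdry_dv0 (@measurable_halfspace_hausdorff R n.+1 n) r0 bB g_C1r.
have [mk [Kk Kk0 kC] kloc] :=
  C1r_bdry_coefficient (@measurable_halfspace_hausdorff R n.+1 n) r0 compB kappa_C1r.
have vol0 := vol_gt0 omega_open omega_bounded Lambda_f_lt0.
have sig0 := surf_bdry_gt0 omega_open omega_bounded omega_smooth Lambda_f_lt0 bp.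
set vol := fine _ in vol0; set sig := fine _ in sig0.
(* The constants s on the surface and t in the bulk give two states of unit mass, one carried by
   each component; sig and vol are positive. *)
pose s := Num.sqrt sig^-1; pose t := Num.sqrt vol^-1.
have s2 : s ^+ 2 = sig^-1 by rewrite sqr_sqrtr// invr_ge0 ltW.
have t2 : t ^+ 2 = vol^-1 by rewrite sqr_sqrtr// invr_ge0 ltW.
have es : s ^+ 2 * sig = 1 by rewrite s2 mulVf// gt_eqF.
have et : t ^+ 2 * vol = 1 by rewrite t2 mulVf// gt_eqF.
have e1 : s ^+ 2 * sig + 0 ^+ 2 * vol = 1.
  by rewrite es expr0n mul0r addr0.
have e2 : 0 ^+ 2 * sig + t ^+ 2 * vol = 1.
  by rewrite et expr0n mul0r add0r.
have q0 : 0 <= nu * sig / vol by apply: divr_ge0; [apply: mulr_ge0; exact: ltW | exact: ltW].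
(* The exchange energy is at most Kk mu for the surface state and Kk nu sig / vol for the bulk one.
   The same C bounds the static energy from below on all admissible states. *)
pose C := Cg + Cf + Kk * (mu + nu * sig / vol).
have CC : Cg + Cf <= C by rewrite lerDl; apply: mulr_ge0 => //; apply: addr_ge0 => //; exact: ltW.
have C0 : 0 <= C by apply: le_trans CC; rewrite addr_ge0.
have A1 := constant_state_admissible omega_open omega_bounded omega_smooth e1.
have A2 := constant_state_admissible omega_open omega_bounded omega_smooth e2.
have E1 := constant_state_energy omega_open omega_bounded omega_smooth d mu nu mf fC mg gC mk kC Cf0 Cg0 e1.
have E2 := constant_state_energy omega_open omega_bounded omega_smooth d mu nu mf fC mg gC mk kC Cf0 Cg0 e2.
have {}E1 : static_energy omega d mu nu kappa f g (constant_state s 0) <= C.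
  apply: le_trans E1 _; rewrite lerD2l; apply: ler_wpM2l => //.
  rewrite mulr0 subr0 exprMn sqr_sqrtr ?(ltW mu_gt0)// -[leLHS]mulrA [X in mu * X]es mulr1.
  by rewrite lerDl.
have {}E2 : static_energy omega d mu nu kappa f g (constant_state 0 t) <= C.
  apply: le_trans E2 _; rewrite lerD2l; apply: ler_wpM2l => //.
  rewrite mulr0 sub0r sqrrN exprMn sqr_sqrtr ?(ltW nu_gt0)// t2 mulrAC.
  by rewrite lerDr ltW.
have Eg x : admissible omega x -> - C <= static_energy omega d mu nu kappa f g x.
  move=> Ax; apply: le_trans (static_energy_ge omega_open mu nu d_gt0 mf fC mg gC kappa_ge0 Cf0 Cg0 Ax).
  by rewrite lerN2.
have u1 := constant_state_surf_mass omega s 0; have u2 := constant_state_surf_mass omega 0 t.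
have v1 := constant_state_bulk_mass omega_open s 0; have v2 := constant_state_bulk_mass omega_open 0 t.
have {}u1 : surf_mass omega (constant_state s 0) = 1 by rewrite u1; exact: es.
have {}v2 : bulk_mass omega (constant_state 0 t) = 1 by rewrite v2; exact: et.
rewrite expr0n mul0r in u2; rewrite expr0n mul0r in v1.
have g1 := constant_state_surf_dirichlet omega s 0; have g2 := constant_state_surf_dirichlet omega 0 t.
have G0 x : admissible omega x -> 0 <= surf_dirichlet omega x by move=> _; exact: surf_dirichlet_ge0.
have U0 x : admissible omega x -> 0 <= surf_mass omega x by move=> _; exact: surf_mass_ge0.
have V0 x : admissible omega x -> 0 <= bulk_mass omega x by move=> _; exact: bulk_mass_ge0.
have UV x : admissible omega x -> surf_mass omega x + bulk_mass omega x = 1 by case.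
have supl : sup [set lam (admissible omega) (surf_dirichlet omega) (surf_mass omega) (bulk_mass omega)
    (static_energy omega d mu nu kappa f g) d D 0 | D in [set D : R | 0 < D]] < 0.
  move: sup_Lambda_lt0; congr (sup _ < 0); apply: eq_imagel => D _.
  exact: (LambdaE omega_open d mu nu kappa mf fC mg gC).
rewrite (cstarE omega_open d mu nu kappa mf fC mg gC).
have [A A0 HA] := speed_ge_sqrt d_gt0 C0 G0 U0 V0 UV Eg A1 g1 u1 v1 E1 supl.
have [B B0 HB] := speed_le_sqrt d_gt0 C0 G0 U0 V0 UV Eg A1 supl.
have [c0 c00 Hc0] := speed_cvg0 d_gt0 C0 G0 U0 V0 UV Eg A1 A2 g2 u2 v2 E2 supl.
split.
  exists c0; split=> // gsmall; split=> //.
  pose l := - Lambda_f omega d f 0; have l0 : 0 < l by rewrite oppr_gt0.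
  (* The minimizer of (l + d a^2) / a, where this quotient equals 2 l / a. *)
  pose a := Num.sqrt (l / d); have a0 : 0 < a by rewrite sqrtr_gt0 divr_gt0.
  have da : d * a ^+ 2 = l by rewrite sqr_sqrtr ?divr_ge0 ?ltW// mulrC divfK// gt_eqF.
  have gk y : bdry omega y -> dv0 g y <= sup [set dv0 g y | y in bdry omega].
    move=> By; apply: ub_le_sup; last by exists y.
    by exists Cg => _ [z Bz <-]; exact: le_trans (ler_norm _) (gC z Bz).
  have kl : sup [set dv0 g y | y in bdry omega] < 2 * l by rewrite /l mulrN.
  have gap theta (theta0 : 0 < theta) := static_energy_gap omega_open omega_bounded omega_connected
    omega_smooth d_gt0 mu_gt0 nu_gt0 mf fC mg gC mk kC kappa_ge0 Lambda_f_lt0 bp kp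
    (fun e e0 => kloc p e bp e0) gk theta0.
  have [e e0 He] := speed_small_le d_gt0 G0 U0 V0 UV Eg A1 supl l0 a0 da kl gap.
  apply: (@le_lt_trans _ _ ((2 * l - e) / a)).
    exact: (cvgr_to_le Hc0 He).
  apply: (@lt_le_trans _ _ (2 * l / a)).
    by rewrite ltr_pM2r ?invr_gt0// ltrBlDr ltrDl.
  exact: (cstar_f_ge omega_open d_gt0 mf fC Lambda_f_lt0 a0 da).
split.
  apply/cvgryPge => M; near=> D.
  have D0 : 0 < D by near: D; exact: nbhs_pinfty_gt.
  apply: le_trans (HA D D0); rewrite mulrC -ler_pdivrMr//.
  apply: le_trans (ler_norm _) _; rewrite -sqrtr_sqr; apply: ler_wsqrtr.
  by near: D; apply: nbhs_pinfty_ge; exact: num_real.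
exists A, B; split=> //; near=> D.
have D1 : 1 <= D by near: D; apply: nbhs_pinfty_ge; exact: num_real.
by rewrite HA ?HB// (lt_le_trans ltr01).
Unshelve. all: by end_near. Qed.
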